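(* Let $G$ be a compact connected Lie group, let $\Omega$ be a $G$-bundle over $(M,\mathcal{A})$ with projection $\pi$ and trivializations $\psi_U$, let $\mu$ be a compatible probability measure on $\Omega$ and $(g_t)_{t\in\mathbb{R}}$ a compatible flow with velocities $v_U:U\to Lie(G)$. Let $T$ be a maximal torus of $G$, $R=\dim T$, $\chi:T\to\mathbb{T}^R$ an isomorphism of Lie groups, and $h:Lie(G)\to G$ a measurable map such that $H_v\subset h(v)T h(v)^{-1}$ for all $v\in Lie(G)$. For $U\in\mathcal{A}$ and $x\in U$ put $w_U(x)=D\chi(e)\big(Ad_{h(v_U(x))^{-1}}(v_U(x))\big)\in\mathbb{R}^R$, and for nonzero $\xi\in\mathbb{Z}^R$ let $\nu^{(\xi,U)}$ be the push-forward of $\mu'_{|U}$ under $x\mapsto\langle\xi|w_U(x)\rangle$, where $\mu'=\mu_\pi$. Then $(\Omega,\mu,(g_t)_{t\in\mathbb{R}})$ exhibits Keplerian shear if and only if for all nonzero $\xi\in\mathbb{Z}^R$ and all $U\in\mathcal{A}$, the restriction $\nu^{(\xi,U)}_{|\mathbb{R}^*}$ is Rajchman, where $\mathbb{R}^*=\mathbb{R}\setminus\{0\}$.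
   Context: $\mathbb{T}=\mathbb{R}/\mathbb{Z}$; $e$ is the neutral element of $G$; $\langle\cdot|\cdot\rangle$ is the Euclidean inner product. $G$-bundle: $M$ is an $n$-dimensional Lindelöf $\mathcal{C}^1$ manifold with atlas $\mathcal{A}$ (elements identified with chart domains $U\subset M$), $\Omega$ is a topological space with its Borel $\sigma$-algebra and a Borel probability measure $\mu$, $\pi:\Omega\to M$ is continuous, and for each $U\in\mathcal{A}$ there is a homeomorphism $\psi_U:\pi^{-1}(U)\to U\times G$ with $\pi_1\circ\psi_U=\pi_{|\pi^{-1}(U)}$, where $\pi_1$ is the first projection. Compatible flow: for all $U\in\mathcal{A}$ there is a measurable $v_U:U\to Lie(G)$ such that $\psi_U\circ g_t\circ\psi_U^{-1}(x,y)=(x,\exp(tv_U(x))y)$ for all $t\in\mathbb{R}$, $(x,y)\in U\times G$. Compatible measure: $\mu'=\mu_\pi$ is the push-forward of $\mu$ by $\pi$; for every $U\in\mathcal{A}$ the push-forward of $\mu_{|\pi^{-1}(U)}$ by $\psi_U$ equals $\mu'_{|U}\otimes\mathcal{H}$ with $\mathcal{H}$ the normalized Haar measure on $G$. For $v\in Lie(G)$, $H_v=\overline{\{\exp(tv):t\in\mathbb{R}\}}$. $Ad_g(v)=\frac{d}{dt}\,g\exp(tv)g^{-1}\big|_{t=0}$. $D\chi(e):Lie(T)\to\mathbb{R}^R$ is the differential of $\chi$ at $e$. $\mathcal{I}=\{A\text{ measurable}:\forall t\in\mathbb{R},\ \mu(A\,\Delta\, g_t^{-1}(A))=0\}$. Keplerian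 shear: for all $f\in L^2_\mu(\Omega)$, $f\circ g_t\rightharpoonup\mathbb{E}_\mu(f|\mathcal{I})$ weakly in $L^2_\mu(\Omega)$ as $t\to+\infty$. A finite measure $\nu$ on $\mathbb{R}$ is Rajchman if $\int e^{2i\pi tx}d\nu(x)\to0$ as $t\to\pm\infty$. *)

(* Defs.v *)
From HB Require Import structures.
From mathcomp Require Import all_boot all_order all_algebra.
From mathcomp Require Import all_classical all_reals all_analysis.
Import Order.TTheory GRing.Theory Num.Theory.
Import numFieldNormedType.Exports.

Set Implicit Arguments.
Unset Strict Implicit.
Unset Printing Implicit Defensive.

Local Open Scope classical_set_scope.
Local Open Scope ring_scope.

(* The carrier [X] with the sigma-algebra generated by its open sets.  The
   library wants measurable types to be pointed, hence [ptopologicalType]; all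
   the spaces below are nonempty. *)
Notation borel X := (g_sigma_algebraType (@open X)).

Definition restr {T : Type} {R : realType} (m : set T -> \bar R) (D : set T) :
  set T -> \bar R := fun A => m (A `&` D).

(* Real and imaginary parts of the integral of exp (2 i pi t x) against [nu]. *)
Definition fourier_cos {R : realType} (nu : set R -> \bar R) (t : R) : \bar R :=
  (\int[nu]_x (cos (2 * pi * t * x))%:E)%E.

Definition fourier_sin {R : realType} (nu : set R -> \bar R) (t : R) : \bar R :=
  (\int[nu]_x (sin (2 * pi * t * x))%:E)%E.

Definition rajchman {R : realType} (nu : set R -> \bar R) : Prop :=
  [/\ fourier_cos nu t @[t --> +oo] --> 0%E,
      fourier_sin nu t @[t --> +oo] --> 0%E,
      fourier_cos nu t @[t --> -oo] --> 0%E &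
      fourier_sin nu t @[t --> -oo] --> 0%E].

(* Meaningful for open [D]. *)
Fixpoint Ck_on {R : realType} {m n : nat} (k : nat) (D : set 'rV[R]_m)
    (f : 'rV[R]_m -> 'rV[R]_n) : Prop :=
  if k is j.+1 then
    (forall x, D x -> differentiable f x) /\
    (forall u : 'rV[R]_m, Ck_on j D (fun x => 'd f x u))
  else {within D, continuous f}.

Definition homeo_on {X Y : topologicalType} (A : set X) (B : set Y)
    (f : X -> Y) : Prop :=
  [/\ set_bij A B f, {within A, continuous f} &
      exists2 g : Y -> X, (forall x, A x -> g (f x) = x) &
                          {within B, continuous g}].

(* A family of charts; [coord U] is meaningful on [dom U] only. *)
Record atlas (R : realType) (X : topologicalType) (n : nat) := Atlas {
  chart :> Type;
  dom : chart -> set X;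
  coord : chart -> X -> 'rV[R]_n }.

Arguments dom {R X n} _ _.
Arguments coord {R X n} _ _ _.

Definition Ck_manifold {R : realType} {X : topologicalType} {n : nat} (k : nat)
    (A : atlas R X n) : Prop :=
  [/\ hausdorff_space X,
      (forall x, exists U, dom A U x),
      (forall U, [/\ open (dom A U), open (coord A U @` dom A U) &
         homeo_on (dom A U) (coord A U @` dom A U) (coord A U)]) &
      (forall U V, exists2 g : 'rV[R]_n -> 'rV[R]_n,
         Ck_on k (coord A U @` (dom A U `&` dom A V)) g &
         forall x, (dom A U `&` dom A V) x -> coord A V x = g (coord A U x))].

Definition smooth_manifold {R : realType} {X : topologicalType} {n : nat}
    (A : atlas R X n) : Prop := forall k, Ck_manifold k A.

(* [f] is of class C^oo on the open set [D]. *)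
Definition smooth_on {R : realType} {X Y : topologicalType} {m n : nat}
    (A : atlas R X m) (B : atlas R Y n) (D : set X) (f : X -> Y) : Prop :=
  {within D, continuous f} /\
  forall k U V, let W := dom A U `&` D `&` f @^-1` dom B V in
    exists2 g : 'rV[R]_m -> 'rV[R]_n, Ck_on k (coord A U @` W) g &
      forall x, W x -> coord B V (f x) = g (coord A U x).

Definition prod_atlas {R : realType} {X Y : topologicalType} {m n : nat}
    (A : atlas R X m) (B : atlas R Y n) : atlas R (X * Y)%type (m + n) :=
  @Atlas R (X * Y)%type (m + n) (chart A * chart B)%type
    (fun U => dom A U.1 `*` dom B U.2)
    (fun U p => row_mx (coord A U.1 p.1) (coord B U.2 p.2)).

Definition vec_atlas (R : realType) (n : nat) : atlas R 'rV[R]_n n :=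
  @Atlas R 'rV[R]_n n unit (fun _ => setT) (fun _ x => x).

Definition lindelof (X : topologicalType) : Prop :=
  forall F : set (set X), F `<=` open -> \bigcup_(O in F) O = setT ->
  exists F' : set (set X),
    [/\ F' `<=` F, countable F' & \bigcup_(O in F') O = setT].

(* No compatibility is built in; it comes from [lie_group]. *)
#[short(type="topGroupType")]
HB.structure Definition TopGroup := {G of Group G & PointedTopological G}.

Definition lie_group {R : realType} {G : topGroupType} {d : nat}
    (AG : atlas R G d) : Prop :=
  [/\ smooth_manifold AG,
      smooth_on (prod_atlas AG AG) AG setT (fun p : G * G => (p.1 * p.2)%g) &
      smooth_on AG AG setT (fun a : G => (a^-1)%g)].

Definition haar_probability {R : realType} {G : topGroupType}
    (m : probability (borel G) R) : Prop :=
  forall (a : G) (A : set (borel G)), measurable A ->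
    m ((fun b : G => (a * b)%g) @^-1` A) = m A.

(* Lie(G) is the tangent space at the neutral element; a chart [E] around that
   element identifies it with 'rV_d, a tangent vector being represented by its
   coordinates in [E].  The exponential map is the map such that, for every [v],
   t |-> exp (t v) is the one-parameter subgroup with velocity [v] at 0. *)
Definition lie_exponential {R : realType} {G : topGroupType} {d : nat}
    (AG : atlas R G d) (E : AG) (ex : 'rV[R]_d -> G) : Prop :=
  forall v : 'rV[R]_d,
  [/\ (forall s t : R, ex ((s + t) *: v) = (ex (s *: v) * ex (t *: v))%g),
      continuous (fun t : R => ex (t *: v)) &
      is_derive (0 : R) (1 : R) (fun t : R => coord AG E (ex (t *: v))) v].

Definition Ad {R : realType} {G : topGroupType} {d : nat}
    (AG : atlas R G d) (E : AG) (ex : 'rV[R]_d -> G) (a : G) (v : 'rV[R]_d) :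
    'rV[R]_d :=
  derive1 (fun t : R => coord AG E (a * ex (t *: v) * a^-1)%g) 0.

Definition orbit_closure {R : realType} {G : topGroupType} {d : nat}
    (ex : 'rV[R]_d -> G) (v : 'rV[R]_d) : set G :=
  closure (range (fun t : R => ex (t *: v))).

Definition subgroup {G : topGroupType} (S : set G) : Prop :=
  S 1%g /\ forall a b, S a -> S b -> S (a * b^-1)%g.

(* In a Lie group, compact subgroups are Lie subgroups. *)
Definition torus {G : topGroupType} (S : set G) : Prop :=
  [/\ subgroup S, compact S, connected S &
      forall a b, S a -> S b -> (a * b)%g = (b * a)%g].

Definition maximal_torus {G : topGroupType} (S : set G) : Prop :=
  torus S /\ forall S', torus S' -> S `<=` S' -> S' = S.

(* R / Z and its r-fold power, as additive groups.  Smoothness of maps from and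
   to the power is expressed through the projection [to_circles], which is a
   local diffeomorphism. *)
Notation circle R :=
  (Quotient.quot ((@Num.int_num_subdef R : {pred R}) : zmodClosed R)).

Definition to_circle {R : realType} (x : R) : circle R := (\pi x)%qT.

Definition to_circles {R : realType} {r : nat} (x : 'rV[R]_r) :
  'rV[circle R]_r := map_mx to_circle x.

(* Coordinate of R / Z around 0: the representative in [-1/2, 1/2[. *)
Definition circle_coord {R : realType} (z : circle R) : R :=
  let a : R := repr z in a - (Num.floor (a + 2^-1))%:~R.

(* [chi], used on [S] only, is an isomorphism of Lie groups from [S] onto the
   r-dimensional torus.  It is smooth on the submanifold [S]: locally it is
   induced by a smooth map on an open subset of G.  The map [q] is the inverse
   of [chi] composed with the projection. *)
Definition torus_iso {R : realType} {G : topGroupType} {d r : nat}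
    (AG : atlas R G d) (S : set G) (chi : G -> 'rV[circle R]_r) : Prop :=
  [/\ set_bij S setT chi,
      (forall a b, S a -> S b -> chi (a * b)%g = chi a + chi b),
      (forall a, S a -> exists (O : set G) (F : G -> 'rV[R]_r),
         [/\ open O, O a, smooth_on AG (vec_atlas R r) O F &
             forall b, (S `&` O) b -> chi b = to_circles (F b)]) &
      (exists q : 'rV[R]_r -> G, smooth_on (vec_atlas R r) AG setT q /\
         forall x, S (q x) /\ chi (q x) = to_circles x)].

(* Differential of [chi] at the neutral element, evaluated at a tangent vector
   [u] of [S], as the velocity of the image of the curve t |-> exp (t u). *)
Definition Dchi {R : realType} {G : topGroupType} {d r : nat}
    (ex : 'rV[R]_d -> G) (chi : G -> 'rV[circle R]_r) (u : 'rV[R]_d) :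
    'rV[R]_r :=
  derive1 (fun t : R => map_mx circle_coord (chi (ex (t *: u)))) 0.

Definition dot_int {R : realType} {r : nat} (xi : 'rV[int]_r) (w : 'rV[R]_r) :
  R := \sum_(i < r) (xi ord0 i)%:~R * w ord0 i.

Definition g_bundle {R : realType} {M : topologicalType} {n : nat}
    (A : atlas R M n) {G : topGroupType} {Omega : topologicalType}
    (proj : Omega -> M) (psi : A -> Omega -> M * G) : Prop :=
  continuous proj /\
  forall U : A,
    homeo_on (proj @^-1` dom A U) (dom A U `*` [set: G]) (psi U) /\
    (forall o, dom A U (proj o) -> (psi U o).1 = proj o).

Definition flow {R : realType} {Omega : ptopologicalType}
    (g : R -> Omega -> Omega) : Prop :=
  [/\ (forall o, g 0 o = o), (forall s t o, g (s + t) o = g s (g t o)) &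
      forall t, measurable_fun setT (g t : borel Omega -> borel Omega)].

(* The point [o] below is the inverse image of [(x, y)] under [psi U]. *)
Definition compatible_flow {R : realType} {M : ptopologicalType} {n d : nat}
    (A : atlas R M n) {G : topGroupType} {Omega : ptopologicalType}
    (ex : 'rV[R]_d -> G) (proj : Omega -> M) (psi : A -> Omega -> M * G)
    (g : R -> Omega -> Omega) (v : A -> M -> 'rV[R]_d) : Prop :=
  forall U : A,
    measurable_fun (dom A U : set (borel M))
      (v U : borel M -> borel 'rV[R]_d) /\
    forall (t : R) (x : M) (y : G) (o : Omega),
      dom A U x -> dom A U (proj o) -> psi U o = (x, y) ->
      dom A U (proj (g t o)) /\ psi U (g t o) = (x, (ex (t *: v U x) * y)%g).

(* The product sigma-algebra of the Borel sigma-algebras of M and G is the Borel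
   sigma-algebra of M * G, since M and G are second countable. *)
Definition compatible_measure {R : realType} {M : ptopologicalType} {n : nat}
    (A : atlas R M n) {G : topGroupType} {Omega : ptopologicalType}
    (proj : Omega -> M) (psi : A -> Omega -> M * G)
    (haar : probability (borel G) R) (mu : probability (borel Omega) R) : Prop :=
  forall (U : A) (B : set (borel M * borel G)), measurable B ->
    pushforward (restr mu (proj @^-1` dom A U))
      (psi U : borel Omega -> borel M * borel G) B =
    (restr (pushforward mu (proj : borel Omega -> borel M)) (dom A U) \x haar)%E
      B.

Definition invariant_sets {R : realType} {Omega : ptopologicalType}
    (mu : probability (borel Omega) R) (g : R -> Omega -> Omega) :
    set (set (borel Omega)) :=
  [set A : set (borel Omega) | measurable A /\
    forall t : R, mu (A `+` ((g t : borel Omega -> borel Omega) @^-1` A)) = 0%E].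

Definition is_cond_expectation {d : measure_display} {T : measurableType d}
    {R : realType} (mu : probability T R) (I : set (set T)) (f e : T -> R) :
    Prop :=
  [/\ (forall B : set R, measurable B -> I (e @^-1` B)),
      mu.-integrable setT (EFin \o e) &
      forall A, I A -> (\int[mu]_(x in A) (e x)%:E =
                        \int[mu]_(x in A) (f x)%:E)%E].

Definition weak_L2_cvg {d : measure_display} {T : measurableType d}
    {R : realType} (mu : probability T R) (f : R -> T -> R) (e : T -> R) : Prop :=
  e \in Lfun mu 2%:E /\
  forall phi : T -> R, phi \in Lfun mu 2%:E ->
    (\int[mu]_x (f t x * phi x)%:E)%E @[t --> +oo] -->
    (\int[mu]_x (e x * phi x)%:E)%E.

Definition keplerian_shear {R : realType} {Omega : ptopologicalType}
    (mu : probability (borel Omega) R) (g : R -> Omega -> Omega) : Prop :=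
  forall f : borel Omega -> R, f \in Lfun mu 2%:E ->
  exists2 e : borel Omega -> R,
    is_cond_expectation mu (invariant_sets mu g) f e &
    weak_L2_cvg mu (fun t => f \o g t) e.

(* Main.v *)
(** Over a chart the substitution z = h(v(x))^-1 y turns the flow into the skew
    product (x, z) |-> (x, q(t w(x)) z) on M x G, where q : R^r -> T is the
    universal covering of the torus.

    If the measures are Rajchman: for k continuous on G, the functions
    u |-> k(q(u) z) are Z^r-periodic, with a modulus of continuity independent
    of z, so Fejer means reduce the correlations with k to integrals of
    exp(2 i pi t <xi, w>) Phi.  These converge, because on <xi, w> != 0 the
    modes are asymptotically orthogonal.  Dynkin's lemma then gives the
    convergence of all correlations of bounded functions, first in a chart,
    then on Omega by cutting it along countably many charts.  The limit of
    < f o g_t, . > is represented (Radon-Nikodym) by a square integrable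
    function, which is flow invariant, hence equal to E(f | I).

    Conversely, a function k on G extending a character exp(2 i pi <xi, .>) of
    T, tested against the indicator of A x V with V a small neighbourhood of
    the neutral element, shows that the integral over A of
    exp(2 i pi t <xi, w>) converges as t goes to infinity; averaging over
    arithmetic progressions of times of small step, the limit can only be 0
    when <xi, w> does not vanish on A. *)

From HB Require Import structures.
From mathcomp Require Import all_boot all_order all_algebra.
From mathcomp Require Import all_classical all_reals all_analysis.
From mathcomp Require Import measurable_realfun.
From mathcomp Require Import ring lra.
Require Import Defs.
Import Order.TTheory GRing.Theory Num.Theory.
Import numFieldNormedType.Exports.

Set Implicit Arguments.
Unset Strict Implicit.
Unset Printing Implicit Defensive.

Local Open Scope classical_set_scope.
Local Open Scope ring_scope.

(** * Fejer approximation on the torus *)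

(** Analysis only has to provide the existence of limits; their values come at the end, since a weak
    limit of f o g_t pairs with invariant indicators as f does. Hence the work is phrased with the
    Cauchy criterion [cauchy_oo], which survives uniform approximation and so passes from characters
    to continuous functions, to indicators and to square integrable functions. Two obstacles shape
    the rest. Measurability of w and of x |-> exp (t v(x)) is not given: the latter is read off the
    flow in a chart, and <xi, w> is then a pointwise limit of difference quotients of measurable
    functions. Moreover G need not be commutative, while w only sees the torus: instead of using
    representations of G, characters of T are extended to G by Tietze's theorem, and continuous
    functions on G are expanded along the cosets q(R^r) z, with constants made uniform in z by
    compactness. *)

Lemma sin_mul_sum_cos {R : realType} (x a : R) (n : nat) :
  2 * sin x * (\sum_(k < n) cos (2 * k%:R * x + a)) =
  sin (2 * n%:R * x - x + a) - sin (a - x).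
Proof.
elim: n => [|n IHn].
  by rewrite big_ord0 mulr0 mulr0 mul0r add0r [- x + a]addrC subrr.
rewrite big_ord_recr /= mulrDr IHn.
have -> : 2 * n.+1%:R * x - x + a = (2 * n%:R * x + a) + x.
  by rewrite -natr1; ring.
have -> : 2 * n%:R * x - x + a = (2 * n%:R * x + a) - x by ring.
(* Each term 2 sin x cos p is sin (p + x) - sin (p - x): the sum telescopes. *)
by move: (sinD (2 * n%:R * x + a) x) (sinB (2 * n%:R * x + a) x) => -> ->; ring.
Qed.

(** Bound on a Dirichlet kernel, kept multiplied by sin x so that the zeros of sin x need no
    separate case. It serves both the Fejer kernel and the means over arithmetic progressions of
    times. *)
Lemma norm_sin_sum_cos {R : realType} (x a : R) (n : nat) :
  `|sin x * \sum_(k < n) cos (2 * k%:R * x + a)| <= 1.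
Proof.
have := sin_mul_sum_cos x a n.
have := sin_max (2 * n%:R * x - x + a); have := sin_max (a - x).
set s1 := sin (a - x); set s2 := sin (2 * n%:R * x - x + a).
set t := \sum_(k < n) _ => h1 h2 h3.
have -> : sin x * t = (s2 - s1) / 2 by rewrite -h3; field.
by move: h1 h2; rewrite !ler_norml; lra.
Qed.

Lemma sinDn2pi {R : realType} (a : R) (n : nat) : sin (a + 2 * pi * n%:R) = sin a.
Proof. by rewrite -[RHS](periodicn (@sinD2pi R) n) -[_ *+ n]mulr_natr; congr sin; ring. Qed.

Lemma cosDn2pi {R : realType} (a : R) (n : nat) : cos (a + 2 * pi * n%:R) = cos a.
Proof. by rewrite -[RHS](periodicn (@cosD2pi R) n) -[_ *+ n]mulr_natr; congr cos; ring. Qed.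

Lemma cosDz2pi {R : realType} (a : R) (z : int) : cos (a + 2 * pi * z%:~R) = cos a.
Proof.
case: z => n; first by rewrite -pmulrn cosDn2pi.
by rewrite NegzE mulrNz -pmulrn -[LHS](cosDn2pi _ n.+1); congr cos; ring.
Qed.

(** A frequency strictly between 0 and N is orthogonal to constants on the grid of step 1 / N: with
    x = pi n / N in ]0, pi[, sin x is nonzero, and the telescoped sum closes up after a full
    period. *)
Lemma sum_cos_grid {R : realType} (u : R) (n N : nat) : (0 < n < N)%N ->
  \sum_(j < N) cos (2 * pi * n%:R * (u - j%:R / N%:R)) = 0.
Proof.
move=> /andP[n0 nN].
have N0 : N%:R != 0 :> R by rewrite pnatr_eq0 -lt0n (ltn_trans n0).
set x := pi * n%:R / N%:R : R; set a := - (2 * pi * n%:R * u).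
have sx : sin x != 0.
  rewrite gt_eqF//; apply: sin_gt0_pi.
  rewrite /x -mulrA; apply/andP; split.
    by rewrite mulr_gt0 ?pi_gt0 ?divr_gt0 ?ltr0n // (ltn_trans n0).
  rewrite -[ltRHS]mulr1 ltr_pM2l ?pi_gt0// ltr_pdivrMr ?ltr0n ?(ltn_trans n0)//.
  by rewrite mul1r ltr_nat.
have -> : \sum_(j < N) cos (2 * pi * n%:R * (u - j%:R / N%:R)) =
          \sum_(j < N) cos (2 * j%:R * x + a).
  apply: eq_bigr => j _; rewrite -cosN; congr cos.
  by rewrite /x /a; field.
apply: (mulfI sx); rewrite mulr0; apply: (mulfI (_ : 2 != 0 :> R)) => //.
rewrite mulrA sin_mul_sum_cos mulr0.
have -> : 2 * N%:R * x - x + a = (a - x) + 2 * pi * n%:R by rewrite /x; field.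
by rewrite sinDn2pi subrr.
Qed.

(** The squared modulus of the sum of exp (2 i pi k x), k < N, divided by N^2 rather than N, so that
    the values on a translate of the grid of step 1 / N add up to 1. Sums over the grid thus replace
    integrals over the circle. *)
Definition fejer {R : realType} (N : nat) (x : R) : R :=
  ((\sum_(k < N) cos (2 * pi * k%:R * x)) ^+ 2 +
   (\sum_(k < N) sin (2 * pi * k%:R * x)) ^+ 2) / N%:R ^+ 2.

Lemma fejer_ge0 {R : realType} (N : nat) (x : R) : 0 <= fejer N x.
Proof. by rewrite divr_ge0 ?addr_ge0 ?sqr_ge0. Qed.

Lemma fejerE {R : realType} (N : nat) (x : R) :
  fejer N x = (\sum_(k < N) \sum_(l < N)
     cos (2 * pi * (k%:R - l%:R) * x)) / N%:R ^+ 2.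
Proof.
congr (_ / _); rewrite !expr2 !big_distrl /= -big_split /=.
apply: eq_bigr => k _; rewrite !big_distrr /= -big_split /=.
by apply: eq_bigr => l _; rewrite -cosB; congr cos; ring.
Qed.

(** Concentration near the integers: sin (pi x)^2 stands for the squared distance of x to Z. *)
Lemma fejer_sin_le {R : realType} (N : nat) (x : R) :
  fejer N x * sin (pi * x) ^+ 2 <= 2 / N%:R ^+ 2.
Proof.
rewrite /fejer mulrAC ler_wpM2r ?invr_ge0 ?sqr_ge0// mulrDl -!exprMn.
have hC : `|sin (pi * x) * \sum_(k < N) cos (2 * pi * k%:R * x)| <= 1.
  have := norm_sin_sum_cos (pi * x) 0 N.
  by under eq_bigr do rewrite addr0 mulrA (mulrAC 2).
have hS : `|sin (pi * x) * \sum_(k < N) sin (2 * pi * k%:R * x)| <= 1.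
  have := norm_sin_sum_cos (pi * x) (- (pi / 2)) N.
  by under eq_bigr do rewrite cosBpihalf mulrA (mulrAC 2).
have sq (y : R) : `|y| <= 1 -> y ^+ 2 <= 1.
  by move=> hy; rewrite -real_normK ?num_real// exprn_ile1.
by apply: (@lerD _ _ 1 _ 1); apply: sq; rewrite mulrC.
Qed.

(** In the double sum only the diagonal k = l survives, the other frequencies k - l being smaller
    than N in absolute value. *)
Lemma sum_fejer {R : realType} (N : nat) (u : R) : (0 < N)%N ->
  \sum_(j < N) fejer N (u - j%:R / N%:R) = 1.
Proof.
move=> N0; have N0' : N%:R != 0 :> R by rewrite pnatr_eq0 -lt0n.
under eq_bigr do rewrite fejerE.
rewrite -mulr_suml exchange_big /=.
rewrite (eq_bigr (fun _ => N%:R)); last first.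
  move=> k _; rewrite exchange_big /= (bigD1 k)//= subrr.
  rewrite [X in _ + X]big1 ?addr0; last first.
    move=> l; rewrite -val_eqE /= => lk; have /orP[lk'|kl] : (l < k)%N || (k < l)%N by rewrite -neq_ltn.
    all: swap 1 2.
    - rewrite -[RHS](@sum_cos_grid R u (l - k) N); last first.
        by rewrite subn_gt0 kl (leq_ltn_trans (leq_subr _ _)).
      apply: eq_bigr => j _; rewrite -cosN natrB ?(ltnW kl)//; congr cos.
      by ring.
    - rewrite -[RHS](@sum_cos_grid R u (k - l) N); last first.
        by rewrite subn_gt0 lk' (leq_ltn_trans (leq_subr _ _)).
      by apply: eq_bigr => j _; rewrite natrB ?(ltnW lk').
  rewrite (eq_bigr (fun _ => 1)) ?sumr_const ?card_ord//.
  by move=> j _; rewrite mulr0 mul0r cos0.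
by rewrite sumr_const card_ord -[_ *+ N]mulr_natr -expr2 divff// expf_neq0.
Qed.

Lemma sum_fejer_sin_le {R : realType} (N : nat) (u : R) : (0 < N)%N ->
  \sum_(j < N) fejer N (u - j%:R / N%:R) * sin (pi * (u - j%:R / N%:R)) ^+ 2
  <= 2 / N%:R.
Proof.
move=> N0; have N0' : N%:R != 0 :> R by rewrite pnatr_eq0 -lt0n.
apply: (@le_trans _ _ (\sum_(j < N) 2 / N%:R ^+ 2)).
  by apply: ler_sum => j _; exact: fejer_sin_le.
rewrite sumr_const card_ord -mulr_natr le_eqVlt; apply/orP; left; apply/eqP.
by field.
Qed.

(** * Trigonometric polynomials in several variables *)

Lemma dot_intD {R : realType} r (xi : 'rV[int]_r) (u v : 'rV[R]_r) :
  dot_int xi (u + v) = dot_int xi u + dot_int xi v.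
Proof.
by rewrite /dot_int -big_split /=; apply: eq_bigr => i _; rewrite mxE mulrDr.
Qed.

Lemma dot_intZ {R : realType} r (xi : 'rV[int]_r) (c : R) (u : 'rV[R]_r) :
  dot_int xi (c *: u) = c * dot_int xi u.
Proof.
by rewrite /dot_int big_distrr /=; apply: eq_bigr => i _; rewrite mxE mulrCA.
Qed.

Lemma dot_intDl {R : realType} r (xi eta : 'rV[int]_r) (u : 'rV[R]_r) :
  dot_int (xi + eta) u = dot_int xi u + dot_int eta u.
Proof.
rewrite /dot_int -big_split /=.
by apply: eq_bigr => i _; rewrite mxE mulrzDr mulrDl.
Qed.

Lemma dot_intNl {R : realType} r (xi : 'rV[int]_r) (u : 'rV[R]_r) :
  dot_int (- xi) u = - dot_int xi u.
Proof.
by rewrite /dot_int -sumrN; apply: eq_bigr => i _; rewrite mxE mulrNz mulNr.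
Qed.

Lemma dot_int0l {R : realType} r (u : 'rV[R]_r) : dot_int 0 u = 0.
Proof. by rewrite /dot_int big1// => i _; rewrite mxE mul0r. Qed.

Lemma dot_int_delta {R : realType} r (i : 'I_r) (k : int) (u : 'rV[R]_r) :
  dot_int (k *: delta_mx 0 i) u = k%:~R * u ord0 i.
Proof.
rewrite /dot_int (bigD1 i)//= big1 ?addr0.
  by rewrite !mxE !eqxx mulr1.
by move=> j /negPf ji; rewrite !mxE ji andbF mulr0 mul0r.
Qed.

Lemma sin_shift {R : realType} (x : R) : sin x = cos (x - pi / 2).
Proof. by rewrite cosB cos_pihalf sin_pihalf mulr0 add0r mulr1. Qed.

(** Phases make sines available without complex numbers and keep the class closed under products. *)
Inductive trig_poly {R : realType} {r : nat} : ('rV[R]_r -> R) -> Prop :=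
| trig_cos c a xi : trig_poly (fun u => c * cos (2 * pi * dot_int xi u + a))
| trig_add P Q : trig_poly P -> trig_poly Q -> trig_poly (fun u => P u + Q u).

Lemma trig_ext {R : realType} {r : nat} (P Q : 'rV[R]_r -> R) :
  trig_poly P -> P =1 Q -> trig_poly Q.
Proof. by move=> + /funext <-. Qed.

Lemma trig_cst {R : realType} {r : nat} (c : R) :
  trig_poly (fun _ : 'rV[R]_r => c).
Proof.
apply: trig_ext (trig_cos c 0 0) _ => u.
by rewrite dot_int0l mulr0 addr0 cos0 mulr1.
Qed.

Lemma trig_mul {R : realType} {r : nat} (P Q : 'rV[R]_r -> R) :
  trig_poly P -> trig_poly Q -> trig_poly (fun u => P u * Q u).
Proof.
elim=> [c a xi|P1 P2 _ IH1 _ IH2] HQ; last first.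
  by apply: trig_ext (trig_add (IH1 HQ) (IH2 HQ)) _ => u; rewrite mulrDl.
elim: HQ => [b a' eta|Q1 Q2 _ IH1 _ IH2]; last first.
  by apply: trig_ext (trig_add IH1 IH2) _ => u; ring.
apply: trig_ext (trig_add (trig_cos (c * b / 2) (a - a') (xi - eta))
                          (trig_cos (c * b / 2) (a + a') (xi + eta))) _ => u.
rewrite !dot_intDl dot_intNl.
set x := _ * dot_int xi u; set y := _ * dot_int eta u.
have -> : 2 * pi * (dot_int xi u - dot_int eta u) + (a - a') = (x + a) - (y + a').
  by rewrite /x /y; ring.
have -> : 2 * pi * (dot_int xi u + dot_int eta u) + (a + a') = (x + a) + (y + a').
  by rewrite /x /y; ring.
by move: (x + a) (y + a') => p q; rewrite cosB cosD; field.
Qed.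

Lemma trig_sum {R : realType} {r : nat} (I : Type) (s : seq I) (p : pred I)
    (P : I -> 'rV[R]_r -> R) :
  (forall i, trig_poly (P i)) -> trig_poly (fun u => \sum_(i <- s | p i) P i u).
Proof.
move=> HP; elim: s => [|i s IH].
  by apply: trig_ext (trig_cst 0) _ => u; rewrite big_nil.
case pi : (p i); last first.
  by apply: trig_ext IH _ => u; rewrite big_cons pi.
by apply: trig_ext (trig_add (HP i) IH) _ => u; rewrite big_cons pi.
Qed.

Lemma trig_prod {R : realType} {r : nat} (I : Type) (s : seq I) (p : pred I)
    (P : I -> 'rV[R]_r -> R) :
  (forall i, trig_poly (P i)) -> trig_poly (fun u => \prod_(i <- s | p i) P i u).
Proof.
move=> HP; elim: s => [|i s IH].
  by apply: trig_ext (trig_cst 1) _ => u; rewrite big_nil.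
case pi : (p i); last first.
  by apply: trig_ext IH _ => u; rewrite big_cons pi.
by apply: trig_ext (trig_mul (HP i) IH) _ => u; rewrite big_cons pi.
Qed.

Lemma trig_fejer {R : realType} {r : nat} (N : nat) (i : 'I_r) (c : R) :
  trig_poly (fun u : 'rV[R]_r => fejer N (u ord0 i - c)).
Proof.
have tca a (k : 'I_N) : trig_poly (fun u : 'rV[R]_r =>
    cos (2 * pi * k%:R * (u ord0 i - c) + a)).
  apply: trig_ext (trig_cos 1 (a - 2 * pi * k%:R * c) (k%:Z *: delta_mx 0 i)) _ => u.
  by rewrite !dot_int_delta -pmulrn mul1r; congr cos; ring.
have tc (k : 'I_N) : trig_poly (fun u : 'rV[R]_r => cos (2 * pi * k%:R * (u ord0 i - c))).
  by apply: trig_ext (tca 0 k) _ => u; rewrite addr0.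
have ts (k : 'I_N) : trig_poly (fun u : 'rV[R]_r => sin (2 * pi * k%:R * (u ord0 i - c))).
  by apply: trig_ext (tca (- (pi / 2)) k) _ => u; rewrite sin_shift.
have := @trig_sum R r 'I_N (index_enum 'I_N) xpredT _ tc.
have := @trig_sum R r 'I_N (index_enum 'I_N) xpredT _ ts => hs hc.
have := trig_mul (trig_add (trig_mul hc hc) (trig_mul hs hs))
  (trig_cst (N%:R ^- 2)).
by move=> h; apply: trig_ext h _ => u; rewrite /fejer !expr2.
Qed.

(** The integer nearest to x works: after subtracting it, the point lies in [-1/2, 1/2[, where sin
    (pi .)^2 is even and increases with the absolute value. *)
Lemma sin_pi_dist {R : realType} (x d : R) : 0 < d <= 2^-1 ->
  sin (pi * x) ^+ 2 < sin (pi * d) ^+ 2 -> exists z : int, `|x - z%:~R| < d.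
Proof.
move=> /andP[d0 d2] hs; exists (Num.floor (x + 2^-1)).
set z := Num.floor _; set y := x - z%:~R.
have /andP[y1 y2] : - 2^-1 <= y < 2^-1.
  have := floor_le_tmp (x + 2^-1); have := floorD1_gt (x + 2^-1).
  by rewrite -/z /y intrD; lra.
have {hs} : sin (pi * y) ^+ 2 < sin (pi * d) ^+ 2.
  (* Through the double angle, because sin (pi .) itself changes sign under a shift by 1. *)
  have -> : sin (pi * y) ^+ 2 = sin (pi * x) ^+ 2; last by [].
  rewrite !sin2cos2; congr (1 - _).
  have dbl (b : R) : cos b ^+ 2 = (cos (b *+ 2) + 1) / 2.
    by rewrite cos_mulr2n; field.
  rewrite !dbl -[in LHS](cosDz2pi _ z) /y; congr ((cos _ + _) / _).
  by ring.
have pi0 := pi_gt0 R.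
have hd2 : pi * d <= pi / 2 by rewrite ler_pM2l.
rewrite ltNge => hs; rewrite ltNge; apply: contra hs => dy.
have sd0 : 0 <= sin (pi * d).
  by apply: sin_ge0_pi; rewrite mulr_ge0 ?(ltW pi0) ?(ltW d0)//=; lra.
have -> : sin (pi * y) ^+ 2 = sin (pi * `|y|) ^+ 2.
  by case: (ger0P y) => // _; rewrite mulrN sinN sqrrN.
have hy : pi * `|y| <= pi / 2 by rewrite ler_pM2l// ler_norml; lra.
have hdy : pi * d <= pi * `|y| by rewrite ler_pM2l.
have pd0 : 0 < pi * d by rewrite mulr_gt0.
rewrite lerXn2r ?nnegrE//.
  by apply: sin_ge0_pi; lra.
have [->//|ne] := eqVneq (pi * d) (pi * `|y|).
by apply: ltW; rewrite ltr_sin ?in_itv/= ?lt_neqAle ?ne//=; lra.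
Qed.

Definition mod_cont {R : realType} {r : nat} (Psi : 'rV[R]_r -> R) (d e : R) : Prop :=
  forall u eta : 'rV[R]_r, (forall i, `|eta ord0 i| < d) ->
    `|Psi (u + eta) - Psi u| <= e.

(* The same nodes c and kernels P serve all functions with a given bound and a
   given modulus of continuity. *)
Lemma trig_approx {R : realType} {r : nat} (B d0 e : R) :
  0 <= B -> 0 < d0 -> 0 < e ->
  exists (I : finType) (c : I -> 'rV[R]_r) (P : I -> 'rV[R]_r -> R),
    (forall i, trig_poly (P i)) /\
    forall Psi : 'rV[R]_r -> R, (forall u, `|Psi u| <= B) ->
      (forall u (z : 'rV[int]_r), Psi (u + map_mx intr z) = Psi u) ->
      mod_cont Psi d0 (e / 2) ->
      forall u, `|Psi u - \sum_i Psi (c i) * P i u| <= e.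
Proof.
move=> B0 d0_gt0 e0.
pose d := Num.min d0 2^-1.
have d_gt0 : 0 < d by rewrite lt_min d0_gt0 invr_gt0 ltr0n.
have d_le : d <= 2^-1 by rewrite ge_min lexx orbT.
have pi0 := pi_gt0 R.
pose s := sin (pi * d) ^+ 2.
have s0 : 0 < s.
  rewrite exprn_gt0// sin_gt0_pi// mulr_gt0//=.
  by rewrite -[ltRHS]mulr1 ltr_pM2l// (le_lt_trans d_le)// invf_lt1// ltr1n.
(* Large enough for the nodes far from u to contribute at most e / 2, each of the r coordinates
   having [sum_fejer_sin_le] as its share. *)
pose N := (Num.truncn (2 * B / s * r%:R * 2 * 2 / e)).+1.
have N0 : (0 < N)%N by [].
have N0' : 0 < N%:R :> R by rewrite ltr0n.
have hN : 2 * B / s * r%:R * (2 / N%:R) <= e / 2.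
  have : 2 * B / s * r%:R * 2 * 2 / e < N%:R by rewrite /N truncnS_gt.
  rewrite ltr_pdivrMr// => h; rewrite mulrA ler_pdivrMr//; lra.
pose c (f : {ffun 'I_r -> 'I_N}) : 'rV[R]_r := \row_i ((f i)%:R / N%:R).
pose K (u : 'rV[R]_r) (i : 'I_r) (j : 'I_N) := fejer N (u ord0 i - j%:R / N%:R).
pose S (u : 'rV[R]_r) (i : 'I_r) (j : 'I_N) :=
  sin (pi * (u ord0 i - j%:R / N%:R)) ^+ 2.
exists {ffun 'I_r -> 'I_N}, c, (fun (f : {ffun 'I_r -> 'I_N}) u => \prod_i K u i (f i)); split.
  by move=> f; apply: trig_prod => i; exact: trig_fejer.
move=> Psi PsiB Psip hd0 u.
have K0 i j : 0 <= K u i j by exact: fejer_ge0.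
have sumK : \sum_(f : {ffun 'I_r -> 'I_N}) \prod_i K u i (f i) = 1.
  rewrite -(bigA_distr_bigA (K u)) /= big1// => i _.
  exact: sum_fejer.
(* A Chebyshev argument: either the node is within d of u modulo integers in every coordinate, and
   the modulus of continuity applies; or some [S u i (f i)] is at least s, and the second summand
   already exceeds the trivial bound 2 B. *)
have close (f : {ffun 'I_r -> 'I_N}) :
    `|Psi u - Psi (c f)| <= e / 2 + 2 * B / s * \sum_i S u i (f i).
  have [/forallP hf|] := boolP [forall i, S u i (f i) < s].
    have hz i : {z : int | `|u ord0 i - (f i)%:R / N%:R - z%:~R| < d}.
      apply: cid; apply: sin_pi_dist (hf i).
      by rewrite d_gt0 d_le.
    pose z : 'rV[int]_r := \row_i sval (hz i).
    have -> : Psi u = Psi (c f + (u - c f - map_mx intr z)).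
      by rewrite -(Psip (c f + _) z); congr Psi; apply/rowP => i; rewrite !mxE; ring.
    apply: (@le_trans _ _ (e / 2)).
      apply: hd0 => i; rewrite !mxE.
      by case: (hz i) => k /= hk; rewrite (lt_le_trans hk)// ge_min lexx.
    rewrite lerDl; apply: mulr_ge0.
      by apply: divr_ge0; [exact: mulr_ge0 | exact: ltW].
    by apply: sumr_ge0 => i _; rewrite sqr_ge0.
  rewrite negb_forall => /existsP[i]; rewrite -leNgt => hi.
  apply: (@le_trans _ _ (2 * B)).
    apply: le_trans (ler_normB _ _) _; rewrite mulr2n mulrDl !mul1r.
    by rewrite lerD.
  have h1 : s <= \sum_i S u i (f i).
    rewrite (bigD1 i)//= (le_trans hi)// lerDl; apply: sumr_ge0 => k _.
    by rewrite sqr_ge0.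
  apply: (@le_trans _ _ (2 * B / s * \sum_i S u i (f i))); last first.
    by rewrite lerDr divr_ge0// ltW.
  rewrite -mulrA; apply: ler_peMr; first by rewrite mulr_ge0.
  by rewrite mulrC ler_pdivlMr// mul1r.
have -> : Psi u - \sum_f Psi (c f) * \prod_i K u i (f i) =
   \sum_f (Psi u - Psi (c f)) * \prod_i K u i (f i).
  rewrite -{1}[Psi u]mulr1 -{1}sumK mulr_sumr -sumrB.
  by apply: eq_bigr => f _; rewrite mulrBl.
apply: le_trans (ler_norm_sum _ _ _) _.
apply: (@le_trans _ _ (\sum_(f : {ffun 'I_r -> 'I_N})
   (e / 2 + 2 * B / s * \sum_i S u i (f i)) * \prod_i K u i (f i))).
  apply: ler_sum => f _; rewrite normrM (ger0_norm (prodr_ge0 _ _))//.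
  by rewrite ler_wpM2r// prodr_ge0.
under eq_bigr do rewrite mulrDl.
rewrite big_split /= -mulr_sumr sumK mulr1.
suff : \sum_(f : {ffun 'I_r -> 'I_N})
    2 * B / s * (\sum_i S u i (f i)) * (\prod_i K u i (f i)) <= e / 2.
  by lra.
apply: le_trans hN.
under eq_bigr do rewrite -mulrA.
rewrite -mulr_sumr -[leRHS]mulrA; apply: ler_wpM2l.
  by apply: divr_ge0; [exact: mulr_ge0 | exact: ltW].
under eq_bigr do rewrite mulr_suml.
rewrite exchange_big /=.
apply: (@le_trans _ _ (\sum_(i < r) 2 / N%:R)); last first.
  by rewrite sumr_const card_ord -[_ *+ r]mulr_natl.
apply: ler_sum => i _.
(* Absorbing [S u i] into the i-th factor lets the sum over all nodes factor into one-dimensional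
   sums, all equal to 1 except the i-th. *)
have -> : \sum_(f : {ffun 'I_r -> 'I_N}) S u i (f i) * \prod_k K u k (f k) =
   \sum_(f : {ffun 'I_r -> 'I_N}) \prod_k (K u k (f k) * (if k == i then S u i (f k) else 1)).
  apply: eq_bigr => f _; rewrite [RHS]big_split /= [LHS]mulrC; congr (_ * _).
  by rewrite -big_mkcond /= big_pred1_eq.
rewrite -(bigA_distr_bigA (fun k j => K u k j * (if k == i then S u i j else 1))) /=.
rewrite (bigD1 i)//= eqxx [X in _ * X]big1 ?mulr1; last first.
  move=> k /negPf ->; under eq_bigr do rewrite mulr1.
  exact: sum_fejer.
exact: sum_fejer_sin_le.
Qed.

(** * One-parameter subgroups *)

Lemma mx_entry_le {R : realType} {m n : nat} (A : 'M[R]_(m, n)) i j :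
  `|A i j| <= `|A|.
Proof.
rewrite [`|A|]mx_normrE; apply/bigmax_geP; right => /=.
by exists (i, j).
Qed.

Lemma is_derive_rowP {R : realType} {n : nat} (f : R -> 'rV[R]_n) (t : R) (u : 'rV[R]_n) :
  is_derive t 1 f u <-> forall j, is_derive t 1 (fun s => f s ord0 j) (u ord0 j).
Proof.
split=> [[df <-] j|h].
  by have /derivable_mxP df' := df; apply: DeriveDef => //; rewrite derive_mx// mxE.
have df : derivable f t 1.
  by apply/derivable_mxP => i j; rewrite (ord1 i); case: (h j).
by apply: DeriveDef => //; rewrite derive_mx//; apply/rowP => j; rewrite mxE; case: (h j).
Qed.

Lemma is_derive_diff_comp {R : realType} {m n : nat} (F : 'rV[R]_m -> 'rV[R]_n)
    (c : R -> 'rV[R]_m) (t : R) (u : 'rV[R]_m) : differentiable F (c t) ->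
  is_derive t 1 c u -> is_derive t 1 (F \o c) ('d F (c t) u).
Proof.
move=> dF [dc <-]; have Dc : differentiable c t by apply/derivable1_diffP.
have DFc : differentiable (F \o c) t by exact: differentiable_comp.
apply: DeriveDef; first exact: diff_derivable.
by rewrite deriveE// [in RHS]deriveE// (@diff_comp _ _ _ _ c F t Dc dF).
Qed.

Lemma is_derive_row_mx {R : realType} {m n : nat} (f : R -> 'rV[R]_m)
    (g : R -> 'rV[R]_n) (t : R) (u : 'rV[R]_m) (v : 'rV[R]_n) :
  is_derive t 1 f u -> is_derive t 1 g v ->
  is_derive t 1 (fun s => row_mx (f s) (g s)) (row_mx u v).
Proof.
move=> /is_derive_rowP df /is_derive_rowP dg; apply/is_derive_rowP => j.
case: (split_ordP j) => k ->.
  by rewrite row_mxEl; under eq_fun do rewrite row_mxEl; exact: df.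
by rewrite row_mxEr; under eq_fun do rewrite row_mxEr; exact: dg.
Qed.

Lemma is_derive_affine_comp {R : realType} {n : nat} (c : R -> 'rV[R]_n)
    (k b t : R) (u : 'rV[R]_n) :
  is_derive (k * t + b) 1 c u -> is_derive t 1 (fun s => c (k * s + b)) (k *: u).
Proof.
move=> /is_derive_rowP dc; apply/is_derive_rowP => j; rewrite mxE mulrC.
have dl : is_derive t 1 (fun s : R => k * s + b) k.
  by apply: is_derive_eq; rewrite addr0 [_ *: _]mulr1.
exact: (@is_derive1_comp _ (fun s => c s ord0 j) (fun s => k * s + b) _ _ _ (dc j) dl).
Qed.

Lemma continuous_mulg_at {R : realType} {G : topGroupType} {d : nat} (AG : atlas R G d) :
  lie_group AG -> continuous (fun p : G * G => (p.1 * p.2)%g).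
Proof.
by move=> [_ [h _] _]; exact/continuous_subspace_setT.
Qed.

Lemma continuous_mulg2 {R : realType} {G : topGroupType} {d : nat} (AG : atlas R G d)
    {X : topologicalType} (x y : X -> G) (t : X) : lie_group AG ->
  {for t, continuous x} -> {for t, continuous y} ->
  {for t, continuous (fun s => (x s * y s)%g)}.
Proof.
move=> lieG cx cy.
apply: (@continuous_comp _ _ _ (fun s => (x s, y s)) (fun p : G * G => (p.1 * p.2)%g)).
  exact: cvg_pair.
exact: (continuous_mulg_at lieG).
Qed.

(* [L] is the differential of the multiplication at [(a, b)] in the three charts. *)
Lemma chart_mulg_differential {R : realType} {G : topGroupType} {d : nat}
    (AG : atlas R G d) (U1 U2 U3 : AG) (a b : G) : lie_group AG ->
  dom AG U1 a -> dom AG U2 b -> dom AG U3 (a * b)%g ->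
  exists L : {linear 'rV[R]_(d + d) -> 'rV[R]_d}, forall (x y : R -> G) (t : R) u v,
    x t = a -> y t = b -> {for t, continuous x} -> {for t, continuous y} ->
    is_derive t 1 (fun s => coord AG U1 (x s)) u ->
    is_derive t 1 (fun s => coord AG U2 (y s)) v ->
    is_derive t 1 (fun s => coord AG U3 (x s * y s)%g) (L (row_mx u v)).
Proof.
move=> lieG d1 d2 d3; have [smG [_ smul] _] := lieG; have [_ _ hE _] := smG 0%N.
have [g [dg _] gE] := smul 1%N (U1, U2) U3.
exists ('d g (row_mx (coord AG U1 a) (coord AG U2 b))) => x y t u v xa yb cx cy D1 D2.
have near_dom (V : AG) (z : R -> G) : {for t, continuous z} -> dom AG V (z t) ->
    \forall s \near t, dom AG V (z s).
  move=> cz dz; apply: cz; apply: open_nbhs_nbhs; split=> //.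
  by have [] := hE V.
have cxy := continuous_mulg2 lieG cx cy.
pose c s := row_mx (coord AG U1 (x s)) (coord AG U2 (y s)).
apply: (@near_eq_is_derive _ _ _ (g \o c)).
- near=> s; symmetry; apply: (gE (x s, y s)); split; first split; rewrite //=.
    by split; near: s; apply: near_dom; rewrite ?xa ?yb.
  by near: s; apply: (near_dom U3 (fun s => x s * y s)%g); rewrite ?xa ?yb.
- have -> : row_mx (coord AG U1 a) (coord AG U2 b) = c t by rewrite /c xa yb.
  apply: is_derive_diff_comp; last exact: is_derive_row_mx.
  by rewrite /c xa yb; apply: dg; exists (a, b).
Unshelve. all: by end_near. Qed.

Definition one_param {R : realType} {G : topGroupType} (a : R -> G) : Prop :=
  (forall s t : R, a (s + t) = (a s * a t)%g) /\ continuous a.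

Lemma one_param0 {R : realType} {G : topGroupType} (a : R -> G) :
  one_param a -> a 0 = 1%g.
Proof.
by move=> [aD _]; apply: (@mulgI _ (a 0)); rewrite -aD addr0 mulg1.
Qed.

Lemma one_paramN {R : realType} {G : topGroupType} (a : R -> G) (t : R) :
  one_param a -> a (- t) = (a t)^-1%g.
Proof.
move=> ha; apply: (@mulIg _ (a t)).
by rewrite -ha.1 addNr one_param0// mulVg.
Qed.

(** For large n the time t / n falls in [0, e], and its n-th multiple recovers t; negative times
    follow by inversion. *)
Lemma one_param_eq_near {R : realType} {G : topGroupType} (a b : R -> G) (e : R) :
  one_param a -> one_param b -> 0 < e ->
  (forall t, 0 <= t <= e -> a t = b t) -> a = b.
Proof.
move=> ha hb e0 h.
have pos (t : R) : 0 <= t -> a t = b t.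
  move=> t0; pose n := (Num.truncn (t / e)).+1; pose s := t / n%:R.
  have n0 : 0 < n%:R :> R by rewrite ltr0n.
  have hs : a s = b s.
    apply: h; rewrite divr_ge0//= ler_pdivrMr// mulrC -ler_pdivrMr//.
    by rewrite ltW// truncnS_gt.
  have mult (k : nat) : a (k%:R * s) = b (k%:R * s).
    elim: k => [|k IH]; first by rewrite mul0r !one_param0.
    by rewrite -natr1 mulrDl mul1r ha.1 hb.1 IH hs.
  by have := mult n; rewrite /s mulrC divfK// gt_eqF.
apply/funext => t; have [/pos//|t0] := leP 0 t.
apply: invg_inj; rewrite -!one_paramN//; apply: pos.
by rewrite oppr_ge0 ltW.
Qed.

(* The curve a(s) b(-s) has velocity u - u = 0 at 0, hence, being translated
   along itself, everywhere; it is constant near 0. *)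
Lemma one_param_unique {R : realType} {G : topGroupType} {d : nat}
    (AG : atlas R G d) (E : AG) (a b : R -> G) (u : 'rV[R]_d) :
  lie_group AG -> dom AG E 1%g -> one_param a -> one_param b ->
  is_derive (0 : R) (1 : R) (fun t => coord AG E (a t)) u ->
  is_derive (0 : R) (1 : R) (fun t => coord AG E (b t)) u -> a = b.
Proof.
move=> lieG E1 ha hb da db.
have [smG _ _] := lieG; have [_ cover hE _] := smG 0%N.
have [oE _ [[_ phi_inj _] _ _]] := hE E.
pose b' s := b (- s); pose f s := (a s * b' s)%g.
have a0 := one_param0 ha; have b'0 : b' 0 = 1%g by rewrite /b' oppr0 one_param0.
have db' : is_derive (0 : R) 1 (fun s => coord AG E (b' s)) (- u).
  have -> : (fun s => coord AG E (b' s)) = (fun s => coord AG E (b (-1 * s + 0))).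
    by apply/funext => s; rewrite mulN1r addr0.
  rewrite -[- u]scaleN1r; apply: (@is_derive_affine_comp _ _ (fun s => coord AG E (b s))).
  by rewrite mulr0 addr0.
have cb' : continuous b'.
  by move=> s; apply: continuous_comp; [exact: opp_continuous|exact: hb.2].
have ccst (z : G) : continuous (fun _ : R => z) by move=> s; exact: cvg_cst.
have dcst (V : AG) (z : G) (t : R) : is_derive t 1 (fun _ : R => coord AG V z) 0.
  exact: is_derive_cst.
have f_c : continuous f.
  by move=> s; apply: (continuous_mulg2 lieG (ha.2 s) (cb' s)).
have f0 : f 0 = 1%g by rewrite /f a0 b'0 mulg1.
have df0 : is_derive (0 : R) 1 (fun s => coord AG E (f s)) 0.
  have E11 : dom AG E (1 * 1)%g by rewrite mulg1.
  have [L hL] := chart_mulg_differential lieG E1 E1 E11.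
  (* [L] is only known through its action on curves, so it is evaluated by feeding it a(s) * 1 and 1
     * b(-s). *)
  have L1 : L (row_mx u 0) = u.
    have := hL a (fun=> 1%g) 0 u 0 a0 erefl (ha.2 0) (ccst _ 0) da (dcst E _ 0).
    by under eq_fun do rewrite mulg1; move=> [_ <-]; case: da.
  have L2 : L (row_mx 0 (- u)) = - u.
    have := hL (fun=> 1%g) b' 0 0 (- u) erefl b'0 (ccst _ 0) (cb' 0) (dcst E _ 0) db'.
    by under eq_fun do rewrite mul1g; move=> [_ <-]; case: db'.
  have := hL a b' 0 u (- u) a0 b'0 (ha.2 0) (cb' 0) da db'.
  have -> : row_mx u (- u) = row_mx u 0 + row_mx 0 (- u).
    by rewrite add_row_mx addr0 add0r.
  by rewrite linearD L1 L2 subrr.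
have df t : dom AG E (f t) -> is_derive t 1 (fun s => coord AG E (f s)) 0.
  move=> Et; have [U Ua] := cover (a t); have [V Vb] := cover (b' t).
  have Ua1 : dom AG U (a t * 1)%g by rewrite mulg1.
  have [L hL] := chart_mulg_differential lieG Ua E1 Ua1.
  have h1 := hL (fun=> a t) f 0 0 0 erefl f0 (ccst _ 0) (f_c 0) (dcst U _ 0) df0.
  rewrite row_mx0 linear0 in h1.
  have [L' hL'] := chart_mulg_differential lieG Ua1 Vb (ltac:(by rewrite mulg1) : dom AG E (a t * 1 * b' t)%g).
  have cf := continuous_mulg2 lieG (ccst (a t) 0) (f_c 0).
  have atf0 : (a t * f 0)%g = (a t * 1)%g by rewrite f0.
  have h2 := hL' (fun s => a t * f s)%g (fun=> b' t) 0 0 0 atf0 erefl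
    cf (ccst _ 0) h1 (dcst V _ 0).
  rewrite row_mx0 linear0 in h2.
  (* Although [f] need not be a homomorphism, its value at s + t is a two-sided translate of its
     value at s, and translations send velocity 0 to velocity 0. *)
  have fE s : f (s + t) = (a t * f s * b' t)%g.
    by rewrite /f /b' addrC opprD ha.1 addrC hb.1 !mulgA.
  have -> : (fun s => coord AG E (f s)) =
      (fun s => coord AG E (a t * f (1 * s - t) * b' t)%g).
    by apply/funext => s; rewrite -fE mul1r subrK.
  rewrite -[X in is_derive _ _ _ X](scaler0 _ 1).
  apply: (@is_derive_affine_comp _ _ (fun s => coord AG E (a t * f s * b' t)%g)).
  by rewrite mul1r subrr.
have : \forall t \near (0 : R), dom AG E (f t).
  by apply: f_c; rewrite f0; exact: open_nbhs_nbhs.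
move=> /nbhs_ballP[e /= e0 he].
apply: (@one_param_eq_near _ _ a b (e / 2)) => //; first by rewrite divr_gt0.
move=> t /andP[t0 te].
have Ef s : 0 <= s <= t -> dom AG E (f s).
  move=> /andP[s0 st]; apply: he; rewrite -ball_normE /= sub0r normrN ger0_norm//.
  by rewrite (le_lt_trans (le_trans st te))// ltr_pdivrMr// ltr_pMr// ltr1n.
(* Up to time t the curve stays in the chart [E], where each coordinate has zero derivative and is
   constant by the mean value theorem. *)
have : f t = 1%g.
  rewrite -f0; apply: phi_inj; rewrite ?inE; try (apply: Ef; rewrite ?lexx ?t0//).
  apply/rowP => i.
  have di s : 0 <= s <= t -> is_derive s 1 (fun s => coord AG E (f s) ord0 i) 0.
    by move=> /Ef/df/is_derive_rowP/(_ i); rewrite mxE.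
  have [||s _] := @MVT_segment R (fun s => coord AG E (f s) ord0 i) (fun=> 0) 0 t t0.
  - by move=> s; rewrite in_itv/= => /andP[? ?]; apply: di; rewrite !ltW.
  - apply: continuous_in_subspaceT => s; rewrite inE/= in_itv/= => hs.
    by have [/derivable1_diffP/differentiable_continuous] := di s hs.
  - by rewrite mul0r => /eqP; rewrite subr_eq0 => /eqP.
rewrite /f /b' one_paramN// => h; apply: (@mulIg _ (b t)^-1%g).
by rewrite h mulgV.
Qed.

(** * Maximal tori and their characters *)

(** [Ad] is a [derive1], which says something about the curve only once the curve is known to be
    derivable. *)
Lemma derivable_conjg {R : realType} {G : topGroupType} {d : nat}
    (AG : atlas R G d) (E : AG) (x : R -> G) (k : G) : lie_group AG ->
  dom AG E 1%g -> {for 0, continuous x} -> x 0 = 1%g ->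
  derivable (fun s => coord AG E (x s)) 0 1 ->
  derivable (fun s => coord AG E (k * x s * k^-1)%g) 0 1.
Proof.
move=> lieG E1 cx x0 dx.
have [smG _ _] := lieG; have [_ cover _ _] := smG 0%N.
have [U Uk] := cover k; have [V Vk] := cover (k^-1)%g.
have ck (a : G) : {for (0 : R), continuous (fun=> a)} by exact: cvg_cst.
have dk (W : AG) (a : G) : is_derive (0 : R) 1 (fun=> coord AG W a) 0.
  exact: is_derive_cst.
have Uk1 : dom AG U (k * 1)%g by rewrite mulg1.
have Ekk : dom AG E (k * 1 * k^-1)%g by rewrite mulg1 mulgV.
have [L hL] := chart_mulg_differential lieG Uk E1 Uk1.
have [L' hL'] := chart_mulg_differential lieG Uk1 Vk Ekk.
have h := hL _ x 0 _ _ erefl x0 (ck k) cx (dk U k) (DeriveDef dx erefl).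
have kx0 : (k * x 0 = k * 1)%g by rewrite x0.
by have [] := hL' _ _ 0 _ _ kx0 erefl (continuous_mulg2 lieG (ck k) cx) (ck _) h (dk V _).
Qed.

(** * The circle group and the covering of the torus *)

Lemma to_circleD {R : realType} (x y : R) :
  to_circle (x + y) = to_circle x + to_circle y.
Proof. by rewrite /to_circle raddfD. Qed.

Lemma to_circle_eqP {R : realType} (x y : R) :
  reflect (exists z : int, x = y + z%:~R) (to_circle x == to_circle y).
Proof.
rewrite /to_circle -Quotient.idealrBE; apply: (iffP idP) => [|[z ->]].
  by move=> /intrP[z hz]; exists z; rewrite -hz addrC subrK.
by rewrite addrAC subrr add0r; apply/intrP; exists z.
Qed.

Lemma circle_coordK {R : realType} (z : circle R) : to_circle (circle_coord z) = z.
Proof.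
rewrite -[RHS]reprK; apply/eqP/to_circle_eqP.
exists (- Num.floor (repr z + 2^-1)).
by rewrite /circle_coord mulrNz.
Qed.

Lemma to_circleK {R : realType} (x : R) :
  - 2^-1 <= x < 2^-1 -> circle_coord (to_circle x) = x.
Proof.
move=> hx; rewrite /circle_coord.
have /eqP/to_circle_eqP[z ->] : to_circle (repr (to_circle x)) = to_circle x.
  by rewrite /to_circle reprK.
suff -> : Num.floor (x + z%:~R + 2^-1) = z by rewrite addrK.
apply: floor_def; rewrite intrD; lra.
Qed.

Lemma to_circlesD {R : realType} {r : nat} (x y : 'rV[R]_r) :
  to_circles (x + y) = to_circles x + to_circles y.
Proof. by apply/rowP => i; rewrite !mxE to_circleD. Qed.

Lemma to_circles_eqP {R : realType} {r : nat} (x y : 'rV[R]_r) :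
  (exists z : 'rV[int]_r, x = y + map_mx intr z) <-> to_circles x = to_circles y.
Proof.
split=> [[z ->]|/rowP h].
  by apply/rowP => i; rewrite !mxE; apply/eqP/to_circle_eqP; exists (z ord0 i).
have h' i : exists z : int, x ord0 i = y ord0 i + z%:~R.
  by apply/to_circle_eqP/eqP; have := h i; rewrite !mxE.
exists (\row_i sval (cid (h' i))); apply/rowP => i; rewrite !mxE.
by case: cid.
Qed.

Lemma to_circlesK {R : realType} {r : nat} (x : 'rV[R]_r) :
  (forall i, - 2^-1 <= x ord0 i < 2^-1) -> map_mx circle_coord (to_circles x) = x.
Proof. by move=> hx; apply/rowP => i; rewrite !mxE to_circleK. Qed.

Lemma dot_int_map {R : realType} {r : nat} (xi z : 'rV[int]_r) :
  exists k : int, dot_int xi (map_mx intr z : 'rV[R]_r) = k%:~R.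
Proof.
exists (\sum_i xi ord0 i * z ord0 i); rewrite /dot_int rmorph_sum /=.
by apply: eq_bigr => i _; rewrite !mxE intrM.
Qed.

Record torus_param {R : realType} {G : topGroupType} {r : nat} (S : set G)
    (chi : G -> 'rV[circle R]_r) (q : 'rV[R]_r -> G) : Prop := TorusParam {
  param_cont : continuous q;
  param_in : forall x, S (q x);
  param_chi : forall x, chi (q x) = to_circles x;
  param_uniq : forall a x, S a -> chi a = to_circles x -> a = q x;
  paramD : forall x y, q (x + y) = (q x * q y)%g;
  param1 : forall z : 'rV[int]_r, q (map_mx intr z) = 1%g }.

(** Since chi o q is the additive projection and [chi] is an injective homomorphism on [S], the map
    [q] is itself a homomorphism that kills integer vectors. *)
Lemma torus_paramP {R : realType} {G : topGroupType} {d r : nat}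
    (AG : atlas R G d) (S : set G) (chi : G -> 'rV[circle R]_r) :
  subgroup S -> torus_iso AG S chi -> exists q, torus_param S chi q.
Proof.
move=> [S1 Sdiv] [[_ chi_inj _] chiD _ [q [[qc _] qE]]]; exists q.
have SV a : S a -> S (a^-1)%g by move=> Sa; rewrite -[(a^-1)%g]mul1g; exact: Sdiv.
have SM a b : S a -> S b -> S (a * b)%g.
  by move=> Sa Sb; rewrite -[b]invgK; apply: Sdiv => //; exact: SV.
have uniq a x : S a -> chi a = to_circles x -> a = q x.
  move=> Sa h; apply: chi_inj; rewrite ?inE//; first exact: (qE x).1.
  by rewrite h (qE x).2.
have chi1 : chi 1%g = 0.
  by apply: (@addrI _ (chi 1%g)); rewrite -chiD// mulg1 addr0.
split => //.
- exact/continuous_subspace_setT.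
- by move=> x; exact: (qE x).1.
- by move=> x; exact: (qE x).2.
- move=> x y; symmetry; apply: uniq; first by apply: SM; exact: (qE _).1.
  by rewrite chiD ?(qE _).2 ?to_circlesD//; exact: (qE _).1.
- move=> z; symmetry; apply: uniq => //; rewrite chi1.
  have -> : 0 = to_circles (0 : 'rV[R]_r).
    by apply: (@addrI _ (to_circles 0)); rewrite -to_circlesD !addr0.
  by symmetry; apply/to_circles_eqP; exists z; rewrite add0r.
Qed.

(** Boundedness takes the place of continuity: if n s stays in the interval, then n |f(s)| = |f(n
    s)| < 1, so f is small at small arguments, and additivity fixes it at the multiples of a small
    step. *)
Lemma small_additive_linear {R : realType} (f : R -> R) (e : R) : 0 < e ->
  (forall t, `|t| < e -> `|f t| < 1) ->
  (forall s t, `|s| < e -> `|t| < e -> `|s + t| < e -> f (s + t) = f s + f t) ->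
  forall t, `|t| < e -> f t = t * (f (e / 2) / (e / 2)).
Proof.
move=> e0 f1 fD.
have e2 : 0 < e / 2 by rewrite divr_gt0.
have f0 : f 0 = 0.
  by apply: (@addrI _ (f 0)); rewrite addr0 -fD ?addr0 ?normr0.
have fM (n : nat) s : `|n%:R * s| < e -> f (n%:R * s) = n%:R * f s.
  elim: n => [|n IH]; first by rewrite !mul0r f0.
  move=> hs.
  have le_s (k : nat) : (k <= n.+1)%N -> `|k%:R * s| < e.
    move=> kn; apply: le_lt_trans hs; rewrite !normrM ler_wpM2r//.
    by rewrite !ger0_norm// ler_nat.
  have h1 := le_s 1%N isT; rewrite mul1r in h1.
  rewrite -natr1 mulrDl mul1r fD ?le_s//; last first.
    by rewrite -[X in _ + X]mul1r -mulrDl natr1.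
  by rewrite IH ?le_s// mulrDl mul1r.
have main t : 0 <= t -> t < e -> f t = t * (f (e / 2) / (e / 2)).
  move=> t0 te; apply/eqP; rewrite -subr_eq0 -normr_eq0 eq_le normr_ge0 andbT.
  apply/ler_addgt0Pl => eta eta0; rewrite addr0.
  pose F := `|f (e / 2)|.
  (* The error will be at most F / n, from the slope on a remainder shorter than h = e / (2 n), plus
     1 / n, from the value of f at that remainder. *)
  pose n := (Num.truncn ((F + 2) / eta)).+1.
  have n0 : 0 < n%:R :> R by rewrite ltr0n.
  have hn : (F + 2) / n%:R <= eta.
    by rewrite ler_pdivrMr// mulrC -ler_pdivrMr// ltW// truncnS_gt.
  pose h := e / 2 / n%:R.
  have h0 : 0 < h by rewrite divr_gt0.
  pose m := Num.truncn (t / h).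
  have [m1 m2] : m%:R * h <= t /\ t < m%:R * h + h.
    have := truncn_itv (divr_ge0 t0 (ltW h0)); rewrite -/m => /andP[a b].
    split; first by rewrite -ler_pdivlMr.
    by move: b; rewrite ltr_pdivrMr// -natr1 mulrDl mul1r.
  have nh : n%:R * h = e / 2 by rewrite /h mulrC divfK// gt_eqF.
  have e2e : e / 2 < e by rewrite ltr_pdivrMr// ltr_pMr// ltr1n.
  have eh : f (e / 2) = n%:R * f h.
    by rewrite -fM nh// gtr0_norm.
  have mh : `|m%:R * h| < e.
    rewrite ger0_norm; first exact: le_lt_trans m1 te.
    by rewrite mulr_ge0// ltW.
  pose s := t - m%:R * h.
  have s0 : 0 <= s by rewrite subr_ge0.
  have sh : s < h by rewrite ltrBlDl.
  have ns : n%:R * s < e.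
    have : n%:R * s <= n%:R * h by rewrite ler_pM2l// ltW.
    by move=> /le_lt_trans; apply; rewrite nh.
  have se : `|s| < e.
    rewrite ger0_norm// (le_lt_trans _ ns)// ler_peMl// ler1n.
    by rewrite /n.
  have ft : f t = m%:R * f h + f s.
    rewrite -fM// -fD//; first by rewrite /s addrC subrK.
    by rewrite /s addrC subrK ger0_norm.
  have fs : `|f s| <= n%:R^-1.
    have : `|n%:R * f s| < 1 by rewrite -fM ?f1// ger0_norm ?mulr_ge0.
    rewrite normrM (ger0_norm (ltW n0)) => /ltW.
    by rewrite mulrC -ler_pdivlMr// mul1r.
  have hE : f h = h * (f (e / 2) / (e / 2)).
    by rewrite eh /h; field; rewrite !gt_eqF.
  rewrite ft hE mulrA -addrA [f s - _]addrC addrA -mulrBl.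
  apply: le_trans hn; apply: le_trans (ler_normD _ _) _.
  apply: (@le_trans _ _ (F / n%:R + n%:R^-1)); last first.
    by rewrite mulrDl lerD2l -[leLHS]mul1r ler_wpM2r ?invr_ge0 ?(ltW n0)// ler1n.
  apply: lerD => //; rewrite normrM.
  have -> : `|m%:R * h - t| = s by rewrite distrC ger0_norm.
  rewrite normrM -/F [`|_^-1|]ger0_norm ?invr_ge0 ?(ltW e2)//.
  apply: (@le_trans _ _ (h * (F / (e / 2)))).
    by apply: ler_wpM2r; [rewrite divr_ge0 ?normr_ge0 ?(ltW e2)|exact: ltW].
  by rewrite /h le_eqVlt; apply/orP; left; apply/eqP; field; rewrite !gt_eqF.
move=> t ht; have [t0|t0] := leP 0 t.
  by apply: main => //; rewrite -(ger0_norm t0).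
have : f (- t) = - t * (f (e / 2) / (e / 2)).
  by apply: main; rewrite ?oppr_ge0 ?(ltW t0)// -normrN ger0_norm// ?oppr_ge0 ltW in ht *.
have : f (t + - t) = f t + f (- t) by apply: fD; rewrite ?normrN// subrr normr0.
rewrite subrr f0 => /esym/eqP; rewrite addr_eq0 => /eqP -> ->.
by rewrite mulNr opprK.
Qed.

(** Near time 0 the curve chi o c lifts to R^r. The lift is additive modulo Z^r, and truly additive
    because it is small; hence it is linear, its slope is the derivative, and c agrees with t |-> q
    (t w) near 0, thus everywhere. *)
Lemma one_param_torus {R : realType} {G : topGroupType} {d r : nat}
    (AG : atlas R G d) (S : set G) (chi : G -> 'rV[circle R]_r)
    (q : 'rV[R]_r -> G) (c : R -> G) :
  torus_iso AG S chi -> torus_param S chi q -> one_param c -> (forall t, S (c t)) ->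
  forall t, c t = q (t *: derive1 (fun t : R => map_mx circle_coord (chi (c t))) 0).
Proof.
move=> [_ chiD chiF _] [qc qS qchi quniq qD q1] hc cS.
have c0 := one_param0 hc.
have q0 : q 0 = 1%g.
  by rewrite -[RHS](q1 0); congr q; apply/rowP => i; rewrite !mxE.
have chi1 : chi 1%g = 0 by apply: (@addrI _ (chi 1%g)); rewrite -chiD -?c0// c0 mulg1 addr0.
have [W [F [oO O1 [Fc _] FE]]] : exists (W : set G) (F : G -> 'rV[R]_r),
    [/\ open W, W 1%g, smooth_on AG (vec_atlas R r) W F &
       forall b, (S `&` W) b -> chi b = to_circles (F b)].
  by apply: chiF; rewrite -c0.
pose f (t : R) := F (c t) - F 1%g.
have tc0 : to_circles 0 = 0 :> 'rV[circle R]_r.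
  by apply: (@addrI _ (to_circles 0)); rewrite -to_circlesD !addr0.
have F1 : to_circles (F 1%g) = 0.
  by rewrite -chi1 FE//; split=> //; rewrite -c0.
have Fcont : {for 1%g, continuous F}.
  have /subspace_continuousP/(_ 1%g O1) := Fc.
  by rewrite within_interior//; apply: open_nbhs_nbhs.
(* Entries below 1/4 serve twice: the integers f(s + t) - f(s) - f(t) are below 1 in absolute value,
   hence 0, and f(t) lies in the range where [circle_coord] inverts the projection. *)
have : \forall t \near 0, W (c t) /\ `|f t| < 4^-1.
  have : \forall g \near (1%g : G), W g /\ `|F g - F 1%g| < 4^-1.
    near=> g; split; near: g; first exact: open_nbhs_nbhs.
    have e0 : 0 < 4^-1 :> R by rewrite invr_gt0.
    have /cvgrPdist_lt/(_ _ e0) := Fcont.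
    by apply: filterS => g; rewrite distrC.
  by move=> nW; have := hc.2 0; rewrite /continuous_at c0 => /(_ _ nW).
move=> /nbhs_ballP[e /= e0 he].
have bl (t : R) : `|t| < e -> ball 0 e t by rewrite -ball_normE /= sub0r normrN.
have fchi (t : R) : `|t| < e -> to_circles (f t) = chi (c t).
  move=> /bl/he[Oc _].
  have -> : f t = F (c t) + (- F 1%g) by [].
  rewrite to_circlesD FE//.
  suff -> : to_circles (- F 1%g) = 0 by rewrite addr0.
  apply: (@addrI _ (to_circles (F 1%g))).
  by rewrite -to_circlesD subrr tc0 F1 addr0.
pose w : 'rV[R]_r := (e / 2)^-1 *: f (e / 2).
have fw (t : R) : `|t| < e -> f t = t *: w.
  move=> te; apply/rowP => i; rewrite [RHS]mxE [w _ _]mxE [_^-1 * _]mulrC.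
  apply: (@small_additive_linear _ (fun t => f t ord0 i) e e0) => // {t te}.
    move=> t /bl/he[_ ft]; rewrite (le_lt_trans (mx_entry_le _ _ _))//.
    by rewrite (lt_trans ft)// invf_lt1// ltr1n.
  move=> s t hs ht hst.
  have : to_circles (f (s + t)) = to_circles (f s + f t).
    by rewrite to_circlesD !fchi// hc.1 chiD.
  move=> /to_circles_eqP[z hz].
  have E : f (s + t) ord0 i = f s ord0 i + f t ord0 i + (z ord0 i)%:~R.
    by rewrite hz [LHS]mxE [X in X + _ = _]mxE [X in _ + X = _]mxE.
  have hs' := le_lt_trans (mx_entry_le (f s) ord0 i) (he _ (bl _ hs)).2.
  have ht' := le_lt_trans (mx_entry_le (f t) ord0 i) (he _ (bl _ ht)).2.
  have hst' := le_lt_trans (mx_entry_le (f (s + t)) ord0 i) (he _ (bl _ hst)).2.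
  suff z0 : z ord0 i = 0 by rewrite E z0 addr0.
  have : `|(z ord0 i)%:~R| < 1 :> R.
    move: hs' ht' hst'; rewrite !ltr_norml E; set x := _%:~R; lra.
  rewrite -intr_norm -[1]/(1%:~R) ltr_int => z1; apply/eqP; move: z1.
  by apply: contraLR => nz; rewrite -leNgt -gtz0_ge1 normr_gt0.
have Yw (t : R) : `|t| < e -> map_mx circle_coord (chi (c t)) = t *: w.
  move=> te; rewrite -fchi// -fw//; apply: to_circlesK => i.
  have := le_lt_trans (mx_entry_le (f t) ord0 i) (he _ (bl _ te)).2.
  by rewrite ltr_norml; lra.
have cq (t : R) : `|t| < e -> c t = q (t *: w).
  by move=> te; apply: quniq => //; rewrite -fw// fchi.
have -> : derive1 (fun t : R => map_mx circle_coord (chi (c t))) 0 = w.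
  rewrite derive1E (@near_eq_derive _ _ _ _ (fun t : R => t *: w)).
    have h : is_diff (0 : R) (fun t : R => t *: w) ( *:%R ^~ w).
      exact: is_diff_scalel.
    by rewrite deriveE ?diff_val ?scale1r//; exact: ex_diff.
  apply/nbhs_ballP; exists e => //= t; rewrite -ball_normE /= sub0r normrN.
  exact: Yw.
suff : c = fun t => q (t *: w) by move=> ->.
apply: (@one_param_eq_near _ _ _ _ (e / 2)) => //.
- split; first by move=> s t; rewrite scalerDl qD.
  by move=> t; apply: continuous_comp; [exact: scalel_continuous|exact: qc].
- by rewrite divr_gt0.
- move=> t /andP[t0 te]; apply: cq; rewrite ger0_norm// (le_lt_trans te)//.
  by rewrite ltr_pdivrMr// ltr_pMr// ltr1n.
Unshelve. all: by end_near. Qed.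

(** The conjugate of exp (t v) is a one-parameter subgroup with velocity Ad v, hence equals exp (t
    Ad v) by uniqueness. So [Dchi] at Ad v is the derivative of [chi] along a curve of the torus,
    and [one_param_torus] applies. *)
Lemma exp_conj_torus {R : realType} {G : topGroupType} {d r : nat}
    (AG : atlas R G d) (E : AG) (ex : 'rV[R]_d -> G) (S : set G)
    (chi : G -> 'rV[circle R]_r) (q : 'rV[R]_r -> G) (k : G) (v : 'rV[R]_d) :
  lie_group AG -> dom AG E 1%g -> lie_exponential E ex ->
  torus_iso AG S chi -> torus_param S chi q ->
  (forall t : R, S (k^-1 * ex (t *: v) * k)%g) ->
  forall t : R, (k^-1 * ex (t *: v) * k)%g =
    q (t *: Dchi ex chi (Ad E ex k^-1%g v)).
Proof.
move=> lieG E1 hex iso par hS t.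
have hop (u : 'rV[R]_d) : one_param (fun t : R => ex (t *: u)).
  by have [h1 h2 _] := hex u.
pose c (t : R) := (k^-1 * ex (t *: v) * k)%g.
have hc : one_param c.
  split.
    move=> s s'; rewrite /c (hop v).1.
    by rewrite -!mulgA mulVKg.
  move=> s; have ck (a : G) : {for s, continuous (fun=> a)} by exact: cvg_cst.
  have := continuous_mulg2 lieG (ck k^-1%g) ((hop v).2 s).
  by move=> /(continuous_mulg2 lieG)/(_ (ck k)).
set u := Ad E ex k^-1%g v.
have dc : is_derive (0 : R) (1 : R) (fun t => coord AG E (c t)) u.
  have [_ _ [dv _]] := hex v.
  have h := @derivable_conjg _ _ _ AG E (fun t : R => ex (t *: v)) (k^-1)%g lieG E1
    ((hop v).2 0) (one_param0 (hop v)) dv.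
  have {}h : derivable (fun t => coord AG E (c t)) 0 1.
    by move: h; under eq_fun do rewrite invgK.
  apply: DeriveDef => //; rewrite /u /Ad derive1E.
  suff -> : (fun t : R => coord AG E (c t)) =
            (fun t : R => coord AG E (k^-1 * ex (t *: v) * k^-1^-1)%g) by [].
  by apply/funext => s; rewrite invgK.
have [_ _ du] := hex u.
have E2 := one_param_unique lieG E1 (hop u) hc du dc.
have Dc (a b : R -> G) : a = b ->
    derive1 (fun t : R => map_mx circle_coord (chi (a t))) 0 =
    derive1 (fun t : R => map_mx circle_coord (chi (b t))) 0 by move=> ->.
have -> : Dchi ex chi u = derive1 (fun t : R => map_mx circle_coord (chi (c t))) 0 :=
  Dc _ _ E2.
exact: (one_param_torus iso par hc hS t).
Qed.

(** A 1-periodic function of <xi, .> descends to the torus, is continuous there thanks to the local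
    smooth lifts of [chi], and extends by Tietze's theorem from the closed set [S] to the compact
    Hausdorff, hence normal, space [G]. *)
Lemma torus_char_ext {R : realType} {G : topGroupType} {d r : nat}
    (AG : atlas R G d) (S : set G) (chi : G -> 'rV[circle R]_r)
    (q : 'rV[R]_r -> G) (tau : R -> R) (xi : 'rV[int]_r) :
  hausdorff_space G -> compact [set: G] -> torus S ->
  torus_iso AG S chi -> torus_param S chi q ->
  continuous tau -> (forall x (z : int), tau (x + z%:~R) = tau x) ->
  (forall x, `|tau x| <= 1) ->
  exists k : G -> R, [/\ continuous k, forall a, `|k a| <= 1 &
    forall u, k (q u) = tau (dot_int xi u)].
Proof.
move=> hausG cG [[S1 _] cS _ _] [_ _ chiF _] [qc qS qchi _ _ _] ctau tauz tau1.
pose kap (a : G) : R^o := tau (dot_int xi (map_mx circle_coord (chi a))).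
(* [circle_coord] jumps at 1/2, but another representative moves <xi, .> by an integer only, which
   [tau] does not see; continuity below relies on this freedom of choice. *)
have kapE a x : chi a = to_circles x -> kap a = tau (dot_int xi x).
  move=> ax; rewrite /kap.
  have : to_circles (map_mx circle_coord (chi a)) = to_circles x.
    by rewrite -ax; apply/rowP => i; rewrite !mxE circle_coordK.
  move=> /to_circles_eqP[z ->]; rewrite dot_intD.
  by have [m ->] := @dot_int_map R r xi z.
have kapc : {within S, continuous kap}.
  apply/subspace_continuousP => a Sa.
  have [W [F [oO Oa [Fc _] FE]]] := chiF a Sa.
  have Fcont : {for a, continuous F}.
    have /subspace_continuousP/(_ a Oa) := Fc.
    by rewrite within_interior//; apply: open_nbhs_nbhs.
  have dotc : continuous (fun x : 'rV[R]_r => dot_int xi x).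
    apply: (@continuous_big R 'I_r +%R 0 xpredT (@add_continuous _) 'rV[R]_r
      (index_enum 'I_r) (fun i x => (xi ord0 i)%:~R * x ord0 i)) => i _ x.
    exact: (cvgM (cvg_cst _) (@coord_continuous _ _ _ ord0 i x)).
  have gc : {for a, continuous (fun b => tau (dot_int xi (F b)))}.
    apply: (@continuous_comp _ _ _ F (fun x => tau (dot_int xi x))) => //.
    by apply: continuous_comp; [exact: dotc|exact: ctau].
  have -> : from_subspace S kap a = tau (dot_int xi (F a)).
    by rewrite /from_subspace; apply: kapE; apply: FE.
  move=> A /gc nA; have nW : nbhs a W by exact: open_nbhs_nbhs.
  change (nbhs a (fun b => S b -> A (kap b))).
  apply: filterS2 nW nA => b Wb Ab Sb.
  by rewrite (kapE b (F b))//; apply: FE.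
have clS := compact_closed hausG cS.
have [|k [kE kc k1]] := continuous_bounded_extension (compact_normal hausG cG) clS ltr01 kapc.
  by move=> x _; exact: tau1.
exists k; split=> // u.
by rewrite -kE ?inE//; apply: kapE.
Qed.

(** * Countable bases and Borel sets *)

(** Second countability at the points of [D]; the members of the base may leave [D]. Each chart
    domain has this property, which is enough to work chart by chart. *)
Definition countable_base_on {X : topologicalType} (D : set X) : Prop :=
  exists B : nat -> set X, (forall n, open (B n)) /\
    forall (O : set X) x, open O -> O x -> D x -> exists n, B n x /\ B n `<=` O.

Lemma countable_base_pickle {X : topologicalType} {I : countType} (D : set X)
    (B : I -> set X) : (forall i, open (B i)) ->
  (forall (O : set X) x, open O -> O x -> D x -> exists i, B i x /\ B i `<=` O) ->
  countable_base_on D.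
Proof.
move=> oB hB; exists (fun n => if unpickle n is Some i then B i else set0).
split=> [n|O x oO Ox Dx]; first by case: unpickle => // *; exact: open0.
by have [i hi] := hB O x oO Ox Dx; exists (pickle i); rewrite pickleK.
Qed.

Lemma countable_base_rV {R : realType} (n : nat) :
  countable_base_on [set: 'rV[R]_n].
Proof.
pose B (i : 'rV[rat]_n * nat) : set 'rV[R]_n :=
  ball (map_mx ratr i.1 : 'rV[R]_n) i.2.+1%:R^-1.
apply: (@countable_base_pickle _ _ _ B) => [i|O x oO Ox _].
  by apply: ball_open; rewrite invr_gt0.
have /nbhs_ballP[e /= e0 he] : nbhs x O by exact: open_nbhs_nbhs.
(* A ball of radius 1 / (k + 1) that contains x has diameter below e. *)
pose k := Num.truncn (2 / e).
have k0 : 0 < k.+1%:R^-1 :> R by rewrite invr_gt0.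
have ke : 2 * k.+1%:R^-1 < e.
  have : 2 / e < k.+1%:R by rewrite truncnS_gt.
  by rewrite ltr_pdivrMr// ltr_pdivrMr// mulrC.
have hq i : {q : rat | `|x ord0 i - ratr q| < k.+1%:R^-1}.
  apply: cid.
  have [|q] := @rat_in_itvoo R (x ord0 i - k.+1%:R^-1) (x ord0 i + k.+1%:R^-1).
    by rewrite ltrBlDr -addrA ltrDl addr_gt0.
  rewrite in_itv/= => hq; exists q; rewrite ltr_norml.
  by move: hq; set z := _^-1; lra.
pose c : 'rV[rat]_n := \row_i sval (hq i).
have xc : ball (map_mx ratr c : 'rV[R]_n) k.+1%:R^-1 x.
  rewrite -ball_normE /= distrC [`|_|]mx_normrE; apply/bigmax_ltP; split=> // -[i j] _ /=.
  by rewrite ord1 !mxE; case: (hq j).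
exists (c, k); split=> // y; rewrite /B /= => hy.
apply: he; rewrite -ball_normE /=; move: xc hy; rewrite -!ball_normE /= => xc hy.
rewrite -[x](subrK (map_mx ratr c : 'rV[R]_n)) -addrA.
apply: le_lt_trans (ler_normD _ _) _; rewrite distrC.
by apply: lt_trans ke; rewrite mulr2n mulrDl mul1r ltrD.
Qed.

Lemma countable_base_homeo {X Y : topologicalType} (D : set X) (f : X -> Y) :
  open D -> open (f @` D) -> homeo_on D (f @` D) f ->
  countable_base_on [set: Y] -> countable_base_on D.
Proof.
move=> oD oI [_ fc [g gK gc]] [B [oB hB]].
exists (fun n => D `&` f @^-1` B n); split=> [n|O x oO Ox Dx].
  rewrite openE => x [Dx Bx].
  have /subspace_continuousP/(_ x Dx) := fc; rewrite within_interior; last first.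
    by apply: open_nbhs_nbhs.
  move=> fx; apply: filterI; first exact: open_nbhs_nbhs.
  by apply: fx; apply: open_nbhs_nbhs.
have Ifx : (f @` D) (f x) by exists x.
have nI : nbhs (f x) (f @` D) by exact: open_nbhs_nbhs.
have ng : nbhs (f x) (g @^-1` O).
  have /subspace_continuousP/(_ _ Ifx) := gc.
  by rewrite within_interior//; apply; rewrite /from_subspace gK//; exact: open_nbhs_nbhs.
have : nbhs (f x) (g @^-1` O `&` f @` D) by exact: filterI.
rewrite nbhsE => -[W [oW Wx] WO].
have [n [Bx BW]] := hB W (f x) oW Wx Logic.I.
exists n; split=> // y [Dy By].
have [+ _] := WO _ (BW _ By).
by rewrite /= gK.
Qed.

Lemma countable_base_cover {X : topologicalType} (D : nat -> set X) :
  (forall n, countable_base_on (D n)) -> (forall x, exists n, D n x) ->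
  countable_base_on [set: X].
Proof.
move=> hD cov.
pose B (i : nat * nat) := sval (cid (hD i.1)) i.2.
apply: (@countable_base_pickle _ _ _ B) => [[n k]|O x oO Ox _].
  by rewrite /B /=; case: cid => B' [].
have [n Dx] := cov x.
have [k hk] : exists k, B (n, k) x /\ B (n, k) `<=` O.
  by rewrite /B /=; case: cid => B' /= [_]; apply.
by exists (n, k).
Qed.

Lemma countable_base_chart {R : realType} {X : topologicalType} {n k : nat}
    (A : atlas R X n) (U : A) : Ck_manifold k A -> countable_base_on (dom A U).
Proof.
move=> [_ _ /(_ U)[oD oI hom] _].
apply: (countable_base_homeo oD oI hom); exact: countable_base_rV.
Qed.

Lemma countable_base_compact {R : realType} {X : ptopologicalType} {n k : nat}
    (A : atlas R X n) : Ck_manifold k A -> compact [set: X] ->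
  countable_base_on [set: X].
Proof.
move=> mA; rewrite compact_cover => cX.
have [_ cov hU _] := mA.
pose ch (x : X) : A := sval (cid (cov x)).
have [x _|x _|D' _ hD'] := cX X setT (fun x => dom A (ch x)).
- by have [] := hU (ch x).
- by exists x => //; rewrite /ch; case: cid.
pose D (i : nat) := dom A (ch (nth point (finmap.enum_fset D') i)).
apply: (@countable_base_cover _ D) => [i|x]; first exact: countable_base_chart mA.
have [y /= yD' xy] := hD' x Logic.I.
by exists (index y (finmap.enum_fset D')); rewrite /D nth_index.
Qed.

Lemma borel_open {X : ptopologicalType} (O : set X) :
  open O -> measurable (O : set (borel X)).
Proof. exact: sub_sigma_algebra. Qed.

(** Open sets of the product belong to the product of the Borel sigma-algebras, because the bases
    write them as countable unions of open rectangles. *)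
Lemma open_prod_measurable {X Y : ptopologicalType} (D : set X) (W : set (X * Y)) :
  countable_base_on D -> countable_base_on [set: Y] -> open W ->
  W `<=` D `*` [set: Y] -> measurable (W : set (borel X * borel Y)).
Proof.
move=> [B [oB hB]] [C [oC hC]] oW WD.
have -> : W = \bigcup_(i in [set i : nat * nat | B i.1 `*` C i.2 `<=` W])
    (B i.1 `*` C i.2).
  apply/seteqP; split=> [[x y] Wxy|p [i hi]]; last exact: hi.
  have /= : nbhs (x, y) W by exact: open_nbhs_nbhs.
  move=> [[N1 N2] /= [n1 n2] hN].
  move: n1 n2; rewrite !nbhsE => -[V1 [oV1 V1x] VN1] [V2 [oV2 V2y] VN2].
  have [Dx _] := WD _ Wxy.
  have [m [Bx BO]] := hB V1 x oV1 V1x Dx.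
  have [n [Cy CO]] := hC V2 y oV2 V2y Logic.I.
  exists (m, n) => // -[a b] [/= Ba Cb]; apply: hN; split => /=.
    exact/VN1/BO.
  exact/VN2/CO.
rewrite bigcup_mkcond; apply: countable_bigcupT_measurable => // i.
case: ifPn => // _.
by apply: measurableX; exact: borel_open.
Qed.

Lemma borel_measurable_fun {d : measure_display} {T : measurableType d}
    {X : ptopologicalType} (D : set T) (f : T -> borel X) : measurable D ->
  (forall O : set X, open O -> measurable (D `&` f @^-1` O)) -> measurable_fun D f.
Proof.
move=> mD h; apply: (measurability (@open X : set (set (borel X)))) => // _ [V oV <-].
exact: h.
Qed.

Lemma continuous_borel {X Y : ptopologicalType} (f : X -> Y) : continuous f ->
  measurable_fun setT (f : borel X -> borel Y).
Proof.
move=> fc; apply: borel_measurable_fun => // O oO; rewrite setTI.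
by apply: borel_open; apply: open_comp => // x _; exact: fc.
Qed.

Lemma continuous_borel_real {R : realType} {X : ptopologicalType} (f : X -> R) :
  continuous f -> measurable_fun setT (f : borel X -> R).
Proof.
move=> fc; apply: (measurability _ (RGenOInfty.measurableE R)) => _ [_ [r ->] <-].
rewrite setTI; apply: borel_open; apply: open_comp => [x _|]; first exact: fc.
exact: interval_open.
Qed.

Lemma within_continuous_open {X Y : topologicalType} (D : set X) (f : X -> Y)
    (O : set Y) : open D -> {within D, continuous f} -> open O ->
  open (D `&` f @^-1` O).
Proof.
move=> oD fc oO; rewrite openE => x [Dx Ox].
have nD : nbhs x D by exact: open_nbhs_nbhs.
have /subspace_continuousP/(_ x Dx) := fc; rewrite within_interior// => fx.
by apply: filterI => //; apply: fx; exact: open_nbhs_nbhs.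
Qed.

(** Compactness gives [G] a countable base, which turns continuity on G * G into measurability for
    the product sigma-algebra. *)
Lemma measurable_mulg {R : realType} {G : topGroupType} {d : nat} (AG : atlas R G d) :
  lie_group AG -> compact [set: G] ->
  measurable_fun setT (fun p : borel G * borel G => (p.1 * p.2)%g : borel G).
Proof.
move=> lieG cG; apply: borel_measurable_fun => // O oO; rewrite setTI.
have [smG _ _] := lieG.
have cb := countable_base_compact (smG 0%N) cG.
apply: (open_prod_measurable cb cb) => //.
apply: open_comp => // x _; exact: (continuous_mulg_at lieG).
Qed.

(** * Bounded measurable functions and almost orthogonality *)

(** Convergence at +oo without naming the limit: stable under uniform approximation, with no limits
    of limits to track. *)
Definition cauchy_oo {R : realType} (F : R -> R) : Prop :=
  forall e, 0 < e -> exists T0, forall s t, T0 <= s -> T0 <= t -> `|F s - F t| <= e.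

Lemma cauchy_ooP {R : realType} (F : R -> R) :
  cauchy_oo F <-> exists l : R, F t @[t --> +oo] --> l.
Proof.
split=> [hF|[l hl] e e0].
  have FF : ProperFilter (F t @[t --> +oo]) by apply: fmap_proper_filter; exact: proper_pinfty_nbhs.
  apply/cvg_ex/cauchy_cvgP/cauchyP => e e0.
  have e2 : 0 < e / 2 by rewrite divr_gt0.
  have [T0 hT] := hF _ e2.
  exists (F T0); suff : \forall t \near +oo, ball (F T0) e (F t) by [].
  near=> t; rewrite -ball_normE /=.
  apply: (@le_lt_trans _ _ (e / 2)); last by rewrite ltr_pdivrMr// ltr_pMr// ltr1n.
  by apply: hT => //; near: t; apply: nbhs_pinfty_ge; exact: num_real.
have e2 : 0 < e / 2 by rewrite divr_gt0.
have /cvgrPdist_le/(_ _ e2)[T0 [_ hT]] := hl.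
exists (T0 + 1) => s t hs ht.
have h1 : `|l - F s| <= e / 2 by apply: hT; rewrite (lt_le_trans _ hs)// ltrDl.
have h2 : `|l - F t| <= e / 2 by apply: hT; rewrite (lt_le_trans _ ht)// ltrDl.
have -> : F s - F t = (l - F t) - (l - F s) by ring.
by rewrite (le_trans (ler_normB _ _))// [leRHS]splitr lerD.
Unshelve. all: by end_near. Qed.

Lemma cauchy_oo_cst {R : realType} (c : R) : cauchy_oo (fun=> c).
Proof. by move=> e e0; exists 0 => *; rewrite subrr normr0 ltW. Qed.

Lemma cauchy_ooD {R : realType} (F G : R -> R) :
  cauchy_oo F -> cauchy_oo G -> cauchy_oo (fun t => F t + G t).
Proof.
move=> /cauchy_ooP[l hl] /cauchy_ooP[l' hl']; apply/cauchy_ooP.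
by exists (l + l'); exact: cvgD.
Qed.

Lemma cauchy_ooZ {R : realType} (c : R) (F : R -> R) :
  cauchy_oo F -> cauchy_oo (fun t => c * F t).
Proof.
move=> /cauchy_ooP[l hl]; apply/cauchy_ooP.
by exists (c * l); apply: cvgM => //; exact: cvg_cst.
Qed.

Lemma cauchy_oo_sum {R : realType} (I : Type) (s : seq I) (F : I -> R -> R) :
  (forall i, cauchy_oo (F i)) -> cauchy_oo (fun t => \sum_(i <- s) F i t).
Proof.
move=> hF; elim: s => [|i s IH].
  by under eq_fun do rewrite big_nil; exact: cauchy_oo_cst.
by under eq_fun do rewrite big_cons; exact: cauchy_ooD.
Qed.

Lemma cauchy_oo_approx {R : realType} (F : R -> R) :
  (forall e, 0 < e -> exists2 G, cauchy_oo G & forall t, `|F t - G t| <= e) ->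
  cauchy_oo F.
Proof.
move=> hF e e0; have e3 : 0 < e / 3 by rewrite divr_gt0.
have [G cG FG] := hF _ e3; have [T0 hT] := cG _ e3.
exists T0 => s t hs ht.
have := hT s t hs ht; have := FG s; have := FG t; rewrite !ler_norml; lra.
Qed.

Lemma cvg_oo0P {R : realType} (F : R -> R) : F t @[t --> +oo] --> 0 <->
  forall e, 0 < e -> exists T0, forall t, T0 <= t -> `|F t| <= e.
Proof.
split=> [/cvgrPdist_le h e e0|h].
  have [T0 [_ hT]] := h e e0; exists (T0 + 1) => t ht.
  have := hT t; rewrite sub0r normrN; apply.
  by rewrite (lt_le_trans _ ht)// ltrDl.
apply/cvgrPdist_le => e e0; have [T0 hT] := h e e0.
by near=> t; rewrite sub0r normrN; apply: hT; near: t; apply: nbhs_pinfty_ge; exact: num_real.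
Unshelve. all: by end_near. Qed.

Lemma norm_indic_le1 {T : Type} {R : realType} (A : set T) x : `|\1_A x : R| <= 1.
Proof. by rewrite indicE; case: (_ \in _); rewrite ?normr1 ?normr0. Qed.

Section bounded_measurable.
Context {d : measure_display} {T : measurableType d} {R : realType}.
Implicit Types (mu : {measure set T -> \bar R}) (f g : T -> R).

(** Over a finite measure these functions are integrable, and so are their products, which disposes
    of integrability conditions. *)
Definition bmf f : Prop :=
  measurable_fun setT f /\ exists B, forall x, `|f x| <= B.

Lemma bmf_bound f : bmf f -> exists2 B, 0 <= B & forall x, `|f x| <= B.
Proof.
move=> [_ [B hB]]; exists `|B| => // x.
by rewrite (le_trans (hB x))// ler_norm.
Qed.

Lemma bmf_cst c : bmf (fun=> c).
Proof. by split; [exact: measurable_cst|exists `|c|]. Qed.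

Lemma bmfD f g : bmf f -> bmf g -> bmf (fun x => f x + g x).
Proof.
move=> [mf [B hB]] [mg [C hC]]; split; first exact: measurable_funD.
by exists (B + C) => x; rewrite (le_trans (ler_normD _ _))// lerD.
Qed.

Lemma bmfM f g : bmf f -> bmf g -> bmf (fun x => f x * g x).
Proof.
move=> [mf [B hB]] [mg [C hC]]; split; first exact: measurable_funM.
by exists (B * C) => x; rewrite normrM ler_pM.
Qed.

Lemma bmfZ c f : bmf f -> bmf (fun x => c * f x).
Proof. by move=> hf; apply: bmfM => //; exact: bmf_cst. Qed.

Lemma bmfB f g : bmf f -> bmf g -> bmf (fun x => f x - g x).
Proof.
move=> hf hg; have : bmf (fun x => f x + (-1) * g x) by apply: bmfD => //; exact: bmfZ.
by under eq_fun do rewrite mulN1r.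
Qed.

Lemma bmf_norm f : bmf f -> bmf (fun x => `|f x|).
Proof.
move=> [mf [B hB]]; split; first exact: measurableT_comp.
by exists B => x; rewrite normr_id.
Qed.

Lemma bmf_sum (I : Type) (s : seq I) (F : I -> T -> R) :
  (forall i, bmf (F i)) -> bmf (fun x => \sum_(i <- s) F i x).
Proof.
move=> hF; elim: s => [|i s IH].
  by under eq_fun do rewrite big_nil; exact: bmf_cst.
by under eq_fun do rewrite big_cons; exact: bmfD.
Qed.

Lemma bmf_indic (A : set T) : measurable A -> bmf (\1_A : T -> R).
Proof.
move=> mA; split; first exact: measurable_indic.
by exists 1; exact: norm_indic_le1.
Qed.

Lemma bmf_integrable mu f : (mu setT < +oo)%E -> bmf f ->
  mu.-integrable setT (EFin \o f).
Proof.
move=> fin [mf [B hB]]; apply: measurable_bounded_integrable => //.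
exists B; split; first exact: num_real.
by move=> M BM x _ /=; rewrite (le_trans (hB x))// ltW.
Qed.

Lemma bmf_intD mu f g : (mu setT < +oo)%E -> bmf f -> bmf g ->
  \int[mu]_x (f x + g x) = \int[mu]_x f x + \int[mu]_x g x.
Proof. by move=> fin hf hg; rewrite RintegralD//; exact: bmf_integrable. Qed.

Lemma bmf_intB mu f g : (mu setT < +oo)%E -> bmf f -> bmf g ->
  \int[mu]_x (f x - g x) = \int[mu]_x f x - \int[mu]_x g x.
Proof. by move=> fin hf hg; rewrite RintegralB//; exact: bmf_integrable. Qed.

Lemma bmf_intZ mu c f : (mu setT < +oo)%E -> bmf f ->
  \int[mu]_x (c * f x) = c * \int[mu]_x f x.
Proof. by move=> fin hf; rewrite RintegralZl//; exact: bmf_integrable. Qed.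

Lemma bmf_int_sum mu (I : Type) (s : seq I) (F : I -> T -> R) : (mu setT < +oo)%E ->
  (forall i, bmf (F i)) ->
  \int[mu]_x (\sum_(i <- s) F i x) = \sum_(i <- s) \int[mu]_x F i x.
Proof.
move=> fin hF; elim: s => [|i s IH].
  by rewrite big_nil /Rintegral integral0_eq// => x _; rewrite big_nil.
rewrite big_cons -IH -bmf_intD//; last exact: bmf_sum.
by apply: eq_Rintegral => x _; rewrite big_cons.
Qed.

Lemma bmf_le_int mu f g : (mu setT < +oo)%E -> bmf f -> bmf g ->
  (forall x, f x <= g x) -> \int[mu]_x f x <= \int[mu]_x g x.
Proof.
by move=> fin hf hg fg; apply: le_Rintegral => //; exact: bmf_integrable.
Qed.

Lemma bmf_norm_int mu f : (mu setT < +oo)%E -> bmf f ->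
  `|\int[mu]_x f x| <= \int[mu]_x `|f x|.
Proof. by move=> fin hf; apply: le_normr_Rintegral => //; exact: bmf_integrable. Qed.

Lemma bmf_int_le mu f B : (mu setT < +oo)%E -> bmf f -> (forall x, `|f x| <= B) ->
  `|\int[mu]_x f x| <= B * fine (mu setT).
Proof.
move=> fin hf hB; apply: le_trans (bmf_norm_int fin hf) _.
rewrite -(@Rintegral_cst _ _ _ mu setT)//.
by apply: bmf_le_int => //; [exact: bmf_norm|exact: bmf_cst].
Qed.

Lemma eq_int mu f g : f =1 g -> \int[mu]_x f x = \int[mu]_x g x.
Proof. by move=> /funext ->. Qed.

Lemma bmf_EFin_int mu f : (mu setT < +oo)%E -> bmf f ->
  (\int[mu]_x (f x)%:E)%E = (\int[mu]_x f x)%:E.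
Proof.
move=> fin hf; rewrite /Rintegral fineK//; apply: integrable_fin_num => //.
exact: bmf_integrable.
Qed.

(* A van der Corput argument: the signed sum of N almost orthogonal u_t has norm
   O(sqrt N), too small to correlate with phi to the order of N. *)
Lemma almost_orthogonal_null mu (u : R -> T -> R) (phi : T -> R) :
  (mu setT < +oo)%E -> (forall t, bmf (u t)) -> (forall t x, `|u t x| <= 1) ->
  bmf phi ->
  (forall e, 0 < e -> exists T0, forall s t, T0 <= s -> T0 + s <= t ->
     `|\int[mu]_x (u s x * u t x)| <= e) ->
  forall e, 0 < e -> exists T0, forall t, T0 <= t -> `|\int[mu]_x (u t x * phi x)| <= e.
Proof.
move=> fin bu u1 bphi huu e e0; apply: contrapT => /forallNP hno.
have {hno} hbig T0 : {t : R | T0 <= t /\ e < `|\int[mu]_x (u t x * phi x)|}.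
  apply: cid; have /existsNP[t /not_implyP[ht /negP]] := hno T0.
  by rewrite -ltNge => h; exists t.
pose M := fine (mu setT).
have M0 : 0 <= M by exact: fine_ge0.
pose P := \int[mu]_x (phi x ^+ 2).
have bphi2 : bmf (fun x => phi x ^+ 2) by under eq_fun do rewrite expr2; exact: bmfM.
have P0 : 0 <= P by apply: Rintegral_ge0 => x _; rewrite sqr_ge0.
(* The square of f - K c phi will be expanded, K being the number of terms: this c makes the term in
   phi^2 at most K^2 c e, against a cross term of at least 2 K^2 c e. *)
pose c := e / (P + 1).
have P1 : 0 < P + 1 by rewrite ltr_wpDl.
have c0 : 0 < c by rewrite divr_gt0.
have ce0 : 0 < c * e / 4 by rewrite divr_gt0// mulr_gt0.
have [T1 hT1] := huu _ ce0.
pose T0 := Num.max T1 0.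
(* Makes the diagonal contribution K M smaller than K^2 c e / 4. *)
pose K := (Num.truncn (4 * M / (c * e))).+1.
have K0 : 0 < K%:R :> R by rewrite ltr0n.
have hK : M < K%:R * (c * e / 4).
  have : 4 * M / (c * e) < K%:R by rewrite truncnS_gt.
  rewrite ltr_pdivrMr ?(mulr_gt0 c0 e0)// => h.
  rewrite -(@ltr_pM2l _ 4)//; apply: lt_le_trans h _.
  by rewrite le_eqVlt; apply/orP; left; apply/eqP; field.
(* Times at which the correlation exceeds e, pairwise separated by at least T0 so that the almost
   orthogonality applies to any two of them. *)
pose tau := fix tau (n : nat) : R :=
  if n is n'.+1 then sval (hbig (T0 + tau n')) else sval (hbig T0).
have tauT n : T0 <= tau n.
  elim: n => [|n IH] /=; first by case: (hbig T0) => ? [].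
  case: (hbig _) => x /= [hx _]; apply: le_trans hx.
  by rewrite lerDl (le_trans _ IH)// le_max lexx orbT.
have tauS n : T0 + tau n <= tau n.+1 by move=> /=; case: (hbig (T0 + tau n)) => x /= [].
have T00 : 0 <= T0 by rewrite le_max lexx orbT.
have tau_sep i j : (i < j)%N -> T0 + tau i <= tau j.
  elim: j => // j IH; rewrite ltnS leq_eqVlt => /orP[/eqP ->//|/IH h].
  by rewrite (le_trans h)// (le_trans _ (tauS j))// lerDr.
have taub n : e < `|\int[mu]_x (u (tau n) x * phi x)|.
  by case: n => [|n] /=; case: (hbig _) => x /= [].
pose a (i : 'I_K) := \int[mu]_x (u (tau i) x * phi x).
(* The signs prevent cancellation: every term correlates positively with phi. *)
pose f x := \sum_(i < K) Num.sg (a i) * u (tau i) x.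
have bsu (i : 'I_K) : bmf (fun x => Num.sg (a i) * u (tau i) x) by exact: bmfZ.
have bf : bmf f by exact: bmf_sum.
have fphi : K%:R * e <= \int[mu]_x (f x * phi x).
  rewrite (@eq_int mu _ (fun x => \sum_(i < K) Num.sg (a i) * (u (tau i) x * phi x))); last first.
    by move=> x; rewrite /f mulr_suml; apply: eq_bigr => i _; rewrite mulrA.
  rewrite bmf_int_sum//; last by move=> i; apply: bmfZ; exact: bmfM.
  rewrite mulr_natl -[X in _ *+ X](card_ord K) -sumr_const; apply: ler_sum => i _.
  rewrite bmf_intZ//; last exact: bmfM.
  by rewrite -/(a i) -normrEsg ltW// taub.
have f2 : \int[mu]_x (f x ^+ 2) <= K%:R * M + K%:R ^+ 2 * (c * e / 4).
  rewrite (@eq_int mu _ (fun x => \sum_(i < K) \sum_(j < K)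
     (Num.sg (a i) * Num.sg (a j)) * (u (tau i) x * u (tau j) x))); last first.
    move=> x; rewrite /f expr2 mulr_suml; apply: eq_bigr => i _.
    by rewrite mulr_sumr; apply: eq_bigr => j _; rewrite mulrACA.
  have bij (i j : 'I_K) : bmf (fun x =>
      (Num.sg (a i) * Num.sg (a j)) * (u (tau i) x * u (tau j) x)).
    by apply: bmfZ; exact: bmfM.
  rewrite bmf_int_sum//; last by move=> i; exact: bmf_sum.
  have sg1 (x : R) : `|Num.sg x| <= 1 by rewrite normr_sg; case: (_ != _).
  have le1 i (j : 'I_K) : \int[mu]_x ((Num.sg (a i) * Num.sg (a j)) * (u (tau i) x * u (tau j) x))
      <= (if i == j then M else 0) + c * e / 4.
    rewrite bmf_intZ//; last exact: bmfM.
    apply: le_trans (ler_norm _) _; rewrite normrM normrM.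
    apply: (@le_trans _ _ `|\int[mu]_x (u (tau i) x * u (tau j) x)|).
      by rewrite ler_piMl// mulr_ile1.
    case: eqVneq => [->|ij].
      apply: (@le_trans _ _ M); last by rewrite lerDl ltW.
      rewrite -[M]mul1r; apply: bmf_int_le => //; first exact: bmfM.
      by move=> x; rewrite normrM mulr_ile1.
    rewrite add0r.
    have sep (k l : 'I_K) : (k < l)%N -> `|\int[mu]_x (u (tau k) x * u (tau l) x)| <= c * e / 4.
      move=> kl; apply: hT1; first by rewrite (le_trans _ (tauT k))// le_max lexx.
      by rewrite (le_trans _ (tau_sep _ _ kl))// lerD2r le_max lexx.
    have /orP[kl|kl] : (i < j)%N || (j < i)%N by rewrite -neq_ltn.
      exact: sep.
    by under eq_Rintegral do rewrite mulrC; exact: sep.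
  apply: (@le_trans _ _ (\sum_(i < K) \sum_(j < K) ((if i == j then M else 0) + c * e / 4))).
    apply: ler_sum => i _; rewrite bmf_int_sum//.
    by apply: ler_sum => j _; exact: le1.
  rewrite (eq_bigr (fun _ => M + K%:R * (c * e / 4))); last first.
    move=> i _; rewrite big_split /= sumr_const card_ord mulr_natl; congr (_ + _).
    by rewrite -big_mkcond /= (big_pred1 i)// => j; rewrite eq_sym.
  rewrite sumr_const card_ord -[_ *+ K]mulr_natl le_eqVlt.
  by apply/orP; left; apply/eqP; ring.
(* In units of K^2 c e, this square is below 1/4 + 1/4 - 2 + 1 < 0, a contradiction. *)
have : 0 <= \int[mu]_x ((f x - (K%:R * c) * phi x) ^+ 2).
  by apply: Rintegral_ge0 => x _; rewrite sqr_ge0.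
have bf2 : bmf (fun x => f x ^+ 2) by under eq_fun do rewrite expr2; exact: bmfM.
rewrite (@eq_int mu _ (fun x => f x ^+ 2 +
    ((- (2 * (K%:R * c))) * (f x * phi x) + (K%:R * c) ^+ 2 * phi x ^+ 2))); last first.
  by move=> x; ring.
rewrite bmf_intD//; last by apply: bmfD; apply: bmfZ => //; exact: bmfM.
rewrite bmf_intD//; [|by apply: bmfZ; exact: bmfM|exact: bmfZ].
rewrite bmf_intZ//; last exact: bmfM.
rewrite bmf_intZ// -/P => hpos.
have h1 : 2 * (K%:R * c) * (K%:R * e) <= 2 * (K%:R * c) * \int[mu]_x (f x * phi x).
  by rewrite ler_wpM2l// mulr_ge0// mulr_ge0// ltW.
have h2 : (K%:R * c) ^+ 2 * P <= K%:R ^+ 2 * (c * e).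
  have -> : (K%:R * c) ^+ 2 * P = K%:R ^+ 2 * (c * (c * P)) by ring.
  rewrite ler_wpM2l ?sqr_ge0// ler_wpM2l ?(ltW c0)//.
  by rewrite /c mulrAC ler_pdivrMr// ler_wpM2l ?(ltW e0)// lerDl.
have h3 : K%:R * M < K%:R ^+ 2 * (c * e / 4).
  by rewrite expr2 -mulrA ltr_pM2l.
have h4 : 0 < K%:R ^+ 2 * (c * e) := mulr_gt0 (exprn_gt0 2 K0) (mulr_gt0 c0 e0).
have h5 : 2 * (K%:R * c) * (K%:R * e) = 2 * (K%:R ^+ 2 * (c * e)) by ring.
have h6 : K%:R ^+ 2 * (c * e / 4) = K%:R ^+ 2 * (c * e) / 4 by ring.
move: hpos h1 h2 h3 h4 f2; rewrite h5 h6 mulNr.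
set X := K%:R ^+ 2 * (c * e); set Y := _ * P; set Z := 2 * _ * _; set W := \int[mu]_x (_ ^+ 2).
lra.
Qed.

End bounded_measurable.

(** * Limits of bounded functions, compactness and Urysohn functions *)

Section bounded_limits.
Context {d : measure_display} {T : measurableType d} {R : realType}.
Implicit Types (mu : {measure set T -> \bar R}) (f g : T -> R).

Lemma bmf_dct mu (f_ : nat -> T -> R) f (B : R) : (mu setT < +oo)%E ->
  (forall n, bmf (f_ n)) -> bmf f -> (forall n x, `|f_ n x| <= B) ->
  (forall x, f_ n x @[n --> \oo] --> f x) ->
  forall e, 0 < e -> exists n0, forall n, (n0 <= n)%N ->
    \int[mu]_x `|f x - f_ n x| <= e.
Proof.
move=> fin bf_ bf fB fcvg e e0.
have H1 : forall n, measurable_fun setT (fun x => (f_ n x)%:E).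
  by move=> n; apply/measurable_EFinP; have [] := bf_ n.
have H2 : measurable_fun setT (fun x => (f x)%:E) by apply/measurable_EFinP; case: bf.
have H3 : {ae mu, forall x, setT x -> (f_ n x)%:E @[n --> \oo] --> (f x)%:E}.
  by apply: aeW => x _; apply: cvg_EFin => //; [exact: nearW|exact: fcvg].
have H4 : mu.-integrable setT (fun=> B%:E).
  exact: (bmf_integrable fin (bmf_cst B)).
have H5 : {ae mu, forall x n, setT x -> (`|(f_ n x)%:E| <= B%:E)%E}.
  by apply: aeW => x n _; rewrite /= lee_fin.
have [_ + _] := dominated_convergence measurableT H1 H2 H3 H4 H5.
move=> /= /fine_cvgP[_ /cvgrPdist_le/(_ e e0)[n0 _ hn]].
exists n0 => n hn0; have := hn n hn0; rewrite /= sub0r normrN => /(le_trans _); apply.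
rewrite -[leLHS]/(Rintegral _ _ _) le_eqVlt; apply/orP; left; apply/eqP.
have -> : (\int[mu]_x `|(f_ n x)%:E - (f x)%:E|)%E = (\int[mu]_x `|f x - f_ n x|%:E)%E.
  by apply: eq_integral => x _; rewrite -EFinB abse_EFin distrC.
by rewrite ger0_norm// fine_ge0// integral_ge0// => x _; rewrite lee_fin.
Qed.

Lemma bmf_bigcup_approx mu (F : nat -> set T) : (mu setT < +oo)%E ->
  (forall n, measurable (F n)) ->
  forall e, 0 < e -> exists n0, forall n, (n0 <= n)%N ->
    \int[mu]_x `|\1_(\bigcup_k F k) x - \1_(\bigcup_(k < n) F k) x| <= e.
Proof.
move=> fin mF; apply: (@bmf_dct mu _ _ 1) => //.
- by move=> n; apply: bmf_indic; apply: bigcup_measurable.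
- by apply: bmf_indic; exact: bigcupT_measurable.
- by move=> n x; exact: norm_indic_le1.
- move=> x; have [[k _ Fk]|nF] := pselect ((\bigcup_k F k) x).
    apply: (@cvg_trans _ (cst (\1_(\bigcup_k F k) x) @ \oo)); last exact: cvg_cst.
    apply: near_eq_cvg; exists k.+1 => //= n kn; rewrite !indicE !mem_set//.
      by exists k.
    by exists k.
  have nFn n : ~ (\bigcup_(k < n) F k) x by move=> [k _ Fk]; apply: nF; exists k.
  rewrite (_ : (fun n => _) = cst (\1_(\bigcup_k F k) x)); first exact: cvg_cst.
  by apply/funext => n; rewrite /= !indicE !memNset.
Qed.

Lemma indic_bigcup_recr (F : nat -> set T) n x : trivIset setT F ->
  \1_(\bigcup_(k < n.+1) F k) x = \1_(\bigcup_(k < n) F k) x + \1_(F n) x :> R.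
Proof.
move=> tF; rewrite bigcup_mkord big_ord_recr /= -bigcup_mkord.
rewrite !indicE in_setU; case: (boolP (x \in \bigcup_(k < n) F k)) => /= [/set_mem[k /= kn Fk]|_].
  rewrite memNset ?addr0// => Fn.
  have /trivIsetP/(_ k n Logic.I Logic.I) := tF; rewrite (ltn_eqF kn) => /(_ isT).
  by move=> /seteqP[/(_ x) + _]; apply.
by rewrite add0r.
Qed.

End bounded_limits.

(** The tube lemma: compactness of the second factor gives one neighbourhood of x0 for all y. *)
Lemma compact_uniform_near {R : realType} {X Y : topologicalType} (F : X * Y -> R)
    (x0 : X) (e : R) : compact [set: Y] -> continuous F -> 0 < e ->
  \forall x \near x0, forall y, `|F (x, y) - F (x0, y)| <= e.
Proof.
move=> /compact_near_coveringP cY cF e0.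
have := cY X (nbhs x0) (fun x y => `|F (x, y) - F (x0, y)| <= e).
move=> h; suff h' : forall y, [set: Y] y -> \forall y' \near y & x \near nbhs x0,
    `|F (x, y') - F (x0, y')| <= e.
  by apply: filterS (h (nbhs_filter x0) h') => x hx y; exact: hx.
move=> y _.
have e2 : 0 < e / 2 by rewrite divr_gt0.
have /cvgrPdist_le/(_ _ e2)[[N1 N2] /= [n1 n2] hN] := cF (x0, y).
exists (N2, N1) => //= -[y' x'] [/= hy' hx'].
have h1 : `|F (x0, y) - F (x', y')| <= e / 2 by apply: (hN (x', y')).
have h2 : `|F (x0, y) - F (x0, y')| <= e / 2.
  by apply: (hN (x0, y')); split => //=; exact: nbhs_singleton.
move: h1 h2; rewrite !ler_norml; lra.
Qed.

(** Each point of [V] has a Urysohn function vanishing off [V]. Keeping one function for every basic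
    open set that admits one, and 0 for the others, leaves a countable family. *)
Lemma open_cozero {R : realType} {G : topologicalType} (V : set G) :
  hausdorff_space G -> compact [set: G] -> countable_base_on [set: G] -> open V ->
  exists k : nat -> G -> R,
    [/\ forall n, continuous (k n), forall n x, 0 <= k n x <= 1 &
        V = \bigcup_n [set x | 0 < k n x]].
Proof.
move=> hG cG [B [oB hB]] oV.
pose P (n : nat) (f : G -> R) :=
  [/\ continuous f, forall x, 0 <= f x <= 1, B n `<=` [set x | 0 < f x] &
      [set x | 0 < f x] `<=` V].
have hk n : {k : G -> R | [/\ continuous k, forall x, 0 <= k x <= 1,
     [set x | 0 < k x] `<=` V & (exists f, P n f) -> B n `<=` [set x | 0 < k x]]}.
  apply: cid; have [[f [f1 f2 f3 f4]]|nf] := pselect (exists f, P n f); first by exists f.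
  exists (fun=> 0); split=> //; first by move=> x; exact: cvg_cst.
    by move=> x; rewrite lexx ler01.
  by move=> x /=; rewrite ltxx.
exists (fun n => sval (hk n)); split.
- by move=> n; case: (hk n) => f [].
- by move=> n; case: (hk n) => f [].
- apply/seteqP; split=> [x Vx|x [n _]]; last by rewrite /=; case: (hk n) => f /= [_ _ fV _]; exact: fV.
  have clV : closed (~` V) by rewrite closedC.
  have clx : closed [set x].
    by apply: compact_closed => //; exact: compact_set1.
  have [|f [fc f01 f0 f1]] := (uniform_separatorP (R := R) (~` V) [set x]).1
      (normal_uniform_separator (compact_normal hG cG) clV clx _).
    by apply/seteqP; split=> // y [/= nVy yx]; apply: nVy; rewrite yx.
  have fx : f x = 1 by apply: f1; exists x.
  have f01' y : 0 <= f y <= 1 by have := f01 (f y); rewrite /= in_itv/=; apply; exists y.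
  have opf : open [set y | 0 < f y].
    by apply: (@open_comp _ _ f [set z | 0 < z]) => // y _; exact: fc.
  have [n [Bx Bf]] := hB [set y | 0 < f y] x opf (ltac:(by rewrite /= fx)) Logic.I.
  exists n => //=; case: (hk n) => g [_ _ _ hg] /=; apply: hg => //.
  exists f; split=> // y /= fy.
  have [//|nVy] := pselect (V y).
  by have := f0 (f y); rewrite /= => h; move: fy; rewrite h ?ltxx//; exists y.
Qed.

(** * Oscillatory modes *)

Lemma bmf_map {d1 d2 : measure_display} {T1 : measurableType d1}
    {T2 : measurableType d2} {R : realType} (phi : T1 -> T2) (F : T2 -> R) :
  measurable_fun setT phi -> bmf F -> bmf (F \o phi).
Proof.
move=> mphi [mF [B hB]]; split; first exact: measurableT_comp.
by exists B => x; exact: hB.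
Qed.

Lemma bmf_continuous {d : measure_display} {T : measurableType d} {R : realType}
    (phi : R -> R) (Y : T -> R) (B : R) : continuous phi -> (forall x, `|phi x| <= B) ->
  measurable_fun setT Y -> bmf (fun x => phi (Y x)).
Proof.
move=> cphi hB mY; split; last by exists B => x; exact: hB.
by apply: measurableT_comp mY; exact: continuous_measurable_fun.
Qed.

Lemma norm_cos_le1 {R : realType} (x : R) : `|cos x| <= 1.
Proof. by rewrite ler_norml cos_geN1 cos_le1. Qed.

Lemma bmf_cosZ {d : measure_display} {T : measurableType d} {R : realType}
    (Y : T -> R) (a b : R) : measurable_fun setT Y -> bmf (fun x => cos (a * Y x + b)).
Proof.
move=> mY; apply: (@bmf_continuous _ _ _ cos (fun x => a * Y x + b) 1).
- exact: continuous_cos.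
- exact: norm_cos_le1.
- by apply: measurable_funD => //; exact: measurable_funM.
Qed.

(** The factor [c] covers image measures (c = 1) and the first marginal of a product restricted to X
    x V (c = the mass of V). Signed functions reduce to nonnegative ones by adding their bound. *)
Lemma integral_map {d1 d2 : measure_display} {T1 : measurableType d1}
    {T2 : measurableType d2} {R : realType} (mu1 : {measure set T1 -> \bar R})
    (mu2 : {measure set T2 -> \bar R}) (phi : T1 -> T2) (c : R) (F : T2 -> R) :
  0 <= c -> measurable_fun setT phi -> (mu2 setT < +oo)%E ->
  (forall A, measurable A -> mu1 (phi @^-1` A) = c%:E * mu2 A)%E -> bmf F ->
  \int[mu1]_x F (phi x) = c * \int[mu2]_x F x.
Proof.
move=> c0 mphi fin2 h bF.
have fin1 : (mu1 setT < +oo)%E.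
  rewrite -[setT](preimage_setT phi) h//.
  by rewrite lte_mul_pinfty// lee_fin.
have pos (H : T2 -> R) : bmf H -> (forall x, 0 <= H x) ->
    \int[mu1]_x H (phi x) = c * \int[mu2]_x H x.
  move=> bH H0; apply: EFin_inj; rewrite EFinM -!bmf_EFin_int//; last first.
    exact: (bmf_map mphi bH).
  have mH : measurable_fun setT (EFin \o H) by apply/measurable_EFinP; case: bH.
  have := @ge0_integral_pushforward _ _ _ _ R phi mphi mu1 setT (EFin \o H) measurableT mH.
  rewrite preimage_setT => <-; last by move=> y _; rewrite lee_fin.
  etransitivity.
    apply: (@eq_measure_integral _ _ _ setT (mscale (NngNum c0) mu2)) => A mA _.
    exact: h.
  by rewrite ge0_integral_mscale// => x _; rewrite lee_fin.
have [B B0 hB] := bmf_bound bF.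
have bFB : bmf (fun x => F x + B) by apply: bmfD => //; exact: bmf_cst.
have := pos _ bFB; rewrite bmf_intD//; [|exact: (bmf_map mphi bF)|exact: bmf_cst].
rewrite bmf_intD//; last exact: bmf_cst.
have := pos _ (bmf_cst B) (fun=> B0).
set I1 := \int[mu1]_x B; set I2 := \int[mu2]_x B.
move=> h1 h2; have := h2 _; rewrite h1 mulrDr => /(_ _)/addIr; apply => x.
by have := hB x; rewrite ler_norml => /andP[]; lra.
Qed.

Lemma integral_mrestr {d : measure_display} {T : measurableType d} {R : realType}
    (mu : {measure set T -> \bar R}) (D : set T) (mD : measurable D) (F : T -> R) :
  (mu setT < +oo)%E -> bmf F -> \int[mrestr mu mD]_x F x = \int[mu]_x (F x * \1_D x).
Proof.
move=> fin bF; transitivity (\int[mu]_(x in D) F x).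
  rewrite /Rintegral; congr fine.
  have finr : (mrestr mu mD setT < +oo)%E.
    by rewrite /mrestr setTI (le_lt_trans _ fin)// le_measure ?inE.
  rewrite (@negligible_integral _ _ _ (mrestr mu mD) setT (~` D))//; last 3 first.
  - exact: measurableC.
  - exact: bmf_integrable.
  - by rewrite /= /mrestr setICl measure0.
  rewrite setTD setCK; apply: eq_measure_integral => A mA AD.
  by rewrite /= /mrestr setIidl.
rewrite Rintegral_mkcond; apply: eq_int => x; rewrite patchE indicE.
by case: (_ \in _); rewrite ?mulr1 ?mulr0.
Qed.

Lemma measurable_neq0 {d : measure_display} {T : measurableType d} {R : realType}
  (Y : T -> R) : measurable_fun setT Y -> measurable [set x | Y x != 0].
Proof.
move=> mY; rewrite (_ : [set x | _] = ~` (Y @^-1` [set 0])).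
  by apply: measurableC; rewrite -[X in measurable X]setTI; exact: mY.
by apply/seteqP; split=> x /= /eqP.
Qed.

Section modes.
Context {d : measure_display} {T : measurableType d} {R : realType}.
Variables (mu : {measure set T -> \bar R}) (fin : (mu setT < +oo)%E).
Implicit Types Y : T -> R.

(** Real form of the Rajchman condition at +oo for the image of [mu] under [Y], off 0: the phases 0
    and - pi / 2 give cosine and sine. *)
Definition mode_vanish Y : Prop := forall a : R,
  \int[mu]_x (cos (2 * pi * t * Y x + a) * \1_[set x | Y x != 0] x) @[t --> +oo] --> 0.

(** The product of the modes at times s and t is half the sum of the modes at times t - s and t + s.
    Both integrals are small once t - s is large, which is the almost orthogonality required. *)
Lemma mode_cauchy Y Phi (a : R) : measurable_fun setT Y -> bmf Phi -> mode_vanish Y ->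
  cauchy_oo (fun t => \int[mu]_x (cos (2 * pi * t * Y x + a) * Phi x)).
Proof.
move=> mY bPhi hY.
pose D : set T := [set x | Y x != 0].
have mD : measurable D by exact: measurable_neq0.
have bD : bmf (\1_D : T -> R) by exact: bmf_indic.
pose u t x : R := cos (2 * pi * t * Y x + a) * \1_D x.
have bu t : bmf (u t) by apply: bmfM => //; exact: bmf_cosZ.
have u1 t x : `|u t x| <= 1.
  by rewrite normrM mulr_ile1// ?norm_cos_le1// norm_indic_le1.
have uu s t x : u s x * u t x = 2^-1 * (cos (2 * pi * (t - s) * Y x + 0) * \1_D x)
     + 2^-1 * (cos (2 * pi * (t + s) * Y x + (a + a)) * \1_D x).
  have DD : \1_D x * \1_D x = \1_D x :> R.
    by rewrite indicE; case: (_ \in _); rewrite ?mulr1 ?mulr0.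
  rewrite /u mulrACA DD; set p := 2 * pi * t * Y x + a; set q := 2 * pi * s * Y x + a.
  have -> : 2 * pi * (t - s) * Y x + 0 = p - q by rewrite /p /q; ring.
  have -> : 2 * pi * (t + s) * Y x + (a + a) = p + q by rewrite /p /q; ring.
  by clearbody p q; rewrite cosB cosD; field.
have orth e : 0 < e -> exists T0, forall s t, T0 <= s -> T0 + s <= t ->
    `|\int[mu]_x (u s x * u t x)| <= e.
  move=> e0; have /cvg_oo0P/(_ e e0)[T0 hT0] := hY 0.
  have /cvg_oo0P/(_ e e0)[T1 hT1] := hY (a + a).
  exists (Num.max (Num.max T0 T1) 0) => s t; rewrite !ge_max => /andP[/andP[s0 s1] s2].
  rewrite -lerBrDr !ge_max => /andP[/andP[t0 t1] t2].
  under eq_Rintegral do rewrite uu.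
  have bc b c : bmf (fun x => cos (c * Y x + b) * \1_D x) by apply: bmfM => //; exact: bmf_cosZ.
  rewrite bmf_intD ?bmf_intZ//; [|exact: bmfZ|exact: bmfZ].
  have h1 := hT0 (t - s) t0.
  have h2 := hT1 (t + s) (ltac:(lra)).
  apply: le_trans (ler_normD _ _) _; rewrite !normrM ger0_norm ?invr_ge0//.
  by rewrite [leRHS]splitr [e / 2]mulrC lerD ?ler_wpM2l ?invr_ge0.
(* The share of the set Y = 0, where the cosine is constantly cos a. *)
pose C := \int[mu]_x (cos a * (1 - \1_D x) * Phi x).
have -> : (fun t => \int[mu]_x (cos (2 * pi * t * Y x + a) * Phi x)) =
    (fun t => \int[mu]_x (u t x * Phi x) + C).
  apply/funext => t; rewrite -bmf_intD//; last 2 first.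
  - exact: bmfM.
  - by apply: bmfM => //; apply: bmfZ; apply: bmfB => //; exact: bmf_cst.
  apply: eq_int => x; rewrite /u indicE; case: (boolP (x \in D)) => [_|xD].
    by rewrite subrr mulr0 mul0r addr0 mulr1.
  have -> : Y x = 0 by apply/eqP; apply: contraNT xD; rewrite inE.
  by rewrite !mulr0 !mul0r !add0r subr0 mulr1.
apply: cauchy_ooD; last exact: cauchy_oo_cst.
apply/cauchy_ooP; exists 0; apply/cvg_oo0P.
exact: (almost_orthogonal_null fin bu u1 bPhi orth).
Qed.

Lemma trig_poly_cauchy (r : nat) (w : T -> 'rV[R]_r) (P : 'rV[R]_r -> R) Phi :
  (forall xi : 'rV[int]_r, measurable_fun setT (fun x => dot_int xi (w x))) ->
  (forall xi : 'rV[int]_r, xi != 0 -> mode_vanish (fun x => dot_int xi (w x))) ->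
  bmf Phi -> trig_poly P ->
  (forall t, bmf (fun x => P (t *: w x))) /\
  cauchy_oo (fun t => \int[mu]_x (P (t *: w x) * Phi x)).
Proof.
(* For xi = 0 the indicator in [mode_vanish] is that of the empty set. *)
move=> mw hw bPhi; have hw' xi : mode_vanish (fun x => dot_int xi (w x)).
  have [->|/hw//] := eqVneq xi 0.
  move=> a; apply/cvg_oo0P => e e0; exists 0 => t _.
  rewrite (@eq_int _ _ _ mu _ (fun=> 0)); last first.
    by move=> x; rewrite indicE memNset ?mulr0//= dot_int0l eqxx.
  by rewrite Rintegral_cst//= mul0r normr0 ltW.
elim=> [c a xi|P1 P2 _ [b1 c1] _ [b2 c2]].
- have bb t : bmf (fun x => cos (2 * pi * t * dot_int xi (w x) + a)) by exact: bmf_cosZ.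
  split=> [t|]; first by under eq_fun do rewrite dot_intZ mulrA; exact: bmfZ.
  have h := mode_cauchy a (mw xi) bPhi (hw' xi).
  have -> : (fun t => \int[mu]_x (c * cos (2 * pi * dot_int xi (t *: w x) + a) * Phi x)) =
      (fun t => c * \int[mu]_x (cos (2 * pi * t * dot_int xi (w x) + a) * Phi x)).
    apply/funext => t; rewrite -bmf_intZ//; last exact: bmfM.
    by apply: eq_int => x; rewrite dot_intZ !mulrA.
  exact: cauchy_ooZ.
- split=> [t|]; first exact: bmfD.
  have -> : (fun t => \int[mu]_x ((P1 (t *: w x) + P2 (t *: w x)) * Phi x)) =
      (fun t => \int[mu]_x (P1 (t *: w x) * Phi x) + \int[mu]_x (P2 (t *: w x) * Phi x)).
    apply/funext => t; rewrite -bmf_intD//; [|exact: bmfM|exact: bmfM].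
    by apply: eq_int => x; rewrite mulrDl.
  exact: cauchy_ooD.
Qed.

(* Along times in arithmetic progression of step 1 / N the means of the cosine
   tend to 0 off [Y x \in N Z], a set which meets [Y x != 0] in a set of small
   measure for large N. *)
Lemma mode_limit0 Y (a l : R) : measurable_fun setT Y ->
  \int[mu]_x (cos (2 * pi * t * Y x + a) * \1_[set x | Y x != 0] x) @[t --> +oo] --> l ->
  l = 0.
Proof.
move=> mY hl; apply/eqP; rewrite -normr_le0; apply/ler_addgt0Pr => e e0; rewrite add0r.
pose D : set T := [set x | Y x != 0].
have mD : measurable D by exact: measurable_neq0.
have bD : bmf (\1_D : T -> R) by exact: bmf_indic.
have D1 := @norm_indic_le1 T R D.
have e4 : 0 < e / 4 by rewrite divr_gt0.
pose big (n : nat) : set T := [set x | n.+1%:R <= `|Y x|].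
have mbig n : measurable (big n).
  have -> : big n = (fun x => `|Y x|) @^-1` `[n.+1%:R, +oo[%classic.
    by apply/seteqP; split=> x /=; rewrite in_itv/= andbT.
  rewrite -[X in measurable X]setTI; apply: measurableT_comp => //.
(* The sets [big n] decrease to the empty set, since [Y] takes finite values. *)
have [N hN] : exists N, \int[mu]_x (\1_(big N) x) <= e / 4.
  have [|x|N0 hN0] := @bmf_dct _ _ _ mu (fun n => \1_(big n)) (fun=> 0) 1 fin
    (fun n => bmf_indic (mbig n)) (bmf_cst 0) _ _ _ e4.
  - by move=> n x; rewrite indicE; case: (_ \in _); rewrite ?normr1 ?normr0.
  - apply: (@cvg_trans _ ((fun=> 0 : R) @ \oo)); last exact: cvg_cst.
    apply: near_eq_cvg; exists (Num.truncn `|Y x|) => //= n hn.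
    rewrite indicE memNset//= /big /=; apply/negP; rewrite -ltNge.
    by rewrite (lt_le_trans (truncnS_gt _))// ler_nat.
  exists N0; apply: le_trans (hN0 _ (leqnn _)); apply: bmf_le_int => //.
  - exact: bmf_indic.
  - by apply: bmf_norm; apply: bmfB; [exact: bmf_cst|exact: bmf_indic].
  - by move=> x; rewrite sub0r normrN ler_norm.
(* With this step, s |Y| lies in ]0, 1[ at the points of [D] outside [big N], so no resonance occurs
   there. *)
pose s : R := N.+1%:R^-1.
have s0 : 0 < s by rewrite invr_gt0 ltr0n.
have /cvgrPdist_le/(_ _ e4)[T1 [_ hT1]] := hl.
pose tau k : R := T1 + 1 + s * k%:R.
pose mean (K : nat) x : R := K.+1%:R^-1 * \sum_(k < K.+1) cos (2 * pi * tau k * Y x + a).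
have bmean K : bmf (mean K) by apply: bmfZ; apply: bmf_sum => k; exact: bmf_cosZ.
have mean1 K x : `|mean K x| <= 1.
  rewrite /mean normrM ger0_norm ?invr_ge0// ler_pdivrMl ?ltr0n// mulr1.
  apply: le_trans (ler_norm_sum _ _ _) _.
  apply: (@le_trans _ _ (\sum_(k < K.+1) 1)); first by apply: ler_sum => k _; exact: norm_cos_le1.
  by rewrite sumr_const card_ord.
(* The points where s Y is not an integer; there the mean of K + 1 cosines is at most 1 / ((K + 1)
   |sin (pi s Y)|). *)
pose Z : set T := [set x | sin (pi * s * Y x) != 0].
have mZ : measurable Z.
  by apply: measurable_neq0; 
  under eq_fun do rewrite sin_shift; case: (bmf_cosZ (pi * s) (- (pi / 2)) mY).
have bZ : bmf (\1_Z : T -> R) by exact: bmf_indic.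
have [K1 hK1] : exists n0, forall n, (n0 <= n)%N ->
    \int[mu]_x `|0 - mean n x * \1_Z x| <= e / 4.
  apply: (bmf_dct (B := 1)) => //.
  - by move=> n; exact: bmfM.
  - exact: bmf_cst.
  - move=> n x; rewrite normrM mulr_ile1//.
    exact: norm_indic_le1.
  move=> x; case: (boolP (x \in Z)) => [xZ|xZ]; last first.
    rewrite (_ : (fun n => _) = cst 0); first exact: cvg_cst.
    by apply/funext => n; rewrite indicE (negbTE xZ) mulr0.
  rewrite (_ : (fun n => _) = (fun n => mean n x)); last first.
    by apply/funext => n; rewrite indicE xZ mulr1.
  have sn0 : sin (pi * s * Y x) != 0 by move: xZ; rewrite inE.
  have sp : 0 < `|sin (pi * s * Y x)| by rewrite normr_gt0.
  apply/cvgrPdist_le => e' e'0.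
  exists (Num.truncn (`|sin (pi * s * Y x)| * e')^-1) => // n /= hn.
  rewrite sub0r normrN /mean normrM ger0_norm ?invr_ge0//.
  have hb := norm_sin_sum_cos (pi * s * Y x) (2 * pi * (T1 + 1) * Y x + a) n.+1.
  rewrite (eq_bigr (fun k : 'I_n.+1 => cos (2 * k%:R * (pi * s * Y x) + (2 * pi * (T1 + 1) * Y x + a)))); last first.
    by move=> k _; congr cos; rewrite /tau; ring.
  rewrite normrM -ler_pdivlMl// mulr1 in hb.
  rewrite ler_pdivrMl ?ltr0n// (le_trans hb)//.
  rewrite -(@ler_pM2l _ `|sin (pi * s * Y x)|)// mulfV ?gt_eqF//.
  have : (`|sin (pi * s * Y x)| * e')^-1 <= n.+1%:R.
    by rewrite ltW// (lt_le_trans (truncnS_gt _))// ler_nat ltnS.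
  have Se : 0 < `|sin (pi * s * Y x)| * e' by rewrite mulr_gt0.
  by rewrite -[X in X <= _ -> _]div1r ler_pdivrMr// mulrCA.
have mean_int : \int[mu]_x (mean K1 x * \1_D x) = K1.+1%:R^-1 * \sum_(k < K1.+1)
    \int[mu]_x (cos (2 * pi * tau k * Y x + a) * \1_D x).
  have bk (k : 'I_K1.+1) : bmf (fun x => cos (2 * pi * tau k * Y x + a) * \1_D x).
    by apply: bmfM => //; exact: bmf_cosZ.
  rewrite -bmf_int_sum// -bmf_intZ//; last exact: bmf_sum.
  by apply: eq_int => x; rewrite /mean -mulrA mulr_suml.
have h1 : `|l - \int[mu]_x (mean K1 x * \1_D x)| <= e / 4.
  have -> : l = K1.+1%:R^-1 * \sum_(k < K1.+1) l.
    by rewrite sumr_const card_ord -[l *+ _]mulr_natl mulKf// pnatr_eq0.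
  rewrite mean_int -mulrBr -sumrB normrM ger0_norm ?invr_ge0// ler_pdivrMl ?ltr0n//.
  apply: le_trans (ler_norm_sum _ _ _) _.
  apply: (@le_trans _ _ (\sum_(k < K1.+1) (e / 4))).
    apply: ler_sum => k _; apply: hT1; rewrite /tau -addrA ltrDl.
    by rewrite ltr_wpDr// mulr_ge0// ltW.
  by rewrite sumr_const card_ord mulr_natl.
have h2 : `|\int[mu]_x (mean K1 x * \1_D x)| <= e / 4 + e / 4.
  apply: le_trans (bmf_norm_int fin _) _; first exact: bmfM.
  apply: le_trans (lerD (hK1 _ (leqnn _)) hN).
  rewrite -bmf_intD//; last 2 first.
  - by apply: bmf_norm; apply: bmfB; [exact: bmf_cst|exact: bmfM].
  - exact: bmf_indic.
  apply: bmf_le_int => //.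
  - by apply: bmf_norm; exact: bmfM.
  - apply: bmfD; last exact: bmf_indic.
    by apply: bmf_norm; apply: bmfB; [exact: bmf_cst|exact: bmfM].
  move=> x; rewrite sub0r normrN.
  case: (boolP (x \in Z)) => [xZ|xZ].
    rewrite (_ : `|mean K1 x * (\1_Z x)| = `|mean K1 x|); last by rewrite indicE xZ mulr1.
    apply: (@le_trans _ _ `|mean K1 x|); last by rewrite lerDl indicE.
    by rewrite normrM ler_piMr.
  rewrite (_ : `|mean K1 x * (\1_Z x)| = 0) ?add0r; last first.
    by rewrite indicE (negbTE xZ) mulr0 normr0.
  have [Y0|Y0] := eqVneq (Y x) 0.
    by rewrite (_ : \1_D x = 0) ?mulr0 ?normr0 ?indicE// memNset//= /D /= Y0 eqxx.
  rewrite (_ : \1_(big N) x = 1); first by rewrite normrM mulr_ile1.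
  (* Here sin (pi s Y) = 0 and Y != 0; were |Y| < N + 1, then pi s |Y| would lie in ]0, pi[. *)
  rewrite indicE mem_set//= /big /= leNgt; apply/negP => YN.
  have : 0 < sin (pi * s * `|Y x|).
    apply: sin_gt0_pi; rewrite !mulr_gt0 ?pi_gt0 ?normr_gt0//=.
    by rewrite -mulrA gtr_pMr ?pi_gt0// mulrC ltr_pdivrMr ?mul1r// ltr0n.
  have : sin (pi * s * Y x) = 0 by apply/eqP; apply: contraNT xZ; rewrite inE.
  case: (lerP 0 (Y x)) => [?|?]; first by rewrite ger0_norm// => ->; rewrite ltxx.
  by rewrite ltr0_norm// mulrN sinN => ->; rewrite oppr0 ltxx.
move: h1 h2; rewrite !ler_norml; lra.
Qed.

End modes.

(** * Skew products *)

Section skew_product.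
Context {R : realType} {d : measure_display} {X : measurableType d}.
Context {G : topGroupType} {r : nat}.
Variables (m : {measure set X -> \bar R}) (haar : probability (borel G) R).
Variables (q : 'rV[R]_r -> G) (w : X -> 'rV[R]_r).
Hypothesis m_fin : (m setT < +oo)%E.
Hypothesis haar_inv : haar_probability haar.
Hypothesis mul_meas :
  measurable_fun setT (fun p : borel G * borel G => (p.1 * p.2)%g : borel G).
Hypothesis qw_meas : forall t, measurable_fun setT (fun x => q (t *: w x) : borel G).
Hypothesis w_meas : forall xi : 'rV[int]_r, measurable_fun setT (fun x => dot_int xi (w x)).

Local Notation lam := (m \x haar)%E.

Definition skew_flow (t : R) (p : X * borel G) : X * borel G :=
  (p.1, (q (t *: w p.1) * p.2)%g).

Lemma skew_measurable t : measurable_fun setT (skew_flow t).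
Proof.
apply: measurable_fun_pair; first exact: measurable_fst.
have m2 : measurable_fun setT (fun p : X * borel G => ((q (t *: w p.1) : borel G), p.2)).
  apply: measurable_fun_pair; last exact: measurable_snd.
  exact: (measurableT_comp (qw_meas t) measurable_fst).
exact: (measurableT_comp mul_meas m2).
Qed.

Lemma lam_fin : (lam setT < +oo)%E.
Proof.
by rewrite -setXTT product_measure1E// [X in (_ * X)%E]probability_setT mule1.
Qed.

(** On the fibre over x the flow is a left translation, which preserves Haar measure; Fubini does
    the rest. *)
Lemma skew_preserves t A : measurable A -> lam (skew_flow t @^-1` A) = lam A.
Proof.
move=> mA; rewrite /product_measure1; apply: eq_integral => x _ /=.
rewrite -(haar_inv (q (t *: w x)) (measurable_xsection x mA)); congr (haar _).
Qed.

Lemma int_skew_flow t F : bmf F -> \int[lam]_p F (skew_flow t p) = \int[lam]_p F p.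
Proof.
move=> bF; rewrite -[RHS]mul1r; apply: integral_map => //.
- exact: skew_measurable.
- exact: lam_fin.
- by move=> A mA; rewrite mul1e; exact: skew_preserves.
Qed.

Lemma bmf_skew t (F : X * borel G -> R) : bmf F -> bmf (F \o skew_flow t).
Proof. by apply: bmf_map; exact: skew_measurable. Qed.

Lemma int_fst_indic (V : set (borel G)) F : measurable V -> bmf F ->
  \int[lam]_p (F p.1 * \1_V p.2) = fine (haar V) * \int[m]_x F x.
Proof.
move=> mV bF; have mTV : measurable (setT `*` V : set (X * borel G)) by exact: measurableX.
have haarV : haar V = (fine (haar V))%:E.
  by rewrite fineK// ge0_fin_numE// (le_lt_trans (probability_le1 haar mV))// ltry.
have h0 : 0 <= fine (haar V) by exact: fine_ge0.
rewrite -(@integral_map _ _ _ _ R (mrestr lam mTV) m fst (fine (haar V)) F h0 measurable_fst m_fin _ bF).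
  rewrite integral_mrestr//; last exact: (bmf_map measurable_fst bF).
    by apply: eq_int => -[x z]; rewrite !indicE; congr (_ * (_ : bool)%:R);
      apply/idP/idP; rewrite !inE/=; tauto.
  exact: lam_fin.
move=> A mA; rewrite -haarV /= /mrestr.
rewrite (_ : _ `&` _ = A `*` V); last by apply/seteqP; split=> -[x z] /=; tauto.
by rewrite product_measure1E// muleC.
Qed.

(** Testing against every bounded [Phi] lets factors that do not move with t be pushed into the test
    function. *)
Definition converging (F : X * borel G -> R) : Prop :=
  forall Phi, bmf Phi -> cauchy_oo (fun t => \int[lam]_p (F (skew_flow t p) * Phi p)).

(** The flow preserves [lam], so an L1 error on [F] is the same at all times. *)
Lemma converging_approx F : bmf F ->
  (forall e, 0 < e -> exists H, [/\ bmf H, converging H & \int[lam]_p `|F p - H p| <= e]) ->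
  converging F.
Proof.
move=> bF h Phi bPhi; apply: cauchy_oo_approx => e e0.
have [B B0 hB] := bmf_bound bPhi.
have eB : 0 < e / (B + 1) by rewrite divr_gt0// ltr_wpDl.
have [H [bH cH FH]] := h _ eB.
exists (fun t => \int[lam]_p (H (skew_flow t p) * Phi p)); first exact: cH.
move=> t; have fin := lam_fin.
have bFt := bmf_skew t bF; have bHt := bmf_skew t bH.
rewrite -bmf_intB//; [|exact: bmfM|exact: bmfM].
apply: le_trans (bmf_norm_int fin _) _; first by apply: bmfB; exact: bmfM.
have bD : bmf (fun p => `|F p - H p|) by apply: bmf_norm; exact: bmfB.
apply: (@le_trans _ _ (\int[lam]_p (B * `|F (skew_flow t p) - H (skew_flow t p)|))).
  apply: bmf_le_int => //.
  - by apply: bmf_norm; apply: bmfB; exact: bmfM.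
  - by apply: bmfZ; apply: (bmf_skew t bD).
  - by move=> p; rewrite -mulrBl normrM mulrC ler_wpM2r.
rewrite bmf_intZ//; last exact: (bmf_skew t bD).
rewrite (int_skew_flow t bD); apply: le_trans (ler_wpM2l B0 FH) _.
by rewrite mulrA ler_pdivrMr ?ltr_wpDl// mulrC ler_wpM2l ?(ltW e0)// lerDl.
Qed.

Lemma convergingD F H : bmf F -> bmf H -> converging F -> converging H ->
  converging (fun p => F p + H p).
Proof.
move=> bF bH cF cH Phi bPhi; have fin := lam_fin.
have -> : (fun t => \int[lam]_p ((F (skew_flow t p) + H (skew_flow t p)) * Phi p)) =
    (fun t => \int[lam]_p (F (skew_flow t p) * Phi p) + \int[lam]_p (H (skew_flow t p) * Phi p)).
  apply/funext => t; have bFt := bmf_skew t bF; have bHt := bmf_skew t bH.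
  rewrite -bmf_intD//; [|exact: bmfM|exact: bmfM].
  by apply: eq_int => p; rewrite mulrDl.
by apply: cauchy_ooD; [exact: cF|exact: cH].
Qed.

Lemma convergingZ c F : bmf F -> converging F -> converging (fun p => c * F p).
Proof.
move=> bF cF Phi bPhi; have fin := lam_fin.
have -> : (fun t => \int[lam]_p (c * F (skew_flow t p) * Phi p)) =
    (fun t => c * \int[lam]_p (F (skew_flow t p) * Phi p)).
  apply/funext => t; have bFt := bmf_skew t bF.
  rewrite -bmf_intZ//; last exact: bmfM.
  by apply: eq_int => p; rewrite mulrA.
by apply: cauchy_ooZ; exact: cF.
Qed.

Lemma converging_cst c : converging (fun=> c).
Proof. by move=> Phi _; exact: cauchy_oo_cst. Qed.

Hypothesis G_compact : compact [set: G].
Hypothesis G_hausdorff : hausdorff_space G.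
Hypothesis G_base : countable_base_on [set: G].
Hypothesis mul_cont : continuous (fun p : G * G => (p.1 * p.2)%g).
Hypothesis q_cont : continuous q.
Hypothesis qD : forall u v, q (u + v) = (q u * q v)%g.
Hypothesis q_period : forall z : 'rV[int]_r, q (map_mx intr z) = 1%g.

Lemma q0 : q 0 = 1%g.
Proof. by rewrite -(q_period 0); congr q; apply/matrixP => i j; rewrite !mxE. Qed.

Lemma continuous_mull (a : G) : continuous (fun z : G => (a * z)%g).
Proof.
move=> z; apply: (@continuous_comp _ _ _ (fun z : G => (a, z)) (fun p : G * G => (p.1 * p.2)%g)).
  by apply: cvg_pair => //=; exact: cvg_cst.
exact: mul_cont.
Qed.

Lemma bmf_snd_continuous (k : G -> R) (B : R) : continuous k -> (forall z, `|k z| <= B) ->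
  bmf (fun p : X * borel G => k p.2).
Proof.
move=> ck hB; split; last by exists B => p; exact: hB.
apply: (@measurableT_comp _ _ _ _ _ _ (k : borel G -> R)); last exact: measurable_snd.
exact: continuous_borel_real.
Qed.

Lemma bmf_fst_indic (A : set X) : measurable A -> bmf (fun p : X * borel G => \1_A p.1 : R).
Proof.
by move=> mA; apply: (bmf_map (phi := fst) measurable_fst (bmf_indic mA)).
Qed.

(** Writing q (u + eta) z = q (eta) (q (u) z) brings every u back to 0, where compactness of [G]
    gives a scale valid for all second factors. *)
Lemma translate_mod_cont (k : G -> R) (e : R) : continuous k -> 0 < e ->
  exists2 d0, 0 < d0 & forall z, mod_cont (fun u => k (q u * z)%g) d0 e.
Proof.
move=> ck e0.
have cF : continuous (fun p : 'rV[R]_r * G => k (q p.1 * p.2)%g).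
  move=> p; apply: (@continuous_comp _ _ _ (fun p : 'rV[R]_r * G => (q p.1 * p.2)%g) k); last exact: ck.
  apply: (@continuous_comp _ _ _ (fun p : 'rV[R]_r * G => (q p.1, p.2)) (fun p : G * G => (p.1 * p.2)%g)); last exact: mul_cont.
  apply: cvg_pair => /=; last exact: cvg_snd.
  by apply: cvg_comp; [exact: cvg_fst|exact: q_cont].
have /nbhs_ballP[d0 /= d00 hd] := @compact_uniform_near R 'rV[R]_r G _ 0 e G_compact cF e0.
exists d0 => // z u eta heta.
have := hd eta _ (q u * z)%g => /=; rewrite q0 mul1g mulgA -qD [eta + u]addrC; apply.
split=> // i j; rewrite mxE /ball /= sub0r normrN ord1; exact: heta.
Qed.

(** The nodes c_i and kernels P_i being common to all z, the dependence on z is confined to the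
    coefficients k (q (c_i) z), which join [Phi] as part of the test function. *)
Lemma converging_rectangle (A : set X) (k : G -> R) (B : R) :
  (forall xi : 'rV[int]_r, xi != 0 -> mode_vanish m (fun x => dot_int xi (w x))) ->
  measurable A -> continuous k -> (forall z, `|k z| <= B) ->
  converging (fun p => \1_A p.1 * k p.2).
Proof.
move=> hw mA ck hB Phi bPhi; apply: cauchy_oo_approx => e e0; have fin := lam_fin.
have [C C0 hC] := bmf_bound bPhi.
have B0 : 0 <= B by rewrite (le_trans _ (hB 1%g)).
(* The uniform error of the approximation gets multiplied by the bound of [Phi] and the total
   mass. *)
pose D := C * fine (lam setT).
have D0 : 0 <= D by rewrite mulr_ge0// fine_ge0.
have eD : 0 < e / (D + 1) by rewrite divr_gt0// ltr_wpDl.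
have eD2 : 0 < e / (D + 1) / 2 by rewrite divr_gt0.
have [d0 d00 hd] := translate_mod_cont ck eD2.
have [I [c [P [hP happ]]]] := trig_approx (r := r) B0 d00 eD.
have bk (a : G) : bmf (fun p : X * borel G => k (a * p.2)%g).
  apply: (bmf_snd_continuous (k := fun z => k (a * z)%g) (B := B)) => // z.
  by apply: continuous_comp; [exact: continuous_mull|exact: ck].
have bA := bmf_fst_indic mA.
have bAk i : bmf (fun p : X * borel G => \1_A p.1 * k (q (c i) * p.2)%g * Phi p).
  by do 2 apply: bmfM => //.
have wfst xi : measurable_fun setT (fun p : X * borel G => dot_int xi (w p.1)).
  exact: (measurableT_comp (w_meas xi) measurable_fst).
have hwl xi : xi != 0 -> mode_vanish lam (fun p : X * borel G => dot_int xi (w p.1)).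
  move=> xi0 a; apply: cvg_trans (hw xi xi0 a); apply: near_eq_cvg; apply: nearW => t.
  have bc : bmf (fun x => cos (2 * pi * t * dot_int xi (w x) + a) *
      \1_[set x | dot_int xi (w x) != 0] x).
    apply: bmfM; last by apply: bmf_indic; exact: measurable_neq0.
    exact: bmf_cosZ.
  have := int_fst_indic (measurableT : measurable [set: borel G]) bc.
  rewrite probability_setT/= mul1r => <-.
  by apply: eq_int => p; rewrite [in LHS]indicT mulr1 !indicE.
have hPc i := trig_poly_cauchy fin wfst hwl (bAk i) (hP i).
exists (fun t => \sum_i \int[lam]_p (P i (t *: w p.1) *
    (\1_A p.1 * k (q (c i) * p.2)%g * Phi p))).
  by apply: cauchy_oo_sum => i; have [] := hPc i.
move=> t; rewrite -bmf_int_sum//; last by move=> i; apply: bmfM => //; have [] := hPc i.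
have bAkt : bmf (fun p : X * borel G => \1_A p.1 * k (q (t *: w p.1) * p.2)%g).
  apply: (bmf_skew t (F := fun p => \1_A p.1 * k p.2)).
  by apply: bmfM => //; exact: (bmf_snd_continuous ck hB).
have bS : bmf (fun p : X * borel G => \sum_i P i (t *: w p.1) *
    (\1_A p.1 * k (q (c i) * p.2)%g * Phi p)).
  by apply: bmf_sum => i; apply: bmfM => //; have [] := hPc i.
rewrite -bmf_intB//; last exact: bmfM.
have bdiff : bmf (fun p : X * borel G =>
    \1_A p.1 * k (q (t *: w p.1) * p.2)%g * Phi p - \sum_i P i (t *: w p.1) *
    (\1_A p.1 * k (q (c i) * p.2)%g * Phi p)).
  by apply: bmfB => //; exact: bmfM.
apply: le_trans (bmf_int_le (B := e / (D + 1) * C) fin bdiff _) _; last first.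
  rewrite -mulrA -/D mulrAC ler_pdivrMr ?ltr_wpDl//.
  by rewrite ler_wpM2l ?(ltW e0)// lerDl.
move=> p.
have per u (z : 'rV[int]_r) : k (q (u + map_mx intr z) * p.2)%g = k (q u * p.2)%g.
  by rewrite qD q_period mulg1.
have := happ (fun u => k (q u * p.2)%g) (fun u => hB _) per (hd p.2) (t *: w p.1).
rewrite [X in `|X - \sum_i P i _ * _|]mulrAC.
rewrite [X in _ -> `|_ - X| <= _](eq_bigr (fun i => \1_A p.1 * Phi p * (k (q (c i) * p.2)%g * P i (t *: w p.1)))); last first.
  by move=> i _; ring.
rewrite -mulr_sumr -mulrBr normrM => h.
rewrite mulrC ler_pM// normrM; apply: le_trans (hC p).
by rewrite ler_piMl// norm_indic_le1.
Qed.


(** Sets k > 0 with k continuous: stable under intersection by taking products of functions, and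
    their indicators are limits of continuous functions. *)
Let prodG : set (set (X * borel G)) := [set A `*` [set z | 0 < k z] |
  A in [set A : set X | measurable A] &
  k in [set k : G -> R | continuous k /\ forall z, 0 <= k z <= 1]].

Lemma measurable_cozero (k : G -> R) : continuous k ->
  measurable ([set z | 0 < k z] : set (borel G)).
Proof.
move=> ck; apply: borel_open.
by apply: (@open_comp _ _ k [set y | 0 < y]) => // y _; exact: ck.
Qed.

Lemma prodG_generates : @measurable _ (X * borel G)%type = <<s prodG >>.
Proof.
apply/seteqP; split.
  rewrite measurable_prod_measurableType.
  apply: smallest_sub; first exact: smallest_sigma_algebra.
  have sG : sigma_algebra setT (<<s prodG >> : set (set (X * borel G))).
    exact: smallest_sigma_algebra.
  (* For fixed A, the V such that A x V is generated by [prodG] form a sigma-algebra; open V then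
     suffice. *)
  move=> _ [A mA [V mV <-]]; apply: (mV [set V | <<s prodG >> (A `*` V)]); split.
    split=> /= [|V' V'G|F FG].
    - by rewrite setX0; case: sG.
    - rewrite (_ : _ `*` _ = setT `\` \bigcup_n bigcup2 (~` A `*` setT) (A `*` V') n).
        apply: sigma_algebraCD; apply: sigma_algebra_bigcup => -[|[|n]] //=; last first.
          by case: sG.
        apply: sub_gen_smallest; exists (~` A); first exact: measurableC.
        exists (fun=> 1); last by congr (_ `*` _); apply/seteqP; split=> z //= _; rewrite ltr01.
        by split=> [z|z]; [exact: cvg_cst|rewrite ler01 lexx].
      by rewrite bigcup2E; apply/seteqP; split=> -[x z] /=; have [Ax|nAx] := pselect (A x); tauto.
    - by rewrite setX_bigcupr; exact: sigma_algebra_bigcup.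
  move=> /= {}V {mV} oV.
  have [k [ck k01 ->]] := open_cozero (R := R) G_hausdorff G_compact G_base oV.
  rewrite (_ : _ `*` _ = \bigcup_n (A `*` [set z | 0 < k n z])); last first.
    apply/seteqP; split=> -[x z] /= [].
      by move=> Ax [n _ kn]; exists n.
    by move=> n _ [/= Ax kn]; split=> //; exists n.
  apply: sigma_algebra_bigcup => n; apply: sub_gen_smallest.
  by exists A => //; exists (k n).
apply: smallest_sub; first exact: sigma_algebra_measurable.
move=> _ [A mA [k [ck _] <-]]; apply: measurableX => //; exact: measurable_cozero.
Qed.

Lemma converging_indic (S : set (X * borel G)) :
  (forall xi : 'rV[int]_r, xi != 0 -> mode_vanish m (fun x => dot_int xi (w x))) ->
  measurable S -> converging (\1_S).
Proof.
move=> hw mS; have fin := lam_fin.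
apply: (@dynkin_induction _ _ prodG (fun S => converging (\1_S))).
- exact: prodG_generates.
- move=> _ _ [A mA [k [ck k01] <-]] [B mB [l [cl l01] <-]].
  exists (A `&` B); first exact: measurableI.
  exists (fun z => k z * l z).
    split; first by move=> z; apply: cvgM; [exact: ck|exact: cl].
    by move=> z; have /andP[? ?] := k01 z; have /andP[? ?] := l01 z;
      rewrite mulr_ge0//= mulr_ile1.
  rewrite -setXI; congr (_ `*` _); apply/seteqP; split=> z /=.
    have /andP[k0 _] := k01 z; have /andP[l0 _] := l01 z.
    by rewrite lt_def mulf_eq0 negb_or => /andP[/andP[? ?] _]; rewrite !lt_def; split; apply/andP.
  by move=> [? ?]; rewrite mulr_gt0.
- rewrite (_ : \1_setT = fun=> 1); first exact: converging_cst.
  by apply/funext => p; rewrite indicT.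
- move=> _ [A mA [k [ck k01] <-]].
  have mcz := measurable_cozero ck.
  have bi : bmf (\1_(A `*` [set z | 0 < k z]) : X * borel G -> R).
    by apply: bmf_indic; exact: measurableX.
  apply: converging_approx => // e e0.
  (* Continuous, with values in [0, 1], and converging pointwise to the indicator of k > 0. *)
  pose kn n z := 1 - (1 - k z) ^+ n.
  have ckn n : continuous (kn n).
    move=> z; apply: cvgB; first exact: cvg_cst.
    apply: (@continuous_comp _ _ _ (fun z => 1 - k z) (fun y => y ^+ n)); last exact: exprn_continuous.
    by apply: cvgB; [exact: cvg_cst|exact: ck].
  have kn1 n z : `|kn n z| <= 1.
    have /andP[k0 k1] := k01 z.
    have h0 : 0 <= 1 - k z by rewrite subr_ge0.
    have h1 : (1 - k z) ^+ n <= 1 by rewrite exprn_ile1// gerBl.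
    by rewrite /kn ger0_norm ?subr_ge0// gerBl exprn_ge0.
  have bF n : bmf (fun p : X * borel G => \1_A p.1 * kn n p.2).
    by apply: bmfM; [exact: bmf_fst_indic|exact: bmf_snd_continuous (ckn n) (kn1 n)].
  have [|p|n0 hn0] := bmf_dct (B := 1) fin bF bi _ _ e0.
  + move=> n p; rewrite normrM mulr_ile1//.
    exact: norm_indic_le1.
  + rewrite [X in _ --> X](_ : _ = \1_A p.1 * (1 - (~~ (0 < k p.2))%:R)); last first.
      rewrite !indicE; have [pA|pA] := boolP (p.1 \in A); last first.
        by rewrite mul0r memNset// => -[/= /mem_set]; rewrite (negbTE pA).
      rewrite mul1r; case: ltP => kp /=.
        by rewrite subr0 mem_set//; split=> //=; exact: set_mem.
      by rewrite subrr memNset// => -[/= _]; rewrite ltNge kp.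
    apply: cvgM; first exact: cvg_cst.
    apply: cvgB; first exact: cvg_cst.
    have /andP[k0 k1] := k01 p.2; case: ltP => /= kp.
      by apply: cvg_expr; rewrite ger0_norm ?subr_ge0// gtrBl.
    have -> : k p.2 = 0 by apply/eqP; rewrite eq_le kp k0.
    by under eq_cvg do rewrite subr0 expr1n; exact: cvg_cst.
  exists (fun p => \1_A p.1 * kn n0 p.2); split=> //.
    exact: converging_rectangle (ckn n0) (kn1 n0).
  exact: hn0.
- move=> U mU cU.
  rewrite (_ : \1_(~` U) = fun p => 1 + (-1) * \1_U p); last first.
    apply/funext => p; rewrite indicC mulN1r.
    by rewrite indicE /=; case: (_ \in _); rewrite ?subrr ?subr0.
  have bU : bmf (\1_U : _ -> R) by exact: bmf_indic.
  apply: convergingD; [exact: bmf_cst|exact: bmfZ|exact: converging_cst|exact: convergingZ].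
- move=> F mF tF cF.
  have bF n : bmf (\1_(\bigcup_(k < n) F k) : _ -> R).
    by apply: bmf_indic; exact: bigcup_measurable.
  apply: converging_approx; first by apply: bmf_indic; exact: bigcupT_measurable.
  move=> e e0; have [n hn] := bmf_bigcup_approx fin mF e0.
  exists (\1_(\bigcup_(k < n) F k)); split=> //; last exact: hn.
  elim: n {hn} => [|n IH].
    rewrite (_ : \1__ = fun=> 0); first exact: converging_cst.
    by apply/funext => p; rewrite indicE memNset// => -[].
  rewrite (_ : \1__ = fun p => \1_(\bigcup_(k < n) F k) p + \1_(F n) p); last first.
    by apply/funext => p; rewrite indic_bigcup_recr.
  by apply: convergingD => //; exact: bmf_indic.
- by rewrite -prodG_generates.
Qed.

(** Otherwise the translates of [V] would cover [G] by basic open sets of measure 0, and there are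
    countably many of those. *)
Lemma haar_open_gt0 (V : set G) : open V -> V 1%g -> (0 < haar V)%E.
Proof.
move=> oV V1; have [B [oB hB]] := G_base.
rewrite lt0e measure_ge0 andbT; apply/eqP => hV0.
have mB n : measurable (B n : set (borel G)) by exact: borel_open.
pose W n := if haar (B n) == 0%E then B n else set0.
have W0 n : haar.-negligible (W n).
  rewrite /W; case: ifPn => [/eqP h|_]; last exact: negligible_set0.
  by apply/negligibleP.
have := negligible_bigcup W0.
rewrite (_ : \bigcup_n W n = setT); last first.
  apply/seteqP; split=> // x _.
  pose U : set G := (fun z => x^-1 * z)%g @^-1` V.
  have oU : open U by apply: open_comp => // z _; exact: continuous_mull.
  have Ux : U x by rewrite /U /= mulVg.
  have [n [Bx BU]] := hB U x oU Ux Logic.I.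
  exists n => //; rewrite /W ifT//.
  rewrite eq_le measure_ge0 andbT -hV0 -(haar_inv x^-1%g (borel_open oV)).
  by apply: le_measure => //; rewrite inE//; exact: borel_open.
move/negligibleP => /(_ measurableT) h.
by have /eqP := etrans (esym (probability_setT haar)) h; rewrite onee_eq0.
Qed.

(** For z close to the neutral element, k (q (t w) z) is within [dl] of k (q (t w)), which is the
    cosine sought, uniformly in t by compactness. Dividing by the mass of the neighbourhood [V]
    recovers the integral over X. *)
Lemma converging_mode (xi : 'rV[int]_r) (a : R) (k : G -> R) :
  continuous k -> (forall z, `|k z| <= 1) ->
  (forall u, k (q u) = cos (2 * pi * dot_int xi u + a)) ->
  (forall F, bmf F -> converging F) ->
  \int[m]_x (cos (2 * pi * t * dot_int xi (w x) + a) *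
    \1_[set x | dot_int xi (w x) != 0] x) @[t --> +oo] --> 0.
Proof.
move=> ck k1 kq hconv; have fin := lam_fin.
pose Y x := dot_int xi (w x); pose A : set X := [set x | Y x != 0].
have mA : measurable A by apply: measurable_neq0; exact: w_meas.
have bA : bmf (\1_A : X -> R) by exact: bmf_indic.
suff /cauchy_ooP[l hl] : cauchy_oo (fun t => \int[m]_x (cos (2 * pi * t * Y x + a) * \1_A x)).
  by have l0 := mode_limit0 m_fin (w_meas xi) hl; rewrite -[X in _ --> X]l0.
apply: cauchy_oo_approx => e e0.
have M0 : 0 <= fine (m setT) by exact: fine_ge0.
pose dl := e / (fine (m setT) + 1).
have dl0 : 0 < dl by rewrite divr_gt0// ltr_wpDl.
have cF : continuous (fun p : G * G => k (p.2 * p.1)%g).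
  move=> p; apply: (@continuous_comp _ _ _ (fun p : G * G => (p.2 * p.1)%g) k); last exact: ck.
  apply: (@continuous_comp _ _ _ (fun p : G * G => (p.2, p.1)) (fun p : G * G => (p.1 * p.2)%g)); last exact: mul_cont.
  by apply: cvg_pair => /=; [exact: cvg_snd|exact: cvg_fst].
have : nbhs (1%g : G) [set x | forall y, `|k (y * x)%g - k (y * 1)%g| <= dl].
  exact: (@compact_uniform_near R G G _ 1%g dl G_compact cF dl0).
rewrite nbhsE => -[V [oV V1] hV].
have mV : measurable (V : set (borel G)) by exact: borel_open.
pose c := fine (haar V).
have c0 : 0 < c by rewrite fine_gt0// haar_open_gt0//= (le_lt_trans (probability_le1 haar mV))// ltry.
pose Phi (p : X * borel G) : R := \1_A p.1 * \1_V p.2.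
have b1V : bmf (fun p : X * borel G => \1_V p.2 : R).
  exact: (bmf_map (phi := snd) measurable_snd (bmf_indic mV)).
have bPhi : bmf Phi by apply: bmfM => //; exact: bmf_fst_indic.
have bk : bmf (fun p : X * borel G => k p.2) by exact: bmf_snd_continuous ck k1.
exists (fun t => c^-1 * \int[lam]_p (k (skew_flow t p).2 * Phi p)).
  by apply: cauchy_ooZ; exact: (hconv _ bk _ bPhi).
move=> t.
have bc : bmf (fun x => cos (2 * pi * t * Y x + a)) by exact: (bmf_cosZ _ _ (w_meas xi)).
have bcA : bmf (fun x => cos (2 * pi * t * Y x + a) * \1_A x) by exact: bmfM.
have bkt := bmf_skew t bk.
have b1 : bmf (fun p : X * borel G => (cos (2 * pi * t * Y p.1 + a) * \1_A p.1) * \1_V p.2).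
  by apply: bmfM => //; exact: (bmf_map (phi := fst) measurable_fst bcA).
have -> : \int[m]_x (cos (2 * pi * t * Y x + a) * \1_A x) =
    c^-1 * \int[lam]_p ((cos (2 * pi * t * Y p.1 + a) * \1_A p.1) * \1_V p.2).
  by rewrite (int_fst_indic mV bcA) mulKf// gt_eqF.
have b2 : bmf (fun p => k (skew_flow t p).2 * Phi p) by exact: bmfM.
rewrite -mulrBr -bmf_intB// normrM gtr0_norm ?invr_gt0// ler_pdivrMl//.
apply: le_trans (bmf_norm_int fin _) _; first exact: bmfB.
apply: (@le_trans _ _ (\int[lam]_p ((fun=> dl) p.1 * \1_V p.2))).
  apply: bmf_le_int => //; [by apply: bmf_norm; exact: bmfB|exact: bmfZ|].
  move=> p; rewrite /Phi mulrA -mulrBl -mulrBl.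
  rewrite [\1_V _]indicE; case: (boolP (p.2 \in V)) => [/set_mem/hV/= hp|_]; last first.
    by rewrite !mulr0 normr0.
  have := hp (q (t *: w p.1)); rewrite mulg1 kq dot_intZ !mulr1 distrC normrM.
  rewrite [2 * pi * (_ * _)]mulrA => h; apply: le_trans h; rewrite ler_piMr//.
  exact: norm_indic_le1.
rewrite (int_fst_indic mV (bmf_cst dl)).
rewrite Rintegral_cst// ler_wpM2l ?(ltW c0)// /dl mulrAC ler_pdivrMr ?ltr_wpDl//.
by rewrite ler_wpM2l ?(ltW e0)// lerDl.
Qed.

End skew_product.

(** * Transfer from a chart *)

(** Equips the bare set function [pushforward] with its measure structure. *)
Lemma pushforward_measureP {d1 d2 : measure_display} {T1 : measurableType d1}
    {T2 : measurableType d2} {R : realType} (mu : {measure set T1 -> \bar R})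
    (phi : T1 -> T2) : measurable_fun setT phi ->
  exists m : {measure set T2 -> \bar R}, m = pushforward mu phi :> (set T2 -> \bar R).
Proof.
move=> mphi.
by exists (measure_function_pushforward__canonical__measure_function_Measure mu mphi).
Qed.

Lemma sinZ_cvg {R : realType} (y : R) : n.+1%:R * sin (n.+1%:R^-1 * y) @[n --> \oo] --> y.
Proof.
have df : is_derive (0 : R) 1 (fun s : R => sin (s * y)) y.
  have -> : (fun s : R => sin (s * y)) = sin \o (fun s => y * s).
    by apply/funext => s; rewrite /= mulrC.
  apply: is_derive_eq.
  by rewrite mulr0 cos0 mul1r /GRing.scale /= mulr1.
have hd : h^-1 *: (sin ((h *: (1 : R) + 0) * y) - sin (0 * y)) @[h --> (0 : R)^'] --> y.
  by have [e1 e2] := df; rewrite -[X in _ --> X]e2; exact: e1.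
have hseq : (fun n => n.+1%:R^-1 : R) @ \oo --> (0 : R)^'.
  move=> A hA; have [N _ hN] := @cvg_harmonic R _ hA.
  by exists N => // n /= Nn; apply: (hN n Nn); rewrite /= /harmonic invr_eq0 pnatr_eq0.
have := @cvg_comp _ _ _ _ _ _ _ _ hseq hd; apply: cvg_trans; apply: near_eq_cvg; near=> n.
by rewrite /= invrK mul0r sin0 subr0 addr0 /GRing.scale /= mulr1.
Unshelve. all: by end_near. Qed.

Lemma open_setX {X Y : topologicalType} (A : set X) (B : set Y) :
  open A -> open B -> open (A `*` B).
Proof.
move=> oA oB; rewrite openE => -[x y] [/= Ax By].
by exists (A, B) => //; split; exact: open_nbhs_nbhs.
Qed.

(** [w] comes from derivatives, with no measurability attached. But sin (2 pi <xi, w> / n) is a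
    continuous function of q (w / n), and multiplied by n it tends to 2 pi <xi, w>. *)
Lemma measurable_dot_int {d : measure_display} {T : measurableType d} {R : realType}
    {G : topGroupType} {r : nat} (q : 'rV[R]_r -> G) (w : T -> 'rV[R]_r)
    (xi : 'rV[int]_r) (k : G -> R) : continuous k ->
  (forall u, k (q u) = cos (2 * pi * dot_int xi u - pi / 2)) ->
  (forall t, measurable_fun setT (fun x => q (t *: w x) : borel G)) ->
  measurable_fun setT (fun x => dot_int xi (w x)).
Proof.
move=> ck kq mq.
have ks u : k (q u) = sin (2 * pi * dot_int xi u).
  by rewrite kq cosB cos_pihalf sin_pihalf mulr0 add0r mulr1.
pose f n x := (2 * pi)^-1 * (n.+1%:R * k (q (n.+1%:R^-1 *: w x))).
apply: (@measurable_fun_cvg _ _ _ _ f) => [n|x _].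
  apply: measurable_funM => //; apply: measurable_funM => //.
  exact: (measurableT_comp (continuous_borel_real ck) (mq _)).
have -> : dot_int xi (w x) = (2 * pi)^-1 * (2 * pi * dot_int xi (w x)).
  by rewrite mulKf// mulf_neq0// gt_eqF// pi_gt0.
apply: cvgM; first exact: cvg_cst.
rewrite (_ : (fun n => _) = (fun n => n.+1%:R * sin (n.+1%:R^-1 * (2 * pi * dot_int xi (w x))))).
  exact: sinZ_cvg.
by apply/funext => n; rewrite ks dot_intZ; congr (_ * sin _); ring.
Qed.

Section transfer.
Context {R : realType} {M Omega : ptopologicalType} {G : topGroupType} {d r : nat}.
Variables (proj : Omega -> M) (psi : Omega -> M * G) (D : set M).
Variables (mu : probability (borel Omega) R) (haar : probability (borel G) R).
Variables (g : R -> Omega -> Omega) (ex : 'rV[R]_d -> G) (v : M -> 'rV[R]_d).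
Variables (h : 'rV[R]_d -> G) (q : 'rV[R]_r -> G) (w : M -> 'rV[R]_r).
Variable m : {measure set (borel M) -> \bar R}.
Let P := proj @^-1` D.
Hypothesis D_open : open D.
Hypothesis D_base : countable_base_on D.
Hypothesis G_base : countable_base_on [set: G].
Hypothesis proj_cont : continuous proj.
Hypothesis psi_homeo : homeo_on P (D `*` [set: G]) psi.
Hypothesis psi1 : forall o, P o -> (psi o).1 = proj o.
Hypothesis g_meas : forall t, measurable_fun setT (g t : borel Omega -> borel Omega).
Hypothesis g_compat : forall t o, P o ->
  P (g t o) /\ psi (g t o) = (proj o, (ex (t *: v (proj o)) * (psi o).2)%g).
Hypothesis v_meas : measurable_fun setT (v : borel M -> borel 'rV[R]_d).
Hypothesis h_meas : measurable_fun setT (h : borel 'rV[R]_d -> borel G).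
Hypothesis mul_meas :
  measurable_fun setT (fun p : borel G * borel G => (p.1 * p.2)%g : borel G).
Hypothesis inv_cont : continuous (fun a : G => a^-1%g).
Hypothesis haar_inv : haar_probability haar.
Hypothesis conj : forall t x, ((h (v x))^-1 * ex (t *: v x) * h (v x))%g = q (t *: w x).
Variable v_out : 'rV[R]_d.
Hypothesis v_off : forall x, ~ D x -> v x = v_out.
Hypothesis m_def : m = restr (pushforward mu (proj : borel Omega -> borel M)) D
  :> (set (borel M) -> \bar R).
Hypothesis mu_compat : forall B : set (borel M * borel G), measurable B ->
  mu (P `&` psi @^-1` B) = (m \x haar)%E B.

Local Notation lam := (m \x haar)%E.

Lemma measurable_dom : measurable (D : set (borel M)).
Proof. exact: borel_open. Qed.

Lemma measurable_proj : measurable_fun setT (proj : borel Omega -> borel M).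
Proof. exact: continuous_borel. Qed.

Lemma open_fiber : open P.
Proof. by apply: open_comp => // o _; exact: proj_cont. Qed.

Lemma measurable_fiber : measurable (P : set (borel Omega)).
Proof. by apply: borel_open; exact: open_fiber. Qed.

(** A total function that inverts [psi] over the chart; its other values are arbitrary. *)
Variable gam : M * G -> Omega.
Hypothesis gamK : forall o, P o -> gam (psi o) = o.
Hypothesis gam_cont : {within D `*` [set: G], continuous gam}.

Lemma psiK p : D p.1 -> P (gam p) /\ psi (gam p) = p.
Proof.
case: psi_homeo => -[psiP _ psiS] _ _ Dp.
by have [y Py <-] := psiS p (Logic.conj Dp Logic.I); rewrite gamK.
Qed.

Lemma gam_proj p : D p.1 -> proj (gam p) = p.1.
Proof. by move=> /psiK[Pg pg]; rewrite -psi1// pg. Qed.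

Lemma measurable_gam : measurable_fun (D `*` [set: G] : set (borel M * borel G))
  (gam : borel M * borel G -> borel Omega).
Proof.
apply: borel_measurable_fun.
  by apply: measurableX => //; exact: measurable_dom.
move=> W oW; apply: (open_prod_measurable D_base G_base); last by move=> p [].
apply: within_continuous_open => //; apply: open_setX => //; exact: openT.
Qed.

Let psi2 : borel Omega -> borel G := (fun o => (psi o).2 : borel G) \_ P.

Lemma psi2E o : P o -> psi2 o = (psi o).2.
Proof. by move=> Po; rewrite /psi2 patchT// mem_set. Qed.

Lemma measurable_psi2 : measurable_fun setT psi2.
Proof.
apply/(measurable_restrictT _ measurable_fiber).
apply: borel_measurable_fun; first exact: measurable_fiber.
move=> W oW; apply: borel_open.
rewrite (_ : _ `&` _ = P `&` psi @^-1` (setT `*` W)); last first.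
  by apply/seteqP; split=> o /=; tauto.
apply: within_continuous_open; [exact: open_fiber|by case: psi_homeo|].
by apply: open_setX => //; exact: openT.
Qed.

Let H (x : borel M) : borel G := h (v x).

Lemma measurable_H : measurable_fun setT H.
Proof. exact: (measurableT_comp h_meas v_meas). Qed.

Lemma measurable_H_inv : measurable_fun setT (fun x => (H x)^-1%g : borel G).
Proof. exact: (measurableT_comp (continuous_borel inv_cont) measurable_H). Qed.

Lemma measurable_mul {d' : measure_display} {T : measurableType d'} (a b : T -> borel G) :
  measurable_fun setT a -> measurable_fun setT b ->
  measurable_fun setT (fun x => (a x * b x)%g : borel G).
Proof.
move=> ma mb; apply: (measurableT_comp mul_meas (g := fun x => (a x, b x))).
exact: measurable_fun_pair.
Qed.

(** [ex] is only controlled along lines, so measurability is taken from the flow: exp (t v(x)) is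
    the fibre coordinate at time t of the point that starts at (x, 1). *)
Lemma measurable_exp t : measurable_fun setT (fun x : borel M => ex (t *: v x) : borel G).
Proof.
rewrite -(setUv D); apply/measurable_funU.
- exact: measurable_dom.
- by apply: measurableC; exact: measurable_dom.
split; last first.
  by apply: (eq_measurable_fun (fun=> ex (t *: v_out) : borel G)) => // x /set_mem nDx; rewrite v_off.
pose f (x : borel M) : borel G := psi2 (g t (gam (x, 1%g))).
apply: (eq_measurable_fun f).
  move=> x /set_mem Dx; have [Pg pg] := psiK (p := (x, 1%g)) Dx.
  have [Pgg pgg] := g_compat t Pg.
  by rewrite /f psi2E// pgg /= gam_proj// pg /= mulg1.
have mg : measurable_fun (D : set (borel M)) (fun x : borel M => gam (x, 1%g : G) : borel Omega).
  have mp : measurable_fun setT (fun x : borel M => (x, (1%g : borel G))).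
    exact: measurable_fun_pair.
  apply: (measurable_comp _ _ measurable_gam (measurable_funTS mp)).
  - by apply: measurableX => //; exact: measurable_dom.
  - by move=> _ [x Dx <-].
exact: (measurableT_comp measurable_psi2 (measurableT_comp (g_meas t) mg)).
Qed.

Lemma measurable_qw t : measurable_fun setT (fun x : borel M => q (t *: w x) : borel G).
Proof.
under eq_fun do rewrite -conj.
apply: measurable_mul; last exact: measurable_H.
by apply: measurable_mul; [exact: measurable_H_inv|exact: measurable_exp].
Qed.

Let zeta (o : borel Omega) : borel M * borel G := (proj o, ((H (proj o))^-1 * psi2 o)%g).

Lemma measurable_zeta : measurable_fun setT zeta.
Proof.
apply: measurable_fun_pair; first exact: measurable_proj.
apply: measurable_mul; last exact: measurable_psi2.
exact: (measurableT_comp measurable_H_inv measurable_proj).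
Qed.

(** Inverse of [zeta] over the chart, given a default value elsewhere so as to be measurable
    everywhere. *)
Let Theta : borel M * borel G -> borel Omega :=
  (fun p => gam (p.1, (H p.1 * p.2)%g)) \_ (D `*` setT).

Lemma measurable_Theta : measurable_fun setT Theta.
Proof.
have mDT : measurable (D `*` setT : set (borel M * borel G)).
  by apply: measurableX => //; exact: measurable_dom.
apply/(measurable_restrictT _ mDT).
have mf : measurable_fun setT (fun p : borel M * borel G => (p.1, (H p.1 * p.2)%g : borel G)).
  apply: measurable_fun_pair => //; apply: measurable_mul => //.
  exact: (measurableT_comp measurable_H measurable_fst).
apply: (measurable_comp mDT _ measurable_gam (measurable_funTS mf)).
by move=> _ [p [Dp _] <-].
Qed.

Lemma ThetaK o : P o -> Theta (zeta o) = o.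
Proof.
move=> Po; rewrite /Theta patchT; last by rewrite inE.
rewrite /= mulgA mulgV mul1g psi2E//.
rewrite (_ : (proj o, (psi o).2) = psi o); first exact: gamK.
by rewrite -psi1//; case: (psi o).
Qed.

(** Inserting h h^-1 behind exp (t v) makes the conjugate q (t w) appear in front of the new fibre
    coordinate. *)
Lemma zeta_flow t o : P o -> zeta (g t o) = @skew_flow R _ (borel M) G r q w t (zeta o).
Proof.
move=> Po; have [Pg pg] := g_compat t Po.
have projg : proj (g t o) = proj o by rewrite -psi1// pg.
rewrite /zeta /skew_flow /= projg psi2E// pg /= -conj psi2E//; congr pair.
by rewrite /H -!mulgA; congr (_ * (_ * _))%g; rewrite mulgA mulgV mul1g.
Qed.

Lemma m_fin : (m setT < +oo)%E.
Proof.
rewrite m_def /restr (le_lt_trans _ (ltry 1))// -(probability_setT mu).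
rewrite /pushforward; apply: le_measure; rewrite ?inE//.
rewrite setTI -[X in measurable X]setTI; apply: measurable_proj => //.
exact: measurable_dom.
Qed.

(** In the fibre over x the new coordinate differs from the old one by a left translation, so the
    product form of the measure is kept. *)
Lemma zeta_pushforward A : measurable A -> mu (zeta @^-1` A `&` P) = lam A.
Proof.
move=> mA.
pose B : set (borel M * borel G) := (fun p => (p.1, ((H p.1)^-1 * p.2)%g)) @^-1` A.
have mB : measurable B.
  have mf : measurable_fun setT
      (fun p : borel M * borel G => (p.1, ((H p.1)^-1 * p.2)%g : borel G)).
    apply: measurable_fun_pair => //; apply: measurable_mul => //.
    exact: (measurableT_comp measurable_H_inv measurable_fst).
  by rewrite -[X in measurable X]setTI; exact: mf.
transitivity (lam B).
  rewrite -mu_compat//; congr (mu _); apply/seteqP; split=> o /= [].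
    by rewrite /zeta /B /= => + Po; rewrite psi2E// psi1.
  by rewrite /zeta /B /= => Po; rewrite psi2E// psi1.
rewrite /product_measure1; apply: eq_integral => x _ /=.
by rewrite -(haar_inv (H x)^-1%g (measurable_xsection x mA)).
Qed.

Lemma int_zeta F : bmf F ->
  \int[mu]_o (F (zeta o) * \1_P o) = \int[lam]_p F p.
Proof.
move=> bF; have fin : (mu setT < +oo)%E by rewrite probability_setT ltry.
have mz := measurable_zeta.
rewrite -(integral_mrestr measurable_fiber fin (bmf_map mz bF)) /= -[RHS]mul1r.
apply: integral_map => //; first exact: (lam_fin haar m_fin).
by move=> A mA; rewrite mul1e; exact: zeta_pushforward.
Qed.

Lemma bmf_indic_fiber : bmf (\1_P : borel Omega -> R).
Proof. by apply: bmf_indic; exact: measurable_fiber. Qed.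

Lemma chart_pres t (A : set (borel Omega)) : measurable A ->
  mu (g t @^-1` A `&` P) = mu (A `&` P).
Proof.
move=> mA; pose S : set (borel M * borel G) := Theta @^-1` A.
have mS : measurable S by rewrite -[S]setTI; exact: measurable_Theta.
have mSt : measurable (@skew_flow R _ (borel M) G r q w t @^-1` S).
  by rewrite -[X in measurable X]setTI; apply: (skew_measurable mul_meas measurable_qw t).
rewrite (_ : g t @^-1` A `&` P = zeta @^-1` (@skew_flow R _ (borel M) G r q w t @^-1` S) `&` P).
  rewrite zeta_pushforward//.
  rewrite (skew_preserves m q w haar_inv t mS) -zeta_pushforward//.
  congr (mu _); apply/seteqP; split=> y [/= Ay Py]; split=> //.
    by rewrite /S /= ThetaK in Ay.
  by rewrite /S /= ThetaK.
apply/seteqP; split=> y [/= Ay Py]; split=> //.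
  by rewrite /= -zeta_flow// /S /= ThetaK//; have [] := g_compat t Py.
by move: Ay; rewrite -zeta_flow// /S /= ThetaK//; have [] := g_compat t Py.
Qed.

Lemma chart_cauchy (A : set (borel Omega)) (phi : borel Omega -> R) :
  (forall S, measurable S -> converging m haar q w (\1_S : borel M * borel G -> R)) ->
  measurable A -> bmf phi ->
  cauchy_oo (fun t => \int[mu]_o (\1_A (g t o) * phi o * \1_P o)).
Proof.
move=> hconv mA bphi.
pose S : set (borel M * borel G) := Theta @^-1` A.
have mS : measurable S by rewrite -[S]setTI; exact: measurable_Theta.
have bPhi := bmf_map measurable_Theta bphi.
have := hconv S mS _ bPhi.
rewrite (_ : (fun t => _) = fun t => \int[mu]_o (\1_A (g t o) * phi o * \1_P o))//.
apply/funext => t; rewrite -int_zeta; last first.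
  apply: bmfM => //.
  have := bmf_skew mul_meas measurable_qw t (bmf_indic mS).
  exact.
apply: eq_int => y; rewrite [\1_P y]indicE.
case: (boolP (y \in P)) => [/set_mem Py|]; last by rewrite !mulr0.
rewrite !mulr1 /= ThetaK// -zeta_flow//.
have [Pg _] := g_compat t Py.
have -> // : \1_S (zeta (g t y)) = \1_A (g t y) :> R.
rewrite !indicE (_ : (zeta (g t y) \in S) = (g t y \in A))//.
by apply/idP/idP; rewrite !inE /S /= ThetaK.
Qed.

Lemma chart_converging :
  (forall f phi : borel Omega -> R, bmf f -> bmf phi ->
     cauchy_oo (fun t => \int[mu]_o (f (g t o) * phi o))) ->
  forall F, bmf F -> converging m haar q w (F : borel M * borel G -> R).
Proof.
move=> hcauchy F bF Phi bPhi.
pose f (y : borel Omega) : R := F (zeta y) * \1_P y.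
pose phi (y : borel Omega) : R := Phi (zeta y) * \1_P y.
have bf : bmf f by apply: bmfM bmf_indic_fiber; exact: (bmf_map measurable_zeta bF).
have bphi : bmf phi by apply: bmfM bmf_indic_fiber; exact: (bmf_map measurable_zeta bPhi).
have := hcauchy _ _ bf bphi.
rewrite (_ : (fun t => _) = fun t => \int[(m \x haar)%E]_p
  (F (@skew_flow R _ (borel M) G r q w t p) * Phi p))//.
apply/funext => t; rewrite -int_zeta; last first.
  by apply: bmfM => //; exact: (bmf_skew mul_meas measurable_qw t bF).
apply: eq_int => y; rewrite /f /phi.
have [Py|nPy] := pselect (P y); last by rewrite (_ : \1_P y = 0) ?mulr0// indicE memNset.
have [Pg _] := g_compat t Py.
rewrite (_ : \1_P y = 1); last by rewrite indicE mem_set.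
rewrite (_ : \1_P (g t y) = 1); last by rewrite indicE mem_set.
by rewrite !mulr1 zeta_flow.
Qed.

Hypothesis G_compact : compact [set: G].
Hypothesis G_hausdorff : hausdorff_space G.
Hypothesis mul_cont : continuous (fun p : G * G => (p.1 * p.2)%g).
Hypothesis q_cont : continuous q.
Hypothesis qD : forall u v, q (u + v) = (q u * q v)%g.
Hypothesis q_period : forall z : 'rV[int]_r, q (map_mx intr z) = 1%g.
Hypothesis q_char : forall (xi : 'rV[int]_r) (a : R), exists k : G -> R,
  [/\ continuous k, forall z, `|k z| <= 1 &
      forall u, k (q u) = cos (2 * pi * dot_int xi u + a)].

(** The two implications are not symmetric: vanishing modes control correlations over this chart
    only, whereas the converse starts from correlations on all of Omega. *)
Lemma chart_equivalence :
  [/\ forall t (A : set (borel Omega)), measurable A ->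
        mu (g t @^-1` A `&` P) = mu (A `&` P),
      forall xi : 'rV[int]_r, measurable_fun setT (fun x : borel M => dot_int xi (w x)),
      (forall xi : 'rV[int]_r, xi != 0 ->
         mode_vanish m (fun x : borel M => dot_int xi (w x))) ->
      forall (A : set (borel Omega)) (phi : borel Omega -> R), measurable A -> bmf phi ->
        cauchy_oo (fun t => \int[mu]_o (\1_A (g t o) * phi o * \1_P o)) &
      (forall f phi : borel Omega -> R, bmf f -> bmf phi ->
         cauchy_oo (fun t => \int[mu]_o (f (g t o) * phi o))) ->
      forall xi : 'rV[int]_r, mode_vanish m (fun x : borel M => dot_int xi (w x))].
Proof.
have mw (xi : 'rV[int]_r) : measurable_fun setT (fun x : borel M => dot_int xi (w x)).
  have [k [ck _ kq]] := q_char xi (- (pi / 2)).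
  exact: (measurable_dot_int ck kq measurable_qw).
split=> //.
- exact: chart_pres.
- move=> hmode A phi mA bphi; apply: chart_cauchy => // S mS.
  exact: (converging_indic m_fin haar_inv mul_meas measurable_qw mw G_compact G_hausdorff
    G_base mul_cont q_cont qD q_period hmode mS).
- move=> hc xi a; have [k [ck k1 kq]] := q_char xi a.
  have hconv := chart_converging hc.
  exact: (converging_mode m_fin haar_inv mul_meas measurable_qw mw G_compact
    G_base mul_cont ck k1 kq hconv).
Qed.

End transfer.

(** * Square integrable functions and weak limits *)

Section square_integrable.
Context {d : measure_display} {T : measurableType d} {R : realType}.
Variable mu : {measure set T -> \bar R}.
Hypothesis fin : (mu setT < +oo)%E.
Implicit Types f u : T -> R.

Definition sq_int f : Prop :=
  measurable_fun setT f /\ mu.-integrable setT (EFin \o (fun x => f x ^+ 2)).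

Lemma sq_intP f : f \in Lfun mu 2%:E <-> sq_int f.
Proof.
split=> [hf|[mf hf]].
  by split; [move: hf; rewrite inE => /andP[]; rewrite inE|exact: Lfun2_integrable_sqr].
rewrite inE; apply/andP; split; rewrite inE//= /finite_norm unlock poweR_lty//.
have /integrableP[_] := hf; apply: le_lt_trans.
rewrite le_eqVlt; apply/orP; left; apply/eqP; apply: eq_integral => x _ /=.
by rewrite powR_mulrn// normrX.
Qed.

Lemma integrable_dominated f u : measurable_fun setT f -> (forall x, `|f x| <= u x) ->
  mu.-integrable setT (EFin \o u) -> mu.-integrable setT (EFin \o f).
Proof.
move=> mf fu; apply: le_integrable => //; first exact/measurable_EFinP.
by move=> x _; rewrite /= lee_fin (le_trans (fu x))// ler_norm.
Qed.

Lemma bmf_sq_int f : bmf f -> sq_int f.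
Proof.
move=> bf; split; first by case: bf.
by apply: bmf_integrable => //; under eq_fun do rewrite expr2; exact: bmfM.
Qed.

(** Expansion of s (a - b / s)^2 and s (a + b / s)^2. The free weight s makes it do the work of the
    Cauchy-Schwarz inequality. *)
Lemma young (a b s : R) : 0 < s -> `|a * b| <= s * a ^+ 2 + s^-1 * b ^+ 2.
Proof.
move=> s0; have s0' : 0 < s^-1 by rewrite invr_gt0.
have h : s * s^-1 = 1 by rewrite mulfV// gt_eqF.
have h1 : 0 <= s * (a - s^-1 * b) ^+ 2 by rewrite mulr_ge0 ?sqr_ge0// ltW.
have h2 : 0 <= s * (a + s^-1 * b) ^+ 2 by rewrite mulr_ge0 ?sqr_ge0// ltW.
have e1 : s * (a - s^-1 * b) ^+ 2 = s * a ^+ 2 + (s * s^-1) * s^-1 * b ^+ 2 - 2 * (s * s^-1) * (a * b) by ring.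
have e2 : s * (a + s^-1 * b) ^+ 2 = s * a ^+ 2 + (s * s^-1) * s^-1 * b ^+ 2 + 2 * (s * s^-1) * (a * b) by ring.
have a0 : 0 <= s * a ^+ 2 by rewrite mulr_ge0 ?sqr_ge0// ltW.
have b0 : 0 <= s^-1 * b ^+ 2 by rewrite mulr_ge0 ?sqr_ge0// ltW.
move: h1 h2; rewrite e1 e2 h mul1r mulr1 ler_norml => h1 h2; apply/andP; split; lra.
Qed.

Lemma sq_int_mul f u : sq_int f -> sq_int u ->
  mu.-integrable setT (EFin \o (fun x => f x * u x)).
Proof.
move=> [mf hf] [mu' hu].
apply: (@integrable_dominated _ (fun x => f x ^+ 2 + u x ^+ 2)); last 2 first.
- move=> x; have := young (f x) (u x) ltr01; by rewrite invr1 !mul1r.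
- exact: (integrableD measurableT hf hu).
exact: measurable_funM.
Qed.

Lemma sq_int_bound f u s : sq_int f -> sq_int u -> 0 < s ->
  `|\int[mu]_x (f x * u x)| <=
    s * \int[mu]_x (f x ^+ 2) + s^-1 * \int[mu]_x (u x ^+ 2).
Proof.
move=> sf su s0; have ifu := sq_int_mul sf su.
have [mf hf] := sf; have [mu' hu] := su.
apply: le_trans (le_normr_Rintegral measurableT ifu) _.
have hf' : mu.-integrable setT (EFin \o (fun x => s * f x ^+ 2)).
  exact: (integrableZl measurableT s hf).
have hu' : mu.-integrable setT (EFin \o (fun x => s^-1 * u x ^+ 2)).
  exact: (integrableZl measurableT s^-1 hu).
rewrite -!RintegralZl// -RintegralD//.
apply: le_Rintegral => //.
- exact: (integrable_abse ifu).
- exact: (integrableD measurableT hf' hu').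
- by move=> x _; exact: young.
Qed.

Lemma sq_int_integrable f : sq_int f -> mu.-integrable setT (EFin \o f).
Proof.
move=> sf; have := sq_int_mul sf (bmf_sq_int (bmf_cst 1)).
by under eq_fun do rewrite mulr1.
Qed.

Lemma sq_intZ c f : sq_int f -> sq_int (fun x => c * f x).
Proof.
move=> [mf hf]; split; first exact: measurable_funM.
under eq_fun do rewrite exprMn.
exact: (integrableZl measurableT (c ^+ 2) hf).
Qed.

Lemma sq_intD f u : sq_int f -> sq_int u -> sq_int (fun x => f x + u x).
Proof.
move=> sf su; have ifu := sq_int_mul sf su.
have [mf hf] := sf; have [mu' hu] := su; split; first exact: measurable_funD.
have := integrableD measurableT (integrableD measurableT hf hu)
  (integrableZl measurableT 2 ifu).
apply: eq_integrable => // x _; rewrite /= -EFinM -!EFinD; congr EFin; ring.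
Qed.

Lemma sq_intB f u : sq_int f -> sq_int u -> sq_int (fun x => f x - u x).
Proof.
move=> sf su; have := sq_intD sf (sq_intZ (-1) su).
by under eq_fun do rewrite mulN1r.
Qed.

(** Large values become 0 rather than n, so that the square of the truncation equals its product
    with [f]. *)
Definition truncate (n : nat) f x : R := if `|f x| <= n%:R then f x else 0.

Lemma truncateE n f x : truncate n f x = f x * \1_[set x | `|f x| <= n%:R] x.
Proof.
rewrite /truncate indicE; case: ifPn => h; first by rewrite mem_set ?mulr1.
by rewrite memNset ?mulr0//; exact/negP.
Qed.

Lemma bmf_truncate n f : measurable_fun setT f -> bmf (truncate n f).
Proof.
move=> mf; split; last first.
  by exists n%:R => x; rewrite /truncate; case: ifP => //; rewrite normr0.
have -> : truncate n f = fun x => f x * \1_[set x | `|f x| <= n%:R] x.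
  by apply/funext => x; rewrite truncateE.
apply: measurable_funM => //; apply: measurable_indic.
have -> : [set x | `|f x| <= n%:R] = (fun x => `|f x|) @^-1` `]-oo, n%:R]%classic.
  by apply/seteqP; split=> x /=; rewrite in_itv.
by rewrite -[X in measurable X]setTI; apply: measurableT_comp.
Qed.

Lemma truncateB_sq n f x : (f x - truncate n f x) ^+ 2 <= f x ^+ 2.
Proof.
by rewrite /truncate; case: ifP => _; rewrite ?subr0// subrr expr0n sqr_ge0.
Qed.

Lemma truncate_near f x : exists N, forall n, (N <= n)%N -> truncate n f x = f x.
Proof.
exists (Num.truncn `|f x|).+1 => n Nn; rewrite /truncate ifT//.
by rewrite ltW// (lt_le_trans (truncnS_gt _))// ler_nat.
Qed.

Lemma truncate_approx f : sq_int f -> forall e, 0 < e -> exists n,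
  \int[mu]_x ((f x - truncate n f x) ^+ 2) <= e.
Proof.
move=> sf e e0; have [mf hf] := sf.
have bn n := bmf_truncate n mf.
have H1 n : measurable_fun setT (fun x => ((f x - truncate n f x) ^+ 2)%:E).
  apply/measurable_EFinP; apply: measurable_funX; apply: measurable_funB => //.
  by case: (bn n).
have H2 : measurable_fun setT (fun x : T => 0%:E : \bar R) by exact: measurable_cst.
have H3 : {ae mu, forall x, setT x ->
    ((f x - truncate n f x) ^+ 2)%:E @[n --> \oo] --> (0%:E : \bar R)}.
  apply: aeW => x _; have [N hN] := truncate_near f x.
  apply: (@cvg_trans _ ((fun=> 0%:E : \bar R) @ \oo)); last exact: cvg_cst.
  by apply: near_eq_cvg; exists N => // n /= Nn; rewrite hN// subrr expr0n.
have H5 : {ae mu, forall x n, setT x ->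
    (`|((f x - truncate n f x) ^+ 2)%:E| <= (f x ^+ 2)%:E)%E}.
  by apply: aeW => x n _; rewrite /= lee_fin ger0_norm ?sqr_ge0// truncateB_sq.
have [_ + _] := dominated_convergence measurableT H1 H2 H3 hf H5.
move=> /= /fine_cvgP[_ /cvgrPdist_le/(_ e e0)[n0 _ hn]].
exists n0; have := hn n0 (leqnn _); rewrite /= sub0r normrN.
apply: le_trans; rewrite le_eqVlt; apply/orP; left; apply/eqP.
rewrite ger0_norm; last by apply: fine_ge0; exact: integral_ge0.
congr fine; apply: eq_integral => x _.
by rewrite subr0 ger0_norm ?sqr_ge0.
Qed.

(** The squares of the truncations increase to f^2: monotone convergence. *)
Lemma sq_int_of_truncate f (C : R) : measurable_fun setT f ->
  (forall n, \int[mu]_x (truncate n f x ^+ 2) <= C) -> sq_int f.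
Proof.
move=> mf hC; split=> //; apply/integrableP; split.
  by apply/measurable_EFinP; exact: measurable_funX.
have bn n := bmf_truncate n mf.
have bn2 n : bmf (fun x => truncate n f x ^+ 2).
  by under eq_fun do rewrite expr2; exact: bmfM.
apply: (@le_lt_trans _ _ C%:E); last exact: ltry.
have H1 n : measurable_fun setT (fun x => (truncate n f x ^+ 2)%:E).
  by apply/measurable_EFinP; case: (bn2 n).
have nd x : setT x -> {homo (fun n => (truncate n f x ^+ 2)%:E) : p n / (p <= n)%N >-> (p <= n)%E}.
  move=> _ p n pn; rewrite lee_fin /truncate; case: ifPn => fp; last by rewrite expr0n sqr_ge0.
  by rewrite ifT// (le_trans fp)// ler_nat.
have := @monotone_convergence _ _ _ mu setT measurableT _ H1
  (fun n x _ => ltac:(by rewrite lee_fin sqr_ge0)) nd.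
set L := (\int[mu]_x `|_|)%E => mc.
have -> : L = (\int[mu]_x limn (fun n => (truncate n f x ^+ 2)%:E))%E.
  apply: eq_integral => x _ /=; rewrite ger0_norm ?sqr_ge0//; apply/esym.
  apply: cvg_lim => //; have [N hN] := truncate_near f x.
  apply: (@cvg_trans _ ((fun=> (f x ^+ 2)%:E : \bar R) @ \oo)); last exact: cvg_cst.
  by apply: near_eq_cvg; exists N => // n /= Nn; rewrite hN.
rewrite mc; apply: lime_le.
  apply: ereal_nondecreasing_is_cvgn => p n pn.
  by apply: ge0_le_integral => // x _; rewrite ?lee_fin ?sqr_ge0//; exact: nd.
by apply: nearW => n; rewrite bmf_EFin_int// lee_fin.
Qed.

End square_integrable.

(** Layer decomposition: the number of levels - B + (k + 1) e below f(x) differs from (f(x) + B) / e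
    by at most 1, so a combination of indicators is within e of f. *)
Lemma bmf_uniform_ind {d : measure_display} {T : measurableType d} {R : realType}
    (Q : (T -> R) -> Prop) :
  (forall A, measurable A -> Q (\1_A)) -> (forall c, Q (fun=> c)) ->
  (forall f u, bmf f -> bmf u -> Q f -> Q u -> Q (fun x => f x + u x)) ->
  (forall c f, bmf f -> Q f -> Q (fun x => c * f x)) ->
  (forall f, bmf f -> (forall e, 0 < e -> exists u, [/\ bmf u, Q u &
     forall x, `|f x - u x| <= e]) -> Q f) ->
  forall f, bmf f -> Q f.
Proof.
move=> Q1 Qc QD QZ Qlim f bf; apply: Qlim => // e e0.
have [B B0 hB] := bmf_bound bf; have [mf _] := bf.
pose K := Num.truncn (2 * B / e).
pose A (k : nat) : set T := [set x | - B + k.+1%:R * e <= f x].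
have mA k : measurable (A k).
  have -> : A k = f @^-1` `[- B + k.+1%:R * e, +oo[%classic.
    by apply/seteqP; split=> x /=; rewrite in_itv/= andbT.
  by rewrite -[X in measurable X]setTI; apply: mf.
have bA k : bmf (\1_(A k) : T -> R) by exact: bmf_indic.
(* The sum is the integer part of y capped at K', and y does not exceed K' + 1. *)
have key (K' : nat) (y : R) : 0 <= y <= K'.+1%:R ->
    `|y - \sum_(k < K') ((k.+1%:R : R) <= y)%R%:R| <= 1.
  elim: K' => [|K' IH] hy.
    by rewrite big_ord0 subr0 ger0_norm; move: hy => /andP[].
  rewrite big_ord_recr /=; case: (lerP K'.+1%:R y) => [h|h].
    rewrite (eq_bigr (fun=> 1)); last first.
      by move=> k _; rewrite (le_trans _ h)// ler_nat ltnS ltnW.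
    rewrite sumr_const card_ord (_ : true%:R = 1 :> R)//.
    have : K'.+2%:R = K'%:R + 2 :> R by rewrite -addn2 natrD.
    have : K'.+1%:R = K'%:R + 1 :> R by rewrite -addn1 natrD.
    move: hy h => /andP[_]; rewrite ler_norml; set a := K'%:R; lra.
  by rewrite addr0; apply: IH; move: hy => /andP[-> _]; rewrite ltW.
pose u x : R := - B + e * \sum_(k < K) \1_(A k) x.
have QbS (n : nat) : bmf (fun x => \sum_(k < n) \1_(A k) x : R) /\
    Q (fun x => \sum_(k < n) \1_(A k) x).
  elim: n => [|n [IH1 IH2]].
    by under eq_fun do rewrite big_ord0; split; [exact: bmf_cst|exact: Qc].
  under eq_fun do rewrite big_ord_recr /=.
  by split; [exact: bmfD|apply: QD => //; exact: Q1].
have [bS QS] := QbS K.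
exists u; split.
- by apply: bmfD; [exact: bmf_cst|exact: bmfZ].
- by apply: QD; [exact: bmf_cst|exact: bmfZ|exact: Qc|exact: QZ].
- move=> x; pose y := (f x + B) / e.
  have fy : f x = - B + e * y by rewrite /y mulrCA mulfV ?gt_eqF// mulr1; lra.
  have hBx : - B <= f x <= B by rewrite -ler_norml.
  have hy : 0 <= y <= K.+1%:R.
    apply/andP; split; first by rewrite divr_ge0 ?(ltW e0)//; lra.
    apply: (@le_trans _ _ (2 * B / e)); last by rewrite ltW// truncnS_gt.
    by rewrite ler_pM2r ?invr_gt0//; lra.
  have Ay k : \1_(A k) x = (k.+1%:R <= y)%R%:R :> R.
    rewrite indicE; congr (nat_of_bool _)%:R; apply/idP/idP; rewrite inE /A /= fy lerD2l mulrC ler_pM2l//.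
  rewrite fy /u opprD addrACA subrr add0r -mulrBr normrM gtr0_norm//.
  rewrite (eq_bigr (fun k : 'I_K => (k.+1%:R <= y)%R%:R)); last by move=> k _; exact: Ay.
  by rewrite ler_piMr ?(ltW e0)//; exact: key.
Qed.

(** * Correlations along a measure-preserving flow *)

Section weak_limits.
Context {d : measure_display} {T : measurableType d} {R : realType}.
Variables (mu : probability T R) (g : R -> T -> T).
Hypothesis g_meas : forall t, measurable_fun setT (g t).
Hypothesis g_pres : forall t A, measurable A -> mu (g t @^-1` A) = mu A.

Let fin : (mu setT < +oo)%E.
Proof. by rewrite probability_setT ltry. Qed.

Definition pairing (f phi : T -> R) (t : R) : R := \int[mu]_x (f (g t x) * phi x).

Lemma pres_ge0_int t (u : T -> R) : measurable_fun setT u -> (forall x, 0 <= u x) ->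
  (\int[mu]_x (u (g t x))%:E = \int[mu]_x (u x)%:E)%E.
Proof.
move=> mu0 u0; have mu1 : measurable_fun setT (EFin \o u) by exact/measurable_EFinP.
have := @ge0_integral_pushforward _ _ _ _ R (g t) (g_meas t) mu setT (EFin \o u) measurableT mu1.
rewrite preimage_setT => <-; last by move=> y _; rewrite lee_fin.
by apply: eq_measure_integral => A mA _; exact: g_pres.
Qed.

Lemma pres_integrable t (u : T -> R) : mu.-integrable setT (EFin \o u) ->
  mu.-integrable setT (EFin \o (u \o g t)).
Proof.
move=> /integrableP[/measurable_EFinP mu1 iu]; apply/integrableP; split.
  by apply/measurable_EFinP; exact: measurableT_comp.
have := pres_ge0_int t (measurableT_comp (@normr_measurable R setT) mu1) (fun=> normr_ge0 _).
by move=> /= ->.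
Qed.

Lemma pres_int t (u : T -> R) : mu.-integrable setT (EFin \o u) ->
  \int[mu]_x u (g t x) = \int[mu]_x u x.
Proof.
move=> iu; have /integrableP[mu1 _] := iu; rewrite /Rintegral; congr fine.
have := @integral_pushforward _ _ _ _ R (g t) (g_meas t) mu setT (EFin \o u) mu1.
rewrite preimage_setT => <-//; last exact: pres_integrable.
by apply: eq_measure_integral => A mA _; exact: g_pres.
Qed.

Lemma pres_sq_int t f : sq_int mu f -> sq_int mu (f \o g t) /\
  \int[mu]_x (f (g t x) ^+ 2) = \int[mu]_x (f x ^+ 2).
Proof.
move=> [mf hf]; split; last exact: (pres_int t hf).
by split; [exact: measurableT_comp|exact: (pres_integrable t hf)].
Qed.

Lemma pairing_bound f phi t s : sq_int mu f -> sq_int mu phi -> 0 < s ->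
  `|pairing f phi t| <= s * \int[mu]_x (f x ^+ 2) + s^-1 * \int[mu]_x (phi x ^+ 2).
Proof.
move=> sf sphi s0; have [sft <-] := pres_sq_int t sf.
exact: (sq_int_bound sft sphi s0).
Qed.

Lemma pairingDl f f' phi t : sq_int mu f -> sq_int mu f' -> sq_int mu phi ->
  pairing (fun x => f x + f' x) phi t = pairing f phi t + pairing f' phi t.
Proof.
move=> sf sf' sphi; have [sft _] := pres_sq_int t sf; have [sft' _] := pres_sq_int t sf'.
rewrite /pairing -RintegralD//; [|exact: (sq_int_mul sft sphi)|exact: (sq_int_mul sft' sphi)].
by apply: eq_int => x; rewrite mulrDl.
Qed.

Lemma pairingDr f phi phi' t : sq_int mu f -> sq_int mu phi -> sq_int mu phi' ->
  pairing f (fun x => phi x + phi' x) t = pairing f phi t + pairing f phi' t.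
Proof.
move=> sf sphi sphi'; have [sft _] := pres_sq_int t sf.
rewrite /pairing -RintegralD//; [|exact: (sq_int_mul sft sphi)|exact: (sq_int_mul sft sphi')].
by apply: eq_int => x; rewrite mulrDr.
Qed.

Lemma pairingZl c f phi t : sq_int mu f -> sq_int mu phi ->
  pairing (fun x => c * f x) phi t = c * pairing f phi t.
Proof.
move=> sf sphi; have [sft _] := pres_sq_int t sf.
rewrite /pairing -RintegralZl//; last exact: (sq_int_mul sft sphi).
by apply: eq_int => x; rewrite mulrA.
Qed.

Lemma pairingZr c f phi t : sq_int mu f -> sq_int mu phi ->
  pairing f (fun x => c * phi x) t = c * pairing f phi t.
Proof.
move=> sf sphi; have [sft _] := pres_sq_int t sf.
rewrite /pairing -RintegralZl//; last exact: (sq_int_mul sft sphi).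
by apply: eq_int => x; rewrite mulrCA.
Qed.

Lemma pairingBl f f' phi t : sq_int mu f -> sq_int mu f' -> sq_int mu phi ->
  pairing (fun x => f x - f' x) phi t = pairing f phi t - pairing f' phi t.
Proof.
move=> sf sf' sphi; rewrite -[in RHS]mulN1r -pairingZl// -pairingDl//; last exact: sq_intZ.
by apply: eq_int => x; rewrite mulN1r.
Qed.

Lemma pairingBr f phi phi' t : sq_int mu f -> sq_int mu phi -> sq_int mu phi' ->
  pairing f (fun x => phi x - phi' x) t = pairing f phi t - pairing f phi' t.
Proof.
move=> sf sphi sphi'; rewrite -[in RHS]mulN1r -pairingZr// -pairingDr//; last exact: sq_intZ.
by apply: eq_int => x; rewrite mulN1r.
Qed.

(** First s is taken so that s F <= e / 2, then dl = s e / 2 accounts for the other half. *)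
Lemma small_young (F e : R) : 0 <= F -> 0 < e ->
  exists2 s, 0 < s & exists2 dl, 0 < dl & s * F + s^-1 * dl <= e.
Proof.
move=> F0 e0; have F1 : 0 < F + 1 by rewrite ltr_wpDl.
have s0 : 0 < e / (2 * (F + 1)) by rewrite divr_gt0// mulr_gt0.
exists (e / (2 * (F + 1))) => //; exists (e / 2 * (e / (2 * (F + 1)))).
  by rewrite mulr_gt0// divr_gt0.
rewrite [X in _ + X]mulrCA mulVf ?gt_eqF// mulr1.
have h : F <= F + 1 by rewrite lerDl.
have : e / (2 * (F + 1)) * F <= e / (2 * (F + 1)) * (F + 1) by rewrite ler_wpM2l// ltW.
have -> : e / (2 * (F + 1)) * (F + 1) = e / 2 by field; rewrite gt_eqF.
lra.
Qed.

(** Equicontinuity in t: invariance of [mu] keeps the L2 norm of f o g_t constant. *)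
Lemma pairing_small_l phi e : sq_int mu phi -> 0 < e -> exists2 dl, 0 < dl &
  forall f t, sq_int mu f -> \int[mu]_x (f x ^+ 2) <= dl -> `|pairing f phi t| <= e.
Proof.
move=> sphi e0; have P0 : 0 <= \int[mu]_x (phi x ^+ 2).
  by apply: Rintegral_ge0 => x _; rewrite sqr_ge0.
have [s s0 [dl dl0 h]] := small_young P0 e0; exists dl => // f t sf fdl.
have s0' : 0 < s^-1 by rewrite invr_gt0.
apply: le_trans (pairing_bound t sf sphi s0') _; rewrite invrK addrC.
by apply: le_trans h; rewrite lerD2l ler_pM2l.
Qed.

Lemma pairing_small_r f e : sq_int mu f -> 0 < e -> exists2 dl, 0 < dl &
  forall phi t, sq_int mu phi -> \int[mu]_x (phi x ^+ 2) <= dl -> `|pairing f phi t| <= e.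
Proof.
move=> sf e0; have P0 : 0 <= \int[mu]_x (f x ^+ 2).
  by apply: Rintegral_ge0 => x _; rewrite sqr_ge0.
have [s s0 [dl dl0 h]] := small_young P0 e0; exists dl => // phi t sphi pdl.
apply: le_trans (pairing_bound t sf sphi s0) _.
by apply: le_trans h; rewrite lerD2l ler_pM2l// invr_gt0.
Qed.

Lemma sq_int_small (u : T -> R) e : 0 <= e -> bmf u -> (forall x, `|u x| <= e) ->
  \int[mu]_x (u x ^+ 2) <= e ^+ 2.
Proof.
move=> e0 bu hu; have b2 : bmf (fun x => u x ^+ 2).
  by under eq_fun do rewrite expr2; exact: bmfM.
have := bmf_int_le (B := e ^+ 2) fin b2 _.
rewrite -[fine _]/(fine (mu setT)) probability_setT /= mulr1 => h; apply: le_trans (ler_norm _) (h _) => x.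
by rewrite normrX ler_pXn2r// nnegrE.
Qed.

(** Layers lead from indicators to bounded f, then truncation leads to square integrable functions
    on both sides. *)
Lemma pairing_cauchy :
  (forall A phi, measurable A -> bmf phi -> cauchy_oo (pairing (\1_A) phi)) ->
  forall f phi, sq_int mu f -> sq_int mu phi -> cauchy_oo (pairing f phi).
Proof.
move=> hA; have hb f phi : bmf f -> bmf phi -> cauchy_oo (pairing f phi).
  move=> bf bphi; have sphi := bmf_sq_int fin bphi.
  move: f bf; apply: bmf_uniform_ind.
  - by move=> A mA; exact: hA.
  - move=> c; exact: cauchy_oo_cst.
  - move=> f u bf bu cf cu.
    rewrite (_ : pairing _ _ = fun t => pairing f phi t + pairing u phi t).
      exact: cauchy_ooD.
    by apply/funext => t; rewrite pairingDl//; exact: bmf_sq_int.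
  - move=> c f bf cf.
    rewrite (_ : pairing _ _ = fun t => c * pairing f phi t); first exact: cauchy_ooZ.
    by apply/funext => t; rewrite pairingZl//; exact: bmf_sq_int.
  - move=> f bf happ; apply: cauchy_oo_approx => e e0.
    have [dl dl0 hdl] := pairing_small_l sphi e0.
    (* The minimum with 1 bounds the squared error by the error itself, hence by dl. *)
    have [u [bu cu fu]] := happ (Num.min 1 dl) (ltac:(by rewrite lt_min ltr01 dl0)).
    exists (pairing u phi) => // t; rewrite -pairingBl; [|exact: bmf_sq_int..].
    apply: hdl; first by apply: bmf_sq_int => //; exact: bmfB.
    have m0 : 0 <= Num.min 1 dl by rewrite le_min ler01 ltW.
    apply: le_trans (sq_int_small m0 (bmfB bf bu) fu) _.
    apply: (@le_trans _ _ (Num.min 1 dl)); last by rewrite ge_min lexx orbT.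
    by rewrite expr2 ler_piMl// ge_min lexx.
move=> f phi sf sphi; apply: cauchy_oo_approx => e e0.
have e2 : 0 < e / 2 by rewrite divr_gt0.
have [mf _] := sf; have [mphi _] := sphi.
have [dl dl0 hdl] := pairing_small_l sphi e2.
have [n hn] := truncate_approx sf dl0.
have bn := bmf_truncate n mf; have sn := bmf_sq_int fin bn.
(* The tolerance for [phi] depends on the truncation of [f], so it is chosen second. *)
have [dl' dl'0 hdl'] := pairing_small_r sn e2.
have [k hk] := truncate_approx sphi dl'0.
have bk := bmf_truncate k mphi; have sk := bmf_sq_int fin bk.
exists (pairing (truncate n f) (truncate k phi)); first exact: hb.
move=> t; have -> : pairing f phi t - pairing (truncate n f) (truncate k phi) t =
    (pairing f phi t - pairing (truncate n f) phi t) +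
    (pairing (truncate n f) phi t - pairing (truncate n f) (truncate k phi) t) by ring.
rewrite -pairingBl// -pairingBr// (le_trans (ler_normD _ _))// [leRHS]splitr lerD//.
  by apply: hdl => //; exact: sq_intB.
by apply: hdl' => //; exact: sq_intB.
Qed.

End weak_limits.

Lemma cvg_norm_le {R : realType} (F : R -> R) (l C : R) :
  F t @[t --> +oo] --> l -> (forall t, `|F t| <= C) -> `|l| <= C.
Proof.
move=> /cvgrPdist_le hl hC; apply/ler_addgt0Pr => e e0.
have [T0 [_ hT]] := hl e e0.
have h1 : `|l - F (T0 + 1)| <= e by apply: hT; rewrite ltrDl.
have -> : l = (l - F (T0 + 1)) + F (T0 + 1) by ring.
by rewrite (le_trans (ler_normD _ _))// addrC lerD.
Qed.

Section integral_indic.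
Context {d : measure_display} {T : measurableType d} {R : realType}.
Variable mu : {measure set T -> \bar R}.

Lemma Rintegral_indic (A : set T) (u : T -> R) :
  \int[mu]_(x in A) u x = \int[mu]_x (u x * \1_A x).
Proof.
rewrite Rintegral_mkcond; apply: eq_int => x; rewrite patchE indicE.
by case: (_ \in _); rewrite ?mulr1 ?mulr0.
Qed.

Lemma EFin_Rintegral (A : set T) (u : T -> R) : measurable A ->
  mu.-integrable setT (EFin \o u) ->
  (\int[mu]_(x in A) (u x)%:E)%E = (\int[mu]_(x in A) u x)%:E.
Proof.
move=> mA iu; rewrite /Rintegral fineK//; apply: integrable_fin_num => //.
exact: integrableS iu.
Qed.

End integral_indic.

(** * Representation of the weak limit by an invariant function *)

Section weak_limit.
Context {d : measure_display} {T : measurableType d} {R : realType}.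
Variables (mu : probability T R) (g : R -> T -> T) (f : T -> R).
Hypothesis g_meas : forall t, measurable_fun setT (g t).
Hypothesis g_pres : forall t A, measurable A -> mu (g t @^-1` A) = mu A.
Hypothesis g0 : forall x, g 0 x = x.
Hypothesis gD : forall s t x, g (s + t) x = g s (g t x).
Hypothesis f_sq : sq_int mu f.
Hypothesis f_conv : forall phi, sq_int mu phi -> cauchy_oo (pairing mu g f phi).

Let fin : (mu setT < +oo)%E.
Proof. by rewrite probability_setT ltry. Qed.

Definition weak_lim (phi : T -> R) : R := lim (pairing mu g f phi t @[t --> +oo]).
Local Notation ell := weak_lim.

Lemma weak_lim_cvg phi : sq_int mu phi -> pairing mu g f phi t @[t --> +oo] --> ell phi.
Proof.
move=> sphi; have /cauchy_ooP[l hl] := f_conv sphi.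
by rewrite /weak_lim (cvg_lim _ hl).
Qed.

Lemma weak_limE phi l : pairing mu g f phi t @[t --> +oo] --> l -> ell phi = l.
Proof. by move=> hl; rewrite /weak_lim (cvg_lim _ hl). Qed.

Lemma weak_limD phi phi' : sq_int mu phi -> sq_int mu phi' ->
  ell (fun x => phi x + phi' x) = ell phi + ell phi'.
Proof.
move=> sp sp'; apply: weak_limE.
rewrite (_ : pairing _ _ _ _ = fun t => pairing mu g f phi t + pairing mu g f phi' t).
  by apply: cvgD; exact: weak_lim_cvg.
by apply/funext => t; exact: pairingDr.
Qed.

Lemma weak_limZ c phi : sq_int mu phi -> ell (fun x => c * phi x) = c * ell phi.
Proof.
move=> sp; apply: weak_limE.
rewrite (_ : pairing _ _ _ _ = fun t => c * pairing mu g f phi t).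
  by apply: cvgM; [exact: cvg_cst|exact: weak_lim_cvg].
by apply/funext => t; exact: pairingZr.
Qed.

Lemma weak_limB phi phi' : sq_int mu phi -> sq_int mu phi' ->
  ell (fun x => phi x - phi' x) = ell phi - ell phi'.
Proof.
move=> sp sp'; rewrite -[in RHS]mulN1r -weak_limZ// -weak_limD//; last exact: sq_intZ.
by congr ell; apply/funext => x; rewrite mulN1r.
Qed.

Lemma weak_lim_bound phi s : sq_int mu phi -> 0 < s ->
  `|ell phi| <= s * \int[mu]_x (f x ^+ 2) + s^-1 * \int[mu]_x (phi x ^+ 2).
Proof.
by move=> sp s0; apply: cvg_norm_le (weak_lim_cvg sp) _ => t; exact: pairing_bound.
Qed.

Lemma weak_lim_small e : 0 < e -> exists2 dl, 0 < dl &
  forall phi, sq_int mu phi -> \int[mu]_x (phi x ^+ 2) <= dl -> `|ell phi| <= e.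
Proof.
move=> e0; have [dl dl0 h] := pairing_small_r g_meas g_pres f_sq e0.
exists dl => // phi sp hp; apply: cvg_norm_le (weak_lim_cvg sp) _ => t; exact: h.
Qed.

Let nu (A : set T) : \bar R := (ell (\1_A))%:E.

Let sq1 (A : set T) : measurable A -> sq_int mu (\1_A).
Proof. by move=> mA; apply: bmf_sq_int => //; exact: bmf_indic. Qed.

Lemma nu_set0 : nu set0 = 0%E.
Proof.
rewrite /nu (_ : \1_set0 = fun x => 0 * (\1_set0 x : R)); last first.
  by apply/funext => x; rewrite mul0r indicE memNset.
by rewrite weak_limZ ?mul0r//; exact: sq1.
Qed.

Lemma nu_fin A : measurable A -> nu A \is a fin_num.
Proof. by []. Qed.

(** Tails of a disjoint union have small L2 norm, and [ell] is small on such functions by the bound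
    uniform in t. *)
Lemma nu_sigma_additive : semi_sigma_additive nu.
Proof.
move=> F mF tF mUF.
have mn n : measurable (\bigcup_(k < n) F k) by exact: bigcup_measurable.
have -> : (fun n => \sum_(0 <= i < n) nu (F i))%E =
    (fun n => (ell (\1_(\bigcup_(k < n) F k)))%:E).
  apply/funext => n; elim: n => [|n IH].
    rewrite big_geq// -/(nu _) (_ : \bigcup_(k < 0) F k = set0) ?nu_set0//.
    by apply/seteqP; split=> // x [].
  rewrite big_nat_recr//= IH /nu -EFinD -weak_limD; [|exact: sq1..].
  by congr (ell _)%:E; apply/funext => x; rewrite indic_bigcup_recr.
apply: cvg_EFin; first by apply: nearW.
apply/cvgrPdist_le => e e0; have [dl dl0 hdl] := weak_lim_small e0.
have [n0 hn] := bmf_bigcup_approx fin mF dl0.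
exists n0 => // n /= n0n; rewrite /= -weak_limB; [|exact: sq1..].
apply: hdl; first by apply: sq_intB; exact: sq1.
apply: le_trans (hn n n0n); rewrite le_eqVlt; apply/orP; left; apply/eqP.
apply: eq_int => x; have sub : x \in \bigcup_(k < n) F k -> x \in \bigcup_k F k.
  by rewrite !inE => -[k _ Fk]; exists k.
rewrite !indicE; case: (boolP (x \in \bigcup_(k < n) F k)) => [/sub ->|_].
  by rewrite subrr expr0n normr0.
by case: (_ \in _); rewrite subr0 ?expr1n ?normr1// expr0n normr0.
Qed.

Lemma density_exists : exists e : T -> R, mu.-integrable setT (EFin \o e) /\
  forall A, measurable A -> \int[mu]_x (e x * \1_A x) = ell (\1_A).
Proof.
pose C := isCharge.Build _ _ _ nu nu_set0 nu_fin nu_sigma_additive.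
pose nuC : {charge set T -> \bar R} := HB.pack nu C.
have dom : nuC `<< mu.
  (* The indicator of a null set has zero L2 norm, so [ell] is below every e on it. *)
  apply/null_content_dominatesP => A mA A0; rewrite /= /nu; congr EFin.
  apply/eqP; rewrite -normr_le0; apply/ler_addgt0Pr => e e0; rewrite add0r.
  have [dl dl0 hdl] := weak_lim_small e0; apply: hdl; first exact: sq1.
  rewrite (_ : \int[mu]_x _ = 0) ?ltW//.
  rewrite (@eq_int _ _ _ mu _ (\1_A)); last first.
    by move=> x; rewrite indicE; case: (_ \in _); rewrite ?expr1n ?expr0n.
  by rewrite /Rintegral integral_indic// setIT A0.
exists (fun x => fine (Radon_Nikodym nuC mu x)).
have hint : mu.-integrable setT (EFin \o (fun x => fine (Radon_Nikodym nuC mu x))).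
  apply: (eq_integrable measurableT (Radon_Nikodym nuC mu)).
    by move=> x _; rewrite /= fineK// Radon_Nikodym_fin_num.
  exact: Radon_Nikodym_integrable.
split=> // A mA; rewrite -Rintegral_indic; apply: EFin_inj.
rewrite -EFin_Rintegral// -[RHS]/(nuC A) (Radon_Nikodym_integral dom mA).
by apply: eq_integral => x _; rewrite fineK// Radon_Nikodym_fin_num.
Qed.

Section density.
Variable e : T -> R.
Hypothesis e_int : mu.-integrable setT (EFin \o e).
Hypothesis eE : forall A, measurable A -> \int[mu]_x (e x * \1_A x) = ell (\1_A).

Let e_meas : measurable_fun setT e.
Proof. by have /integrableP[/measurable_EFinP] := e_int. Qed.

Lemma integrable_mul_bmf (u phi : T -> R) : mu.-integrable setT (EFin \o u) -> bmf phi ->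
  mu.-integrable setT (EFin \o (fun x => u x * phi x)).
Proof.
move=> iu bphi; have [B B0 hB] := bmf_bound bphi.
have /integrableP[/measurable_EFinP mu1 _] := iu.
apply: (@integrable_dominated _ _ _ mu _ (fun x => B * `|u x|)).
- by apply: measurable_funM => //; case: bphi.
- by move=> x; rewrite normrM mulrC ler_wpM2r.
- exact: (integrableZl measurableT B (integrable_abse iu)).
Qed.

Lemma density_bmf phi : bmf phi -> \int[mu]_x (e x * phi x) = ell phi.
Proof.
have sb phi' := @bmf_sq_int _ _ _ mu fin phi'.
move: phi; apply: bmf_uniform_ind.
- exact: eE.
- move=> c; have := eE measurableT.
  have s1 : sq_int mu (\1_setT) by exact: sq1.
  rewrite (_ : (fun=> c) = fun x => c * (\1_setT x : R)); last first.
    by apply/funext => x; rewrite indicT mulr1.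
  rewrite weak_limZ// => <-; rewrite -RintegralZl//; last first.
    by apply: integrable_mul_bmf => //; exact: bmf_indic.
  by apply: eq_int => x; rewrite indicT mulr1 mulrC.
- move=> u u' bu bu' hu hu'; rewrite (weak_limD (sb _ bu) (sb _ bu')) -hu -hu' -RintegralD//; last 2 first.
  + exact: integrable_mul_bmf.
  + exact: integrable_mul_bmf.
  by apply: eq_int => x; rewrite mulrDr.
- move=> c u bu hu; rewrite (weak_limZ _ (sb _ bu)) -hu -RintegralZl//; last exact: integrable_mul_bmf.
  by apply: eq_int => x; rewrite mulrCA.
- move=> u bu happ; apply/eqP; rewrite -subr_eq0 -normr_le0; apply/ler_addgt0Pr => ep ep0.
  rewrite add0r; have ep2 : 0 < ep / 2 by rewrite divr_gt0.
  pose N := \int[mu]_x `|e x|.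
  have N0 : 0 <= N by apply: Rintegral_ge0.
  have [dl dl0 hdl] := weak_lim_small ep2.
  (* The first two bounds give et^2 <= dl, for [ell]; the third controls the integral against [e],
     which is only integrable at this stage. *)
  pose et := Num.min (Num.min 1 dl) (ep / 2 / (N + 1)).
  have N1 : 0 < N + 1 by rewrite ltr_wpDl.
  have et0 : 0 < et by rewrite !lt_min ltr01 dl0 divr_gt0.
  have [z [bz hz uz]] := happ et et0.
  have bd := bmfB bu bz.
  have -> : \int[mu]_x (e x * u x) - ell u = \int[mu]_x (e x * (u x - z x)) - ell (fun x => u x - z x).
    rewrite (weak_limB (sb _ bu) (sb _ bz)) -hz (_ : \int[mu]_x (e x * (u x - z x)) =
      \int[mu]_x (e x * u x) - \int[mu]_x (e x * z x)); first by ring.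
    rewrite -RintegralB//; [|exact: integrable_mul_bmf|exact: integrable_mul_bmf].
    by apply: eq_int => x; rewrite mulrBr.
  rewrite (le_trans (ler_normB _ _))// [leRHS]splitr lerD//.
    have ii := integrable_mul_bmf e_int bd.
    apply: le_trans (le_normr_Rintegral measurableT ii) _.
    apply: (@le_trans _ _ (\int[mu]_x (et * `|e x|))).
      apply: le_Rintegral => //.
      - exact: (integrable_abse ii).
      - exact: (integrableZl measurableT et (integrable_abse e_int)).
      - by move=> x _; rewrite normrM mulrC ler_wpM2r.
    rewrite RintegralZl//; last exact: (integrable_abse e_int).
    apply: (@le_trans _ _ (ep / 2 / (N + 1) * N)).
      by rewrite ler_wpM2r// ge_min lexx orbT.
    by rewrite mulrAC ler_pdivrMr// ler_wpM2l ?(ltW ep2)// lerDl.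
  apply: hdl; first exact: sb.
  apply: le_trans (sq_int_small mu (ltW et0) bd uz) _.
  apply: (@le_trans _ _ (Num.min 1 dl)); last by rewrite ge_min lexx orbT.
  apply: (@le_trans _ _ et); last by rewrite ge_min lexx.
  by rewrite expr2 ler_piMl ?(ltW et0)// !ge_min lexx.
Qed.

(** Testing [ell] on a truncation of [e] itself gives I <= 2 F + I / 2, where I and F are the
    integrals of the squares of the truncation and of f; hence I <= 4 F for every level. *)
Lemma density_sq_int : sq_int mu e.
Proof.
apply: (@sq_int_of_truncate _ _ _ mu fin _ (4 * \int[mu]_x (f x ^+ 2))) => // n.
have bn := bmf_truncate n e_meas; have sn := bmf_sq_int fin bn.
have := weak_lim_bound sn (ltr0Sn R 1).
rewrite -density_bmf// (@eq_int _ _ _ mu _ (fun x => truncate n e x ^+ 2)); last first.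
  by move=> x; rewrite /truncate; case: ifP => _; rewrite expr2 ?mulr0.
set I1 := \int[mu]_x _; set F1 := \int[mu]_x _.
by rewrite ler_norml => /andP[_]; lra.
Qed.

Lemma density_sq phi : sq_int mu phi -> \int[mu]_x (e x * phi x) = ell phi.
Proof.
move=> sp; have [mp _] := sp; have se := density_sq_int.
apply/eqP; rewrite -subr_eq0 -normr_le0; apply/ler_addgt0Pr => ep ep0; rewrite add0r.
have ep2 : 0 < ep / 2 by rewrite divr_gt0.
have [dl dl0 hdl] := weak_lim_small ep2.
have F0 : 0 <= \int[mu]_x (e x ^+ 2) by apply: Rintegral_ge0 => x _; rewrite sqr_ge0.
have [s s0 [dl' dl'0 hs]] := small_young F0 ep2.
have m0 : 0 < Num.min dl dl' by rewrite lt_min dl0.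
have [n hn] := truncate_approx sp m0.
have bn := bmf_truncate n mp; have sn := bmf_sq_int fin bn.
have sd := sq_intB sp sn.
have -> : \int[mu]_x (e x * phi x) - ell phi =
    \int[mu]_x (e x * (phi x - truncate n phi x)) - ell (fun x => phi x - truncate n phi x).
  rewrite weak_limB// -(density_bmf bn) (_ : \int[mu]_x (e x * (phi x - truncate n phi x)) =
      \int[mu]_x (e x * phi x) - \int[mu]_x (e x * truncate n phi x)); first by ring.
  rewrite -RintegralB//; [|exact: sq_int_mul|exact: sq_int_mul].
  by apply: eq_int => x; rewrite mulrBr.
rewrite (le_trans (ler_normB _ _))// [leRHS]splitr lerD//.
  apply: le_trans (sq_int_bound se sd s0) _; apply: le_trans hs.
  by rewrite lerD2l ler_pM2l ?invr_gt0// (le_trans hn)// ge_min lexx orbT.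
by apply: hdl => //; rewrite (le_trans hn)// ge_min lexx.
Qed.

(** By invariance, moving [e] by s amounts to moving [phi] by - s, that is, to shifting time by s in
    the correlation, and the limit at +oo does not notice. *)
Lemma density_flow s phi : sq_int mu phi ->
  \int[mu]_x (e (g s x) * phi x) = \int[mu]_x (e x * phi x).
Proof.
move=> sp; have se := density_sq_int.
have [spg _] := pres_sq_int g_meas g_pres (- s) sp.
have [seg _] := pres_sq_int g_meas g_pres s se.
have gK x : g s (g (- s) x) = x by rewrite -gD subrr g0.
have gK' x : g (- s) (g s x) = x by rewrite -gD addNr g0.
rewrite -(pres_int g_meas g_pres (- s) (u := fun x => e (g s x) * phi x)); last first.
  exact: (sq_int_mul seg sp).
rewrite (@eq_int _ _ _ mu _ (fun x => e x * phi (g (- s) x))); last by move=> x; rewrite gK.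
rewrite (density_sq spg) (density_sq sp); apply: weak_limE.
rewrite (_ : pairing _ _ _ _ = (fun t => pairing mu g f phi (t + s))); last first.
  apply/funext => t; have [sft _] := pres_sq_int g_meas g_pres t f_sq.
  rewrite /pairing -(pres_int g_meas g_pres s (u := fun x => f (g t x) * phi (g (- s) x))).
    by apply: eq_int => x; rewrite gK' gD.
  exact: (sq_int_mul sft spg).
apply/cvgrPdist_le => ep ep0.
have /cvgrPdist_le/(_ ep ep0)[T0 [_ hT]] := weak_lim_cvg sp.
by exists (T0 - s); split; [exact: num_real|move=> t ht; apply: hT; rewrite -ltrBlDr].
Qed.

Lemma density_flow_ae s : ae_eq mu setT (EFin \o (e \o g s)) (EFin \o e).
Proof.
have se := density_sq_int.
have [seg _] := pres_sq_int g_meas g_pres s se.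
apply: integral_ae_eq => //.
- exact: (sq_int_integrable fin seg).
- exact/measurable_EFinP.
move=> A _ mA.
rewrite (EFin_Rintegral mA (sq_int_integrable fin seg)) (EFin_Rintegral mA e_int).
congr EFin; rewrite Rintegral_indic [RHS]Rintegral_indic.
exact: (density_flow s (sq1 mA)).
Qed.

End density.

Lemma weak_limit_exists : exists e : T -> R,
  [/\ sq_int mu e,
      forall phi, sq_int mu phi ->
        pairing mu g f phi t @[t --> +oo] --> \int[mu]_x (e x * phi x) &
      forall s, ae_eq mu setT (EFin \o (e \o g s)) (EFin \o e)].
Proof.
have [e [ei eE]] := density_exists; exists e; split.
- exact: density_sq_int.
- by move=> phi sp; rewrite density_sq//; exact: weak_lim_cvg.
- by move=> s; exact: density_flow_ae.
Qed.

End weak_limit.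

(** * Keplerian shear and convergence of correlations *)

Section keplerian.
Context {R : realType} {Omega : ptopologicalType}.
Variables (mu : probability (borel Omega) R) (g : R -> Omega -> Omega).
Hypothesis g_flow : flow g.

Let fin : (mu setT < +oo)%E.
Proof. by rewrite probability_setT ltry. Qed.

Let g_meas t : measurable_fun setT (g t : borel Omega -> borel Omega).
Proof. by case: g_flow. Qed.

Lemma keplerian_cauchy : keplerian_shear mu g ->
  forall f phi : borel Omega -> R, bmf f -> bmf phi -> cauchy_oo (pairing mu g f phi).
Proof.
move=> hK f phi bf bphi.
have sf := bmf_sq_int fin bf; have sphi := bmf_sq_int fin bphi.
have [e _ [/sq_intP se he]] := hK f ((sq_intP mu f).2 sf).
have := he phi ((sq_intP mu phi).2 sphi).
have iep := sq_int_mul se sphi.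
have := EFin_Rintegral (A := setT) measurableT iep => -> hcvg.
apply/cauchy_ooP; exists (\int[mu]_x (e x * phi x)).
by move/fine_cvgP : hcvg => [_].
Qed.

Hypothesis g_pres : forall t (A : set (borel Omega)), measurable A ->
  mu ((g t : borel Omega -> borel Omega) @^-1` A) = mu A.
Hypothesis g_conv : forall (A : set (borel Omega)) phi, measurable A -> bmf phi ->
  cauchy_oo (pairing mu g (\1_A : borel Omega -> R) phi).

(** Up to a null set the indicator of [A] may be replaced by its composite with g_t; then [mu] is
    invariant. *)
Lemma invariant_pairing (A : set (borel Omega)) (f : borel Omega -> R) t :
  invariant_sets mu g A -> sq_int mu f ->
  pairing mu g f (\1_A) t = \int[mu]_x (f x * \1_A x).
Proof.
move=> [mA invA] sf; have s1 : sq_int mu (\1_A) by apply: bmf_sq_int => //; exact: bmf_indic.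
rewrite -(pres_int g_meas g_pres t (u := fun x => f x * \1_A x)); last exact: sq_int_mul.
have [sft _] := pres_sq_int g_meas g_pres t sf.
have [s1t _] := pres_sq_int g_meas g_pres t s1.
have iL := sq_int_mul sft s1; have iR := sq_int_mul sft s1t.
rewrite /pairing /Rintegral; congr fine; apply: ae_eq_integral => //.
- by have /integrableP[] := iL.
- by have /integrableP[] := iR.
have mgA : measurable ((g t : borel Omega -> borel Omega) @^-1` A).
  by rewrite -[X in measurable X]setTI; exact: g_meas.
exists (A `+` ((g t : borel Omega -> borel Omega) @^-1` A)); split.
- by apply: measurableU; exact: measurableD.
- exact: invA.
move=> x /= hx; apply: contrapT => nx; apply: hx => _; congr (_ * _)%:E.
rewrite !indicE; congr (nat_of_bool _)%:R; apply/idP/idP; rewrite !inE => h.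
  by apply: contrapT => h'; apply: nx; left.
by apply: contrapT => h'; apply: nx; right.
Qed.

(** The preimages under the limit [e] are invariant up to a null set for each t, which is what
    [invariant_sets] asks; this makes [e] measurable for the invariant sets. *)
Lemma cauchy_keplerian : keplerian_shear mu g.
Proof.
have [g0 gD _] := g_flow.
move=> f /sq_intP sf.
have fconv phi : sq_int mu phi -> cauchy_oo (pairing mu g f phi).
  by move=> sp; apply: (pairing_cauchy g_meas g_pres g_conv).
have [e [se he einv]] := weak_limit_exists g_meas g_pres g0 gD sf fconv.
have ie := sq_int_integrable fin se.
have me : measurable_fun setT e by case: se.
exists e; split.
- move=> B mB; have mA : measurable (e @^-1` B : set (borel Omega)).
    by rewrite -[X in measurable X]setTI; exact: me.
  split=> // t.
  have mgA : measurable ((g t : borel Omega -> borel Omega) @^-1` (e @^-1` B)).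
    by rewrite -[X in measurable X]setTI; exact: g_meas.
  have [N [mN N0 hN]] := einv t.
  apply/eqP; rewrite eq_le measure_ge0 andbT -N0; apply: le_measure; rewrite ?inE//.
    by apply: measurableU; exact: measurableD.
  move=> x hx; apply: hN => /= /(_ Logic.I)[ex].
  by case: hx => -[/= h1 h2]; apply: h2; rewrite /= ?ex// -ex.
- exact: ie.
- move=> A IA; have mA : measurable A by case: IA.
  have s1 : sq_int mu (\1_A) by apply: bmf_sq_int => //; exact: bmf_indic.
  have iff := sq_int_integrable fin sf.
  rewrite (EFin_Rintegral mA ie) (EFin_Rintegral mA iff); congr EFin.
  rewrite Rintegral_indic [RHS]Rintegral_indic.
  (* On an invariant set the correlation does not depend on t, so its limit, given by [e], is its
     value, given by [f]. *)
  have := he _ s1; under eq_cvg do rewrite (invariant_pairing _ IA sf).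
  move=> h; have h' : (fun _ : R => \int[mu]_x (f x * \1_A x)) t @[t --> +oo] -->
    \int[mu]_x (f x * \1_A x) by exact: cvg_cst.
  by rewrite -(cvg_lim (@norm_hausdorff _ _) h) (cvg_lim (@norm_hausdorff _ _) h').
- exact/sq_intP.
- move=> phi /sq_intP sp.
  rewrite (EFin_Rintegral (A := setT) measurableT (sq_int_mul se sp)).
  rewrite (_ : (fun t => _) = EFin \o pairing mu g f phi).
    by apply: cvg_EFin; [exact: nearW|exact: he].
  apply/funext => t; have [sft _] := pres_sq_int g_meas g_pres t sf.
  exact: (EFin_Rintegral (A := setT) measurableT (sq_int_mul sft sp)).
Qed.

End keplerian.

(** * Gluing the charts *)

Section chart_cover.
Context {R : realType} {M Omega : ptopologicalType}.
Variables (mu : probability (borel Omega) R) (g : R -> Omega -> Omega).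
Variables (proj : Omega -> M) (D : nat -> set M).
Hypothesis g_meas : forall t, measurable_fun setT (g t : borel Omega -> borel Omega).
Hypothesis proj_meas : measurable_fun setT (proj : borel Omega -> borel M).
Hypothesis D_open : forall k, open (D k).
Hypothesis D_cover : \bigcup_k D k = setT.
Hypothesis g_proj : forall t o, proj (g t o) = proj o.
Hypothesis chart_pres : forall k t (A : set (borel Omega)), measurable A ->
  mu ((g t : borel Omega -> borel Omega) @^-1` A `&` proj @^-1` D k) = mu (A `&` proj @^-1` D k).
Hypothesis chart_conv : forall k (A : set (borel Omega)) phi, measurable A -> bmf phi ->
  cauchy_oo (fun t => \int[mu]_o (\1_A (g t o) * phi o * \1_(proj @^-1` D k) o)).

(** Disjoint pieces, each inside the fibres over one chart; they are unions of fibres, so the flow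
    preserves them. *)
Let Q k : set (borel Omega) := proj @^-1` (seqDU D k).

Let mQ k : measurable (Q k).
Proof.
have mD j : measurable (D j : set (borel M)) by exact: borel_open.
rewrite /Q -[X in measurable X]setTI; apply: proj_meas => //.
rewrite /seqDU; apply: measurableD; first exact: mD.
by apply: bigsetU_measurable => j _; exact: mD.
Qed.

Let QU : \bigcup_k Q k = setT.
Proof.
by rewrite /Q -preimage_bigcup -seqDU_bigcup_eq D_cover preimage_setT.
Qed.

Let tQ : trivIset setT Q.
Proof.
apply/trivIsetP => i j _ _ ij; rewrite /Q -preimage_setI.
by have /trivIsetP -> := @trivIset_seqDU _ D; rewrite ?preimage_set0.
Qed.

Let QD k : Q k `<=` proj @^-1` D k.
Proof. by move=> o; apply: subDsetl. Qed.

Lemma cover_pres t (A : set (borel Omega)) : measurable A ->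
  mu ((g t : borel Omega -> borel Omega) @^-1` A) = mu A.
Proof.
move=> mA; have decomp (B : set (borel Omega)) : measurable B ->
    mu B = (\sum_(0 <= k <oo) mu (B `&` Q k))%E.
  move=> mB; rewrite -[in LHS](setIT B) -QU setI_bigcupr.
  rewrite measure_bigcup//.
  - by apply: eq_eseriesl => k; rewrite in_setT.
  - by move=> k _; exact: measurableI.
  - by apply: trivIset_setIl; exact: tQ.
have mgA : measurable ((g t : borel Omega -> borel Omega) @^-1` A).
  by rewrite -[X in measurable X]setTI; exact: g_meas.
rewrite decomp// [RHS]decomp//; apply: eq_eseriesr => k _.
have hk := chart_pres k t (measurableI _ _ mA (mQ k)).
transitivity (mu (A `&` Q k `&` proj @^-1` D k)).
  rewrite -hk; congr (mu _); apply/seteqP; split=> o /=.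
    by move=> [Ao Qo]; split; [split=> //; rewrite /Q /= g_proj|exact: QD].
  by move=> [[Ao]]; rewrite /Q /= g_proj.
by congr (mu _); apply/seteqP; split=> o /= => [[]//|[Ao Qo]]; split=> //; exact: QD.
Qed.

(** Finitely many pieces carry all but a small part of the mass, and each of them is reached by
    cutting the test function. *)
Lemma cover_conv (A : set (borel Omega)) phi : measurable A -> bmf phi ->
  cauchy_oo (pairing mu g (\1_A : borel Omega -> R) phi).
Proof.
move=> mA bphi; have fin : (mu setT < +oo)%E by rewrite probability_setT ltry.
have bA t : bmf (fun o : borel Omega => \1_A (g t o) : R).
  exact: (bmf_map (g_meas t) (bmf_indic mA)).
apply: cauchy_oo_approx => e e0.
have [B B0 hB] := bmf_bound bphi.
have eB : 0 < e / (B + 1) by rewrite divr_gt0// ltr_wpDl.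
have [n hn] := bmf_bigcup_approx fin mQ eB.
pose U := \bigcup_(k < n) Q k.
have mU : measurable U by exact: bigcup_measurable.
have bU : bmf (\1_U : borel Omega -> R) by exact: bmf_indic.
exists (fun t => \int[mu]_o (\1_A (g t o) * phi o * \1_U o)).
  have bQ k : bmf (\1_(Q k) : borel Omega -> R) by exact: bmf_indic.
  rewrite /U => {hn mU bU U}; elim: n => [|n IH].
    rewrite (_ : (fun t => _) = fun=> 0); first exact: cauchy_oo_cst.
    apply/funext => t; rewrite (@eq_int _ _ _ mu _ (fun=> 0)).
      by rewrite Rintegral_cst// mul0r.
    by move=> o; rewrite (_ : \1_(\bigcup_(k < 0) Q k) o = 0) ?mulr0// indicE memNset// => -[].
  (* The cut by [Q n] goes into the test function, after which the indicator of the fibres over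
     [D n] changes nothing. *)
  rewrite (_ : (fun t => _) = (fun t => \int[mu]_o (\1_A (g t o) * phi o * \1_(\bigcup_(k < n) Q k) o)
      + \int[mu]_o (\1_A (g t o) * (phi o * \1_(Q n) o) * \1_(proj @^-1` D n) o))).
    by apply: cauchy_ooD => //; apply: chart_conv => //; exact: bmfM.
  have mUn : measurable (\bigcup_(k < n) Q k) by exact: bigcup_measurable.
  have mDn : measurable (proj @^-1` D n : set (borel Omega)).
    by rewrite -[X in measurable X]setTI; apply: proj_meas => //; exact: borel_open.
  apply/funext => t; rewrite -bmf_intD//; last 2 first.
  - by apply: bmfM; [exact: bmfM|exact: bmf_indic].
  - by apply: bmfM; [by apply: bmfM => //; exact: bmfM|exact: bmf_indic].
  apply: eq_int => o; rewrite indic_bigcup_recr// mulrDr; congr (_ + _).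
  rewrite -!mulrA; congr (_ * (_ * _)); rewrite !indicE.
  case: (boolP (o \in Q n)) => [/set_mem/QD Qo|_]; last by rewrite mul0r.
  by rewrite mem_set ?mulr1.
move=> t; have bAp : bmf (fun o : borel Omega => \1_A (g t o) * phi o) by exact: bmfM.
rewrite /pairing -bmf_intB//; last exact: bmfM.
apply: le_trans (bmf_norm_int fin _) _; first by apply: bmfB => //; exact: bmfM.
have bd : bmf (fun o : borel Omega => `|\1_(\bigcup_k Q k) o - \1_U o| : R).
  by apply: bmf_norm; apply: bmfB => //; apply: bmf_indic; exact: bigcupT_measurable.
apply: (@le_trans _ _ (\int[mu]_o (B * `|\1_(\bigcup_k Q k) o - \1_U o|))).
  apply: bmf_le_int => //.
  - by apply: bmf_norm; apply: bmfB => //; exact: bmfM.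
  - exact: bmfZ.
  move=> o; rewrite QU indicT -[X in X - _]mulr1 -mulrBr normrM ler_wpM2r//.
  rewrite normrM; apply: le_trans (hB o); rewrite ler_piMl//.
  exact: norm_indic_le1.
rewrite bmf_intZ//; apply: le_trans (ler_wpM2l B0 (hn n (leqnn _))) _.
by rewrite mulrCA ler_piMr ?(ltW e0)// ler_pdivrMr ?ltr_wpDl// mul1r lerDl.
Qed.

End chart_cover.

(** * Fourier transforms of the velocities *)

Section rajchman_modes.
Context {d : measure_display} {T : measurableType d} {R : realType}.
Variables (m : {measure set T -> \bar R}) (Y : T -> R) (nu : set R -> \bar R).
Hypothesis m_fin : (m setT < +oo)%E.
Hypothesis Y_meas : measurable_fun setT Y.
Hypothesis nuE : forall B, nu B = m (Y @^-1` (B `&` ~` [set 0])).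

Let D : set T := [set x | Y x != 0].

(** [nu] is a bare set function; it is first identified with the image under [Y] of [m] restricted
    to Y != 0. *)
Lemma integral_modes (F : R -> R) : bmf F ->
  (\int[nu]_y (F y)%:E = (\int[m]_x (F (Y x) * \1_D x))%:E)%E.
Proof.
move=> bF; have mD : measurable D by exact: measurable_neq0.
have [mnu hnu] := pushforward_measureP (mrestr m mD) Y_meas.
have -> : nu = mnu.
  rewrite hnu; apply/funext => B; rewrite nuE /pushforward /= /mrestr.
  by congr (m _); apply/seteqP; split=> x /= [? /eqP].
have fin_r : (mrestr m mD setT < +oo)%E.
  by rewrite /= /mrestr setTI (le_lt_trans _ m_fin)// le_measure ?inE.
have fin_nu : (mnu setT < +oo)%E by rewrite hnu /pushforward preimage_setT.
rewrite bmf_EFin_int// -(integral_mrestr mD m_fin (bmf_map Y_meas bF)) /=.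
rewrite (@integral_map _ _ _ _ _ (mrestr m mD) mnu Y 1 F)//; first by rewrite mul1r.
by move=> B mB; rewrite mul1e hnu.
Qed.

Let C (a t : R) : R := \int[m]_x (cos (2 * pi * t * Y x + a) * \1_D x).

Let b_cos (t a : R) : bmf (fun y : R => cos (2 * pi * t * y + a)).
Proof. exact: (bmf_cosZ _ _ (@measurable_id _ _ setT)). Qed.

Lemma fourier_cosE t : fourier_cos nu t = (C 0 t)%:E.
Proof.
rewrite /fourier_cos -(integral_modes (b_cos t 0)).
by congr (integral nu setT _); apply/funext => y; rewrite addr0.
Qed.

Lemma fourier_sinE t : fourier_sin nu t = (C (- (pi / 2)) t)%:E.
Proof.
rewrite /fourier_sin -(integral_modes (b_cos t (- (pi / 2)))).
by congr (integral nu setT _); apply/funext => y; rewrite sin_shift.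
Qed.

(** An arbitrary phase is a combination of the cosine and the sine, by the addition formula. *)
Lemma rajchman_mode_vanish : rajchman nu -> mode_vanish m Y.
Proof.
move=> [+ + _ _] a.
rewrite (_ : fourier_cos nu = EFin \o C 0); last by apply/funext => t; exact: fourier_cosE.
rewrite (_ : fourier_sin nu = EFin \o C (- (pi / 2))); last first.
  by apply/funext => t; exact: fourier_sinE.
move=> /fine_cvgP[_ /= hc] /fine_cvgP[_ /= hs].
have hC : cos a * C 0 t + - sin a * C (- (pi / 2)) t @[t --> +oo] --> cos a * 0 + - sin a * 0.
  by apply: cvgD; exact: cvgMl_tmp.
rewrite !mulr0 addr0 in hC; apply: cvg_trans hC; apply: near_eq_cvg; apply: nearW => t.
have bC b : bmf (fun x => cos (2 * pi * t * Y x + b) * \1_D x).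
  by apply: bmfM; [exact: bmf_cosZ|apply: bmf_indic; exact: measurable_neq0].
rewrite /C /= -!bmf_intZ// -bmf_intD//; [|exact: bmfZ|exact: bmfZ].
by apply: eq_int => x; rewrite -sin_shift addr0 cosD; ring.
Qed.

(** The limits at -oo follow from those at +oo by parity. *)
Lemma mode_vanish_rajchman : mode_vanish m Y -> rajchman nu.
Proof.
move=> hC; rewrite /rajchman.
rewrite (_ : fourier_cos nu = EFin \o C 0); last by apply/funext => t; exact: fourier_cosE.
rewrite (_ : fourier_sin nu = EFin \o C (- (pi / 2))); last first.
  by apply/funext => t; exact: fourier_sinE.
have Cneg t : C 0 (- t) = C 0 t.
  by apply: eq_int => x; rewrite !addr0 mulrN mulNr cosN.
have Sneg t : C (- (pi / 2)) (- t) = - C (- (pi / 2)) t.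
  have bS : bmf (fun x => cos (2 * pi * t * Y x - pi / 2) * \1_D x).
    apply: bmfM; first exact: bmf_cosZ.
    by apply: bmf_indic; exact: measurable_neq0.
  rewrite -[RHS]mulN1r -bmf_intZ//; apply: eq_int => x.
  by rewrite -!sin_shift mulrN mulNr sinN mulN1r mulNr.
split.
- by apply: cvg_EFin; [exact: nearW|exact: hC].
- by apply: cvg_EFin; [exact: nearW|exact: hC].
- apply: cvg_EFin; first exact: nearW.
  apply/cvgNy_compNP; rewrite (_ : _ \o _ = C 0); first exact: hC.
  by apply/funext => t; rewrite /= Cneg.
- apply: cvg_EFin; first exact: nearW.
  apply/cvgNy_compNP; rewrite (_ : _ \o _ = (fun t => - C (- (pi / 2)) t)).
    apply/cvg_oo0P => e e0; have /cvg_oo0P/(_ e e0)[T0 hT] := hC (- (pi / 2)).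
    by exists T0 => t /hT; rewrite normrN.
  by apply/funext => t; rewrite /= Sneg.
Qed.

End rajchman_modes.

(** * Countable covers by charts and the equivalence *)

Lemma lindelof_charts {R : realType} {M : ptopologicalType} {n k : nat} (A : atlas R M n) :
  Ck_manifold k A -> lindelof M -> exists U : nat -> A, \bigcup_i dom A (U i) = setT.
Proof.
move=> [_ cov hU _] lM.
have [F' [F'sub cF' F'cov]] := lM (range (dom A)) (ltac:(move=> _ [U _ <-]; by have [] := hU U))
  (ltac:(apply/seteqP; split=> // x _; have [U Ux] := cov x; by exists (dom A U) => //; exists U)).
have /countable_injP[f finj] := cF'.
(* Indices that code no member of the subcover receive an arbitrary chart. *)
have hsel i : exists U : A, forall B, F' B -> f B = i -> dom A U = B.
  have [[B [FB fB]]|nB] := pselect (exists B, F' B /\ f B = i).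
    have [U _ UB] := F'sub B FB; exists U => B' FB' fB'.
    by rewrite UB; apply: finj; rewrite ?inE// fB fB'.
  have [U _] := cov point; exists U => B FB fB; exfalso; apply: nB; by exists B.
have [U hUi] := choice hsel; exists U; apply/seteqP; split=> // x _.
have [B FB Bx] : (\bigcup_(O' in F') O') x by rewrite F'cov.
by exists (f B) => //; rewrite (hUi _ B FB).
Qed.

Lemma preimage_setI_eq {X Z : Type} (f1 f2 : X -> Z) (D : set X) (B : set Z) :
  (forall x, D x -> f1 x = f2 x) -> f1 @^-1` B `&` D = f2 @^-1` B `&` D.
Proof. by move=> f12; apply/seteqP; split=> x [/= ? Dx]; split=> //=; rewrite ?f12// -f12. Qed.

Theorem theorem6p5 (R : realType)
  (d : nat) (G : topGroupType) (AG : atlas R G d)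
  (G_lie : lie_group AG) (G_compact : compact [set: G])
  (G_connected : connected [set: G])
  (E : AG) (E_one : dom AG E 1%g)
  (expG : 'rV[R]_d -> G) (expG_exp : lie_exponential E expG)
  (haar : probability (borel G) R) (haar_inv : haar_probability haar)
  (n : nat) (M : ptopologicalType) (AM : atlas R M n)
  (M_C1 : Ck_manifold 1 AM) (M_lindelof : lindelof M)
  (Omega : ptopologicalType) (proj : Omega -> M) (psi : AM -> Omega -> M * G)
  (bundle : g_bundle proj psi)
  (mu : probability (borel Omega) R)
  (mu_compat : compatible_measure proj psi haar mu)
  (g : R -> Omega -> Omega) (g_flow : flow g)
  (v : AM -> M -> 'rV[R]_d)
  (g_compat : compatible_flow expG proj psi g v)
  (T : set G) (T_max : maximal_torus T)
  (r : nat) (chi : G -> 'rV[circle R]_r) (chi_iso : torus_iso AG T chi)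
  (h : 'rV[R]_d -> G)
  (h_meas : measurable_fun setT (h : borel 'rV[R]_d -> borel G))
  (h_conj : forall u : 'rV[R]_d,
     orbit_closure expG u `<=` [set (h u * s * (h u)^-1)%g | s in T]) :
  let w (U : AM) (x : M) : 'rV[R]_r :=
    Dchi expG chi (Ad E expG (h (v U x))^-1%g (v U x)) in
  let mu' := pushforward mu (proj : borel Omega -> borel M) in
  let nu (xi : 'rV[int]_r) (U : AM) : set R -> \bar R :=
    pushforward (restr mu' (dom AM U))
      ((fun x => dot_int xi (w U x)) : borel M -> R) in
  keplerian_shear mu g <->
  forall (xi : 'rV[int]_r) (U : AM), xi != 0 ->
    rajchman (restr (nu xi U) (~` [set 0])).
Proof.
move=> w mu' nu.
have [smG smul sinv] := G_lie.
have [G_hausdorff _ _ _] := smG 0%N.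
have G_base := countable_base_compact (smG 0%N) G_compact.
have mul_meas := measurable_mulg G_lie G_compact.
have mul_cont := continuous_mulg_at G_lie.
have inv_cont : continuous (fun a : G => a^-1%g).
  by have [invc _] := sinv; exact/continuous_subspace_setT.
have [torT _] := T_max; have [subT _ _ _] := torT.
have [q qT] := torus_paramP subT chi_iso.
have q_char (xi : 'rV[int]_r) (a : R) : exists k : G -> R,
    [/\ continuous k, forall z, `|k z| <= 1 &
      forall u, k (q u) = cos (2 * pi * dot_int xi u + a)].
  apply: (torus_char_ext (tau := fun x => cos (2 * pi * x + a)) xi
    G_hausdorff G_compact torT chi_iso qT).
  - move=> x; apply: continuous_comp; last exact: continuous_cos.
    by apply: cvgD; [apply: cvgM; [exact: cvg_cst|exact: cvg_id]|exact: cvg_cst].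
  - move=> x z; have -> : 2 * pi * (x + z%:~R) + a = (2 * pi * x + a) + 2 * pi * z%:~R by ring.
    exact: cosDz2pi.
  - by move=> x; exact: norm_cos_le1.
have [proj_cont hpsi] := bundle.
have [g0 gD g_meas] := g_flow.
have proj_meas := continuous_borel proj_cont.
have [m0 m0E] := pushforward_measureP mu proj_meas.
have [_ M_cover M_charts _] := M_C1.
have domO U : open (dom AM U) by have [] := M_charts U.
have g_comp U t o : (proj @^-1` dom AM U) o -> (proj @^-1` dom AM U) (g t o) /\
    psi U (g t o) = (proj o, (expG (t *: v U (proj o)) * (psi U o).2)%g).
  move=> Po; have [_ psi1] := hpsi U; have [_ hc] := g_compat U.
  apply: hc => //; rewrite -(psi1 o Po).
  by case: (psi U o).
have g_proj t o : proj (g t o) = proj o.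
  have [U Ux] := M_cover (proj o); have [Pg pg] := g_comp U t o Ux.
  by have [_ psi1] := hpsi U; rewrite -(psi1 _ Pg) pg.
have chart U :
  [/\ forall t (A : set (borel Omega)), measurable A ->
        mu ((g t : borel Omega -> borel Omega) @^-1` A `&` proj @^-1` dom AM U) =
        mu (A `&` proj @^-1` dom AM U),
      (forall xi : 'rV[int]_r, xi != 0 -> rajchman (restr (nu xi U) (~` [set 0]))) ->
      forall (A : set (borel Omega)) (phi : borel Omega -> R), measurable A -> bmf phi ->
        cauchy_oo (fun t => \int[mu]_o (\1_A (g t o) * phi o * \1_(proj @^-1` dom AM U) o)) &
      (forall f phi : borel Omega -> R, bmf f -> bmf phi ->
         cauchy_oo (fun t => \int[mu]_o (f (g t o) * phi o))) ->
      forall xi : 'rV[int]_r, rajchman (restr (nu xi U) (~` [set 0]))].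
  have mD : measurable (dom AM U : set (borel M)) by exact: borel_open.
  have [vU_meas _] := g_compat U.
  (* Extending the velocity by a constant makes it measurable on all of M. The conjugation into the
     torus then holds at every point, because [h_conj] speaks of all of Lie(G), and [w'] agrees with
     [w U] over the chart. *)
  pose v' : borel M -> borel 'rV[R]_d := (v U : borel M -> borel 'rV[R]_d) \_ (dom AM U).
  have v'_meas : measurable_fun setT v' by exact/(measurable_restrictT _ mD).
  have v'E x : dom AM U x -> v' x = v U x by move=> Ux; rewrite /v' patchT// mem_set.
  have v'_off x : ~ dom AM U x -> v' x = point.
    by move=> Ux; rewrite /v' patchC// inE.
  pose w' (x : M) : 'rV[R]_r := Dchi expG chi (Ad E expG (h (v' x))^-1%g (v' x)).
  have w'E x : dom AM U x -> w' x = w U x by move=> Ux; rewrite /w' v'E.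
  have conj t x : ((h (v' x))^-1 * expG (t *: v' x) * h (v' x))%g = q (t *: w' x).
    apply: (exp_conj_torus G_lie E_one expG_exp chi_iso qT) => s.
    have [z Tz <-] : [set (h (v' x) * s * (h (v' x))^-1)%g | s in T] (expG (s *: v' x)).
      by apply: h_conj; apply: subset_closure; exists s.
    by rewrite !mulgA mulVg mul1g -mulgA mulVg mulg1.
  have [m mE] : exists m : {measure set (borel M) -> \bar R},
      m = restr mu' (dom AM U) :> (set (borel M) -> \bar R).
    by exists (mrestr m0 mD); apply/funext => A; rewrite /= /mrestr /restr m0E.
  have [psi_homeo psi1] := hpsi U.
  have [_ _ [gam gamK gam_cont]] := psi_homeo.
  have comp' t o : (proj @^-1` dom AM U) o -> (proj @^-1` dom AM U) (g t o) /\
      psi U (g t o) = (proj o, (expG (t *: v' (proj o)) * (psi U o).2)%g).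
    by move=> Po; rewrite v'E//; exact: g_comp.
  have mu_comp (B : set (borel M * borel G)) : measurable B ->
      mu (proj @^-1` dom AM U `&` psi U @^-1` B) = (m \x haar)%E B.
    by move=> mB; rewrite mE -(mu_compat U B mB) /pushforward /restr setIC.
  have [h1 h2 h3 h4] := @chart_equivalence R M Omega G d r proj (psi U) (dom AM U) mu haar g
    expG v' h q w' m (domO U) (countable_base_chart U M_C1) G_base proj_cont psi_homeo psi1
    g_meas comp' v'_meas h_meas mul_meas inv_cont haar_inv conj _ v'_off mE mu_comp gam gamK
    gam_cont G_compact G_hausdorff mul_cont (param_cont qT) (paramD qT) (param1 qT) q_char.
  have fin : (m setT < +oo)%E by exact: (m_fin (domO U) proj_cont mE).
  (* The measure only weighs points of the chart, where the two velocities coincide. *)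
  have nuE xi B : restr (nu xi U) (~` [set 0]) B =
      m ((fun x : borel M => dot_int xi (w' x)) @^-1` (B `&` ~` [set 0])).
    rewrite mE; apply: (congr1 mu').
    by apply: preimage_setI_eq => x Ux; rewrite (w'E x Ux).
  split=> //.
  - by move=> hr; apply: h3 => xi xi0; apply: (rajchman_mode_vanish fin (h2 xi) (nuE xi)); exact: hr.
  - by move=> hc xi; apply: (mode_vanish_rajchman fin (h2 xi) (nuE xi)); exact: h4.
split=> [hK xi U _|hr].
  have [_ _ hU] := chart U; apply: hU => f phi bf bphi.
  exact: (keplerian_cauchy hK bf bphi).
have [U Ucov] := lindelof_charts M_C1 M_lindelof.
have pres t (A : set (borel Omega)) : measurable A ->
    mu ((g t : borel Omega -> borel Omega) @^-1` A) = mu A.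
  apply: (cover_pres g_meas proj_meas (fun k => domO (U k)) Ucov g_proj).
  by move=> k; have [] := chart (U k).
apply: (cauchy_keplerian g_flow pres) => A phi mA bphi.
apply: (cover_conv g_meas proj_meas (fun k => domO (U k)) Ucov) => // k A' phi' mA' bphi'.
have [_ hc _] := chart (U k); apply: hc => // xi xi0; exact: hr.
Qed.
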